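(* Let $X_{ij}$ ($1\le i\le n$, $1\le j\le d$), $\mathbf{W}$, $\Sigma$, $\mathbf{Z}$, $Z_i$ be as in the context, and let $P(\mathbf{w})=A+\sum_{i=1}^dB_i|w_i|^{r_i}$ with $A\ge0$, $B_i\ge0$, $r_i\ge0$. Assume that $\mathbb{E}|X_{ij}|^{r_k+4}<\infty$ for all $i,j$ and $1\le k\le d$. Suppose $\Sigma$ is non-negative definite and that $\mathbb{E}X_{ij}X_{ik}X_{il}=0$ for all $1\le i\le n$ and $1\le j,k,l\le d$. Suppose $g\in C_P^4(\mathbb{R}^d)$. Then, for $h\in C_b^4(\mathbb{R})$, \begin{align*} &|\mathbb{E}h(g(\mathbf{W}))-\mathbb{E}h(g(\Sigma^{1/2}\mathbf{Z}))|\\ &\le\frac{h_4}{24n^{2}}\sum_{i=1}^n\sum_{j,k,l,m=1}^d\bigg\{A\mathbb{E}|X_{ij}X_{ik}X_{il}X_{im}|+\sum_{t=1}^d 2^{r_t}B_t\bigg(2^{r_t}\mathbb{E}|X_{ij}X_{ik}X_{il}X_{im}|\,\mathbb{E}|W_t|^{r_t}\\ &\quad+\frac{2^{r_t}}{n^{r_t/2}}\mathbb{E}\big[|X_{ij}X_{ik}X_{il}X_{im}||X_{it}|^{r_t}\big]+\mathbb{E}|Z_t|^{r_t}\,\mathbb{E}|X_{ij}X_{ik}X_{il}X_{im}|\bigg)\\ &\quad+9|\mathbb{E}X_{ij}X_{ik}|\bigg[A\mathbb{E}|X_{il}X_{im}|+\sum_{t=1}^d 2^{r_t}B_t\bigg(2^{r_t}\mathbb{E}|X_{il}X_{im}|\,\mathbb{E}|W_t|^{r_t}+\frac{2^{r_t}}{n^{r_t/2}}\mathbb{E}\big[|X_{il}X_{im}||X_{it}|^{r_t}\big]+\mathbb{E}|Z_t|^{r_t}\,\mathbb{E}|X_{il}X_{im}|\bigg)\bigg]\bigg\}.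 \end{align*}
   Context: Setting: $X_{ij}$, $1\le i\le n$, $1\le j\le d$, are mean-zero real random variables, not necessarily identically distributed; the vectors $\mathbf{X}_i=(X_{i,1},\ldots,X_{i,d})^T$, $i=1,\ldots,n$, are independent, while for fixed $i$ the components $X_{i,1},\ldots,X_{i,d}$ may be dependent. $W_j=\frac{1}{\sqrt n}\sum_{i=1}^nX_{ij}$, $\mathbf{W}=(W_1,\ldots,W_d)^T$, and $\Sigma=(\sigma_{jk})$ is the covariance matrix of $\mathbf{W}$. $\mathbf{Z}$ is a standard $d$-dimensional normal vector, $\Sigma^{1/2}$ is the unique non-negative definite square root of $\Sigma$, and $Z_i=(\Sigma^{1/2}\mathbf{Z})_i\sim N(0,\sigma_{ii})$. $C_b^k(I)$: real-valued functions on $I$ whose (partial) derivatives of order $k$ all exist and are bounded. A function $g:\mathbb{R}^d\to\mathbb{R}$ is in $C_P^m(\mathbb{R}^d)$, where $P(\mathbf{w})=A+\sum_{i=1}^dB_i|w_i|^{r_i}$ with $A,B_i,r_i\ge0$, if all $m$-th order partial derivatives of $g$ exist and for all $\mathbf{w}\in\mathbb{R}^d$, all $k=1,\ldots,m$ and all indices $i_1,\ldots,i_k$, $\Big|\frac{\partial^kg(\mathbf{w})}{\prod_{j=1}^k\partial w_{i_j}}\Big|^{m/k}\le P(\mathbf{w})$. Further, $h_m=\sum_{j=1}^m{m\brace j}\|h^{(j)}\|$ with $\|\cdot\|$ the supremum norm and ${m\brace j}$ the Stirling numbers of the second kind. *)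

(* Defs.v *)
From HB Require Import structures.
From mathcomp Require Import all_boot all_order all_algebra.
From mathcomp Require Import all_classical all_reals all_analysis.

Set Implicit Arguments.
Unset Strict Implicit.
Unset Printing Implicit Defensive.

Import Order.TTheory GRing.Theory Num.Theory.
Import numFieldNormedType.Exports.

Local Open Scope classical_set_scope.
Local Open Scope ring_scope.

(* [G i] is meant to be a sigma-algebra on [T]: the events of the [i]-th
   family member. *)
Definition mutually_independent (disp : measure_display)
    (T : measurableType disp) (R : realType) (P : probability T R)
    (I : finType) (G : I -> set (set T)) : Prop :=
  forall (J : {set I}) (A : I -> set T), (forall i, i \in J -> G i (A i)) ->
    P (\bigcap_(i in [set` J]) A i) = (\prod_(i in J) P (A i))%E.

(* Each row [X i] generates a sigma-algebra jointly from all its components,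
   so that nothing is required of the components within a row. *)
Definition independent_vectors (disp : measure_display)
    (T : measurableType disp) (R : realType) (P : probability T R)
    (n d : nat) (X : 'I_n -> 'I_d -> {RV P >-> R}) : Prop :=
  mutually_independent P
    (fun i => g_sigma_preimage (fun j => X i j : T -> R)).

Definition standard_normal_vector (disp : measure_display)
    (T : measurableType disp) (R : realType) (P : probability T R)
    (d : nat) (Z : 'I_d -> {RV P >-> R}) : Prop :=
  (forall j (B : set R), measurable B ->
     distribution P (Z j) B = normal_prob 0 1 B) /\
  mutually_independent P
    (fun j => preimage_set_system setT (Z j : T -> R) measurable).

Definition random_vector (T : Type) (R : realType) (d : nat)
    (Z : 'I_d -> T -> R) (x : T) : 'cV[R]_d := \col_j Z j x.

Definition normalized_sum (T : Type) (R : realType) (n d : nat)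
    (X : 'I_n -> 'I_d -> T -> R) (x : T) : 'cV[R]_d :=
  \col_j ((Num.sqrt n%:R)^-1 * \sum_(i < n) X i j x).

Definition covariance_matrix (disp : measure_display)
    (T : measurableType disp) (R : realType) (P : probability T R)
    (d : nat) (V : T -> 'cV[R]_d) : 'M[R]_d :=
  \matrix_(j, k) fine (covariance P (fun x => V x j 0) (fun x => V x k 0)).

Definition nonneg_definite (R : realType) (d : nat) (M : 'M[R]_d) : Prop :=
  M^T = M /\ forall v : 'cV[R]_d, 0 <= (v^T *m M *m v) 0 0.

Definition nonneg_definite_sqrt (R : realType) (d : nat) (M S : 'M[R]_d)
    : Prop :=
  nonneg_definite S /\ S *m S = M.

(* [partial [:: i_1; ...; i_k] g] is the iterated partial derivative
   d/dw_(i_1) ... d/dw_(i_k) g; it is meaningful when the successive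
   derivatives exist, since ['D_v] is total. *)
Definition partial (R : realType) (d : nat) (s : seq 'I_d)
    (g : 'cV[R]_d -> R) : 'cV[R]_d -> R :=
  foldr (fun i f w => 'D_(delta_mx i 0) f w) g s.

Definition growth (R : realType) (d : nat) (A : R) (B r : 'I_d -> R)
    (w : 'cV[R]_d) : R :=
  A + \sum_(i < d) B i * `|w i 0| `^ r i.

Definition CP (R : realType) (d : nat) (p : 'cV[R]_d -> R) (m : nat)
    (g : 'cV[R]_d -> R) : Prop :=
  (forall (s : seq 'I_d) i w, (size s < m)%N ->
     derivable (partial s g) w (delta_mx i 0)) /\
  (forall (s : seq 'I_d) w, (0 < size s <= m)%N ->
     `|partial s g w| `^ (m%:R / (size s)%:R) <= p w).

(* Only the derivative of order exactly [k] is required to be bounded; the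
   lower ones merely exist. Accordingly [sup_norm] and [hconst] below are
   extended reals. *)
Definition Cb (R : realType) (k : nat) (h : R -> R) : Prop :=
  (forall j x, (j < k)%N -> derivable (derive1n j h) x 1) /\
  (exists M : R, forall x, `|derive1n k h x| <= M).

Fixpoint stirling2 (m j : nat) : nat :=
  match m, j with
  | 0, 0 => 1
  | 0, _.+1 => 0
  | _.+1, 0 => 0
  | m'.+1, j'.+1 => j'.+1 * stirling2 m' j'.+1 + stirling2 m' j'
  end.

Definition sup_norm (R : realType) (f : R -> R) : \bar R :=
  ereal_sup [set `|f x|%:E | x in setT].

Definition hconst (R : realType) (m : nat) (h : R -> R) : \bar R :=
  (\sum_(1 <= j < m.+1) (stirling2 m j)%:R%:E * sup_norm (derive1n j h))%E.

(* Main.v *)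
Require Import Defs.
From HB Require Import structures.
From mathcomp Require Import all_boot all_order all_algebra.
From mathcomp Require Import all_classical all_reals all_analysis.
From mathcomp Require Import measurable_realfun lebesgue_integral_fubini.
From mathcomp Require Import ring lra.

Set Implicit Arguments.
Unset Strict Implicit.
Unset Printing Implicit Defensive.

Import Order.TTheory GRing.Theory Num.Theory.
Import numFieldNormedType.Exports.

Local Open Scope classical_set_scope.
Local Open Scope ring_scope.

Section real_integral.
Context {disp : measure_display} {T : measurableType disp} {R : realType}.
Variable P : {measure set T -> \bar R}.
Implicit Types f g : T -> R.

Definition integrable_real f := P.-integrable setT (EFin \o f).

Lemma integrable_real_measurable f : integrable_real f -> measurable_fun setT f.
Proof. by move=> fi; apply/measurable_EFinP; exact: measurable_int fi. Qed.

Lemma integrable_realD f g : integrable_real f -> integrable_real g ->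
  integrable_real (fun x => f x + g x).
Proof. exact: integrableD. Qed.

Lemma integrable_realB f g : integrable_real f -> integrable_real g ->
  integrable_real (fun x => f x - g x).
Proof. exact: integrableB. Qed.

Lemma integrable_realZ (c : R) f : integrable_real f ->
  integrable_real (fun x => c * f x).
Proof. exact: integrableZl. Qed.

Lemma integrable_real_sum (I : Type) (s : seq I) (f : I -> T -> R) :
  (forall i, integrable_real (f i)) -> integrable_real (fun x => \sum_(i <- s) f i x).
Proof.
move=> fi; elim: s => [|i s IH].
  rewrite /integrable_real (_ : _ \o _ = cst 0%E); first exact: integrable0.
  by apply/funext => x /=; rewrite big_nil.
rewrite (_ : (fun x => \sum_(i <- i :: s) f i x) =
  (fun x => f i x + \sum_(i <- s) f i x)); last first.
  by apply/funext => x; rewrite big_cons.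
exact: integrable_realD.
Qed.

Lemma integrable_real_le f g : measurable_fun setT f -> integrable_real g ->
  (forall x, `|f x| <= g x) -> integrable_real f.
Proof.
move=> mf gi fg; apply: (le_integrable _ _ _ gi) => //.
  exact/measurable_EFinP.
by move=> x _; rewrite /= lee_fin (le_trans (fg x))// ler_norm.
Qed.

Lemma integrable_real_norm f : integrable_real f -> integrable_real (fun x => `|f x|).
Proof. exact: integrable_norm. Qed.

Lemma rintegral0 : \int[P]_x (0 : R) = 0.
Proof. by rewrite /Rintegral integral0. Qed.

Lemma rintegralD f g : integrable_real f -> integrable_real g ->
  \int[P]_x (f x + g x) = \int[P]_x f x + \int[P]_x g x.
Proof. exact: RintegralD. Qed.

Lemma rintegralB f g : integrable_real f -> integrable_real g ->
  \int[P]_x (f x - g x) = \int[P]_x f x - \int[P]_x g x.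
Proof. exact: RintegralB. Qed.

Lemma rintegralZ (c : R) f : integrable_real f ->
  \int[P]_x (c * f x) = c * \int[P]_x f x.
Proof. exact: RintegralZl. Qed.

Lemma rintegral_sum (I : Type) (s : seq I) (f : I -> T -> R) :
  (forall i, integrable_real (f i)) ->
  \int[P]_x (\sum_(i <- s) f i x) = \sum_(i <- s) \int[P]_x f i x.
Proof.
move=> fi; elim: s => [|i s IH].
  by rewrite big_nil (_ : (fun x => _) = (fun=> 0)) ?rintegral0//; apply/funext => x; rewrite big_nil.
rewrite big_cons -IH -rintegralD//; last exact: integrable_real_sum.
by congr Rintegral; apply/funext => x; rewrite big_cons.
Qed.

Lemma rintegral_le f g : integrable_real f -> integrable_real g ->
  (forall x, f x <= g x) -> \int[P]_x f x <= \int[P]_x g x.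
Proof. by move=> fi gi fg; apply: le_Rintegral. Qed.

Lemma rintegral_norm_le f g : integrable_real f -> integrable_real g ->
  (forall x, `|f x| <= g x) -> `|\int[P]_x f x| <= \int[P]_x g x.
Proof.
move=> fi gi fg; apply: (le_trans (le_normr_Rintegral _ fi)) => //.
by apply: rintegral_le => //; exact: integrable_real_norm.
Qed.

Lemma EFin_rintegral f : integrable_real f -> (\int[P]_x f x)%:E = (\int[P]_x (f x)%:E)%E.
Proof. by move=> fi; rewrite /Rintegral fineK//; exact: (integrable_fin_num measurableT fi). Qed.

End real_integral.

Section real_integral_probability.
Context {disp : measure_display} {T : measurableType disp} {R : realType}.
Variable P : probability T R.

Lemma integrable_real_cst (c : R) : integrable_real P (fun=> c).
Proof. exact: finite_measure_integrable_cst. Qed.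

Lemma rintegral_cst (c : R) : \int[P]_x c = c.
Proof.
rewrite /Rintegral integral_cst//.
by transitivity (fine (c%:E * 1)%E);
  [congr (fine (_ * _)%E); exact: probability_setT|rewrite mule1].
Qed.

End real_integral_probability.

Section real_fubini.
Context {d1 d2 : measure_display} {T1 : measurableType d1} {T2 : measurableType d2}
  {R : realType}.
Variables (P : probability T1 R) (Q : probability T2 R).

Lemma integrable_prod_le (f : T1 * T2 -> R) (a : T1 -> R) (b : T2 -> R) :
  measurable_fun setT f -> integrable_real P a -> integrable_real Q b ->
  (forall x, 0 <= a x) -> (forall y, 0 <= b y) ->
  (forall x y, `|f (x, y)| <= a x * b y) ->
  integrable_real (P \x Q)%E f.
Proof.
move=> mf ia ib a0 b0 fab.
have mab : measurable_fun setT (fun z : T1 * T2 => a z.1 * b z.2).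
  apply: measurable_funM.
    apply: (@measurableT_comp _ _ _ _ _ _ a); last exact: measurable_fst.
    exact: integrable_real_measurable ia.
  apply: (@measurableT_comp _ _ _ _ _ _ b); last exact: measurable_snd.
  exact: integrable_real_measurable ib.
apply: (@integrable_real_le _ _ _ _ _ (fun z => a z.1 * b z.2)) => //; last first.
  by move=> [x y]; exact: fab.
apply/integrable12ltyP; first exact/measurable_EFinP.
under eq_integral => x _.
  under eq_integral => y _.
    rewrite /= ger0_norm ?mulr_ge0// EFinM.
    over.
  rewrite /= integralZl// -EFin_rintegral//.
  over.
by rewrite /= integralZr// -EFin_rintegral// -EFinM ltry.
Qed.

Lemma rintegral_prod12 (f : T1 * T2 -> R) : integrable_real (P \x Q)%E f ->
  (forall x, integrable_real Q (fun y => f (x, y))) ->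
  \int[(P \x Q)%E]_z f z = \int[P]_x \int[Q]_y f (x, y).
Proof.
move=> fi fix_; rewrite /Rintegral -(integral12_prod_meas1 fi); congr fine.
by apply: eq_integral => x _; rewrite /fubini_F /= EFin_rintegral.
Qed.

Lemma rintegral_prod21 (f : T1 * T2 -> R) : integrable_real (P \x Q)%E f ->
  (forall y, integrable_real P (fun x => f (x, y))) ->
  \int[(P \x Q)%E]_z f z = \int[Q]_y \int[P]_x f (x, y).
Proof.
move=> fi fix_; rewrite /Rintegral -(integral21_prod_meas1 fi); congr fine.
by apply: eq_integral => x _; rewrite /fubini_G /= EFin_rintegral.
Qed.

Lemma integrable_prod_fst (f : T1 * T2 -> R) : integrable_real (P \x Q)%E f ->
  (forall x, integrable_real Q (fun y => f (x, y))) ->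
  integrable_real P (fun x => \int[Q]_y f (x, y)).
Proof.
move=> fi fix_; have := integrable_fubini_F fi.
by congr (_.-integrable _ _); apply/funext => x; rewrite /= EFin_rintegral.
Qed.

Lemma integrable_prod_snd (f : T1 * T2 -> R) (a : T1 -> R) (b : T2 -> R) :
  measurable_fun setT f -> integrable_real P a -> integrable_real Q b ->
  (forall x, 0 <= a x) -> (forall y, 0 <= b y) ->
  (forall x y, `|f (x, y)| <= a x * b y) ->
  integrable_real Q (fun y => \int[P]_x f (x, y)).
Proof.
move=> mf ia ib a0 b0 fab.
have fi := integrable_prod_le mf ia ib a0 b0 fab.
have fiy y : integrable_real P (fun x => f (x, y)).
  apply: (@integrable_real_le _ _ _ _ _ (fun x => b y * a x)).
  - exact: measurable_fun_pair1.
  - exact: integrable_realZ.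
  - by move=> x; rewrite mulrC.
apply: (@integrable_real_le _ _ _ _ _ (fun y => (\int[P]_x a x) * b y)).
- apply/measurable_EFinP; have := measurable_fubini_G fi.
  by congr (measurable_fun _ _); apply/funext => y; rewrite /= EFin_rintegral.
- exact: integrable_realZ.
- move=> y; rewrite mulrC -rintegralZ//; apply: rintegral_norm_le => //.
    exact: integrable_realZ.
  by move=> x; rewrite mulrC.
Qed.

End real_fubini.

Lemma mean_value_ineq (R : realType) (f df g dg : R -> R) (a b : R) :
  a <= b ->
  (forall t : R, is_derive t 1 f (df t)) -> (forall t : R, is_derive t 1 g (dg t)) ->
  (forall t, a <= t <= b -> `|df t| <= dg t) ->
  `|f b - f a| <= g b - g a.
Proof.
move=> ab fD gD dfg.
have mono (h dh : R -> R) : (forall t : R, is_derive t 1 h (dh t)) ->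
    (forall t, a <= t <= b -> 0 <= dh t) -> h a <= h b.
  move=> hD h0; have hC : {within `[a, b], continuous h}.
    apply: continuous_subspaceT => x; apply: differentiable_continuous.
    by apply/derivable1_diffP; have [] := hD x.
  have [c cab /eqP] := @MVT_segment R h dh a b ab (fun x _ => hD x) hC.
  rewrite subr_eq => /eqP ->; rewrite lerDr mulr_ge0 ?subr_ge0 ?h0//.
have pm (s : R) : `|s| <= 1 -> f a * s + g a <= f b * s + g b.
  move=> s1; apply: (mono (fun t => f t * s + g t) (fun t => df t * s + dg t)).
    move=> t; have := fD t; have := gD t => gDt fDt.
    rewrite (_ : df t * s = s *: df t); last exact: mulrC.
    have -> : (fun t => f t * s + g t) = (s *: f + g : R -> R).
      by apply/funext => u /=; rewrite mulrC.
    exact: is_deriveD.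
  move=> t tab; rewrite -lerBlDl sub0r; apply: le_trans (dfg t tab).
  have : `|df t * s| <= `|df t| by rewrite normrM ler_piMr.
  by rewrite ler_norml => /andP[? _]; lra.
have := pm 1; have := pm (-1); rewrite normrN1 normr1 lexx => /(_ isT) h1 /(_ isT) h2.
by rewrite ler_norml; apply/andP; split; lra.
Qed.

Lemma is_derive_monomial (R : realType) (c t : R) (n : nat) :
  is_derive t 1 (fun s : R => c / n.+1%:R * s ^+ n.+1) (c * t ^+ n).
Proof.
have -> : (fun s : R => c / n.+1%:R * s ^+ n.+1) = horner ((c / n.+1%:R) *: 'X^(n.+1)).
  by apply/funext => s; rewrite hornerZ hornerXn.
have -> : c * t ^+ n = ((c / n.+1%:R) *: 'X^(n.+1))^`()%R.[t].
  rewrite derivZ derivXn hornerZ hornerMn hornerXn /=.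
  by rewrite -(mulr_natl (t ^+ n)) mulrA divfK// pnatr_eq0.
exact: is_derive_poly.
Qed.

Section coordinates.
Context {R : realType} {d : nat}.
Implicit Types (w v x : 'cV[R]_d) (F : 'cV[R]_d -> R) (i : 'I_d).

Definition norm1 v : R := \sum_i `|v i 0|.

Definition pderiv i F w : R := 'D_(delta_mx i 0) F w.

Definition in_box w v x :=
  forall i, exists2 s : R, 0 <= s <= 1 & x i 0 = w i 0 + s * v i 0.

Definition coord_derivable F := forall i w, derivable F w (delta_mx i 0).

Lemma norm1_ge0 v : 0 <= norm1 v.
Proof. by apply: sumr_ge0. Qed.

Lemma norm1D v w : norm1 (v + w) <= norm1 v + norm1 w.
Proof.
by rewrite /norm1 -big_split ler_sum// => i _; rewrite mxE ler_normD.
Qed.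

Lemma norm1Z a v : norm1 (a *: v) = `|a| * norm1 v.
Proof.
by rewrite /norm1 mulr_sumr; apply: eq_bigr => i _; rewrite mxE normrM.
Qed.

Lemma le_norm1 v i : `|v i 0| <= norm1 v.
Proof. by rewrite /norm1 (bigD1 i)//= lerDl sumr_ge0. Qed.

Lemma is_derive_coord F i w (t : R) : coord_derivable F ->
  is_derive t 1 (fun s : R => F (w + s *: delta_mx i 0))
    (pderiv i F (w + t *: delta_mx i 0)).
Proof.
move=> /(_ i (w + t *: delta_mx i 0)) dF.
have E : (fun h : R => h^-1 *: (F (w + (h *: (1 : R) + t) *: delta_mx i 0)
             - F (w + t *: delta_mx i 0))) =
         (fun h : R => h^-1 *: ((F \o shift (w + t *: delta_mx i 0))
             (h *: delta_mx i 0) - F (w + t *: delta_mx i 0))).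
  apply/funext => h /=; congr (_ *: (F _ - _)).
  by rewrite [h *: 1]mulr1 scalerDl addrCA.
split; first by rewrite /derivable /= E.
by rewrite /pderiv /derive /= E.
Qed.

Definition truncate k v : 'cV[R]_d := \col_i (if (i < k)%N then v i 0 else 0).

Lemma truncate0 v : truncate 0 v = 0.
Proof. by apply/colP => i; rewrite !mxE. Qed.

Lemma truncate_all v : truncate d v = v.
Proof. by apply/colP => i; rewrite mxE ltn_ord. Qed.

Lemma truncateS v i : truncate i.+1 v = truncate i v + v i 0 *: delta_mx i 0.
Proof.
apply/colP => j; rewrite !mxE ltnS leq_eqVlt eqxx andbT.
have [->|ji] := eqVneq j i; first by rewrite eqxx /= ltnn mulr1 add0r.
by rewrite -val_eqE/= in ji; rewrite (negbTE ji) /= mulr0 addr0.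
Qed.

Lemma norm1_truncateS v i :
  norm1 (truncate i.+1 v) = norm1 (truncate i v) + `|v i 0|.
Proof.
rewrite /norm1 (bigD1 i)//= [in RHS](bigD1 i)//= !mxE ltnSn ltnn normr0 add0r.
rewrite addrC; congr (_ + _); apply: eq_bigr => j ji.
by rewrite !mxE ltnS leq_eqVlt val_eqE (negbTE ji).
Qed.

Lemma in_box_truncate w v k x :
  in_box w (truncate k v) x -> in_box w v x.
Proof.
move=> bx i; have [s s01] := bx i; rewrite mxE; case: ifP => _ xE.
  by exists s.
by exists 0; rewrite ?lexx ?ler01// mul0r addr0 xE mulr0 addr0.
Qed.

Lemma in_box_trans w v u x :
  in_box 0 v u -> in_box w u x -> in_box w v x.
Proof.
move=> vu ux i; have [s s01 ->] := ux i; have [t t01 ->] := vu i.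
exists (s * t); last by rewrite mxE add0r mulrA.
by move: s01 t01; nra.
Qed.

Lemma in_box_step w v i s : 0 <= s <= 1 ->
  in_box w v (w + truncate i v + (s * v i 0) *: delta_mx i 0).
Proof.
move=> s01 j; rewrite !mxE; have [->|ji] := eqVneq j i.
  by exists s => //; rewrite ltnn addr0 mulr1.
rewrite mulr0 addr0; case: ifP => _; last first.
  by exists 0; rewrite ?lexx ?ler01// mul0r.
by exists 1; rewrite ?lexx ?ler01// mul1r.
Qed.

Lemma coord_segment F w i (c s : R) : coord_derivable F ->
  is_derive s 1 (fun s : R => F (w + (s * c) *: delta_mx i 0))
    (c * pderiv i F (w + (s * c) *: delta_mx i 0)).
Proof.
move=> dF; rewrite mulrC.
apply: (@is_derive1_comp R (fun u => F (w + u *: delta_mx i 0)) (fun s => s * c)).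
  exact: is_derive_coord.
rewrite (_ : (fun _ => _) = c *: (id : R -> R)); last first.
  by apply/funext => u /=; rewrite mulrC.
rewrite -[X in is_derive _ _ _ X]mulr1; exact: is_deriveZ.
Qed.

Lemma lipschitz_box F w v (M : R) : coord_derivable F ->
  (forall i x, in_box w v x -> `|pderiv i F x| <= M) ->
  `|F (w + v) - F w| <= M * norm1 v.
Proof.
move=> dF dM.
suff H k : (k <= d)%N ->
    `|F (w + truncate k v) - F w| <= M * norm1 (truncate k v).
  by have := H d (leqnn _); rewrite truncate_all.
elim: k => [_|k IH kd].
  by rewrite truncate0 addr0 subrr normr0 /norm1 big1 ?mulr0// => i; rewrite mxE normr0.
have := IH (ltnW kd); set i := Ordinal kd; rewrite -[k]/(val i) => {}IH.
rewrite norm1_truncateS truncateS mulrDr addrA.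
rewrite (le_trans (ler_distD (F (w + truncate i v)) _ _))//.
rewrite [leRHS]addrC lerD//.
have lin (s : R) : is_derive s 1 (fun s : R => s * (`|v i 0| * M)) (`|v i 0| * M).
  have -> : (fun s : R => s * (`|v i 0| * M)) = ((`|v i 0| * M) *: id : R -> R).
    by apply/funext => u /=; rewrite mulrC.
  rewrite -[X in is_derive _ _ _ X]mulr1; exact: is_deriveZ.
have /= := mean_value_ineq ler01
  (fun s => coord_segment (w + truncate i v) i (v i 0) s dF) lin.
rewrite !mul1r !mul0r scale0r addr0 subr0 [X in _ <= X]mulrC. apply.
move=> s s01; rewrite normrM ler_wpM2l//; apply: dM.
exact: (@in_box_step w v i s s01).
Qed.

Lemma taylor2_box F w v (M : R) : coord_derivable F ->
  (forall i, coord_derivable (pderiv i F)) ->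
  (forall i j x, in_box w v x -> `|pderiv j (pderiv i F) x| <= M) ->
  `|F (w + v) - F w - \sum_i v i 0 * pderiv i F w| <= M / 2 * norm1 v ^+ 2.
Proof.
move=> dF ddF dM.
have sumS (i : 'I_d) : \sum_j truncate i.+1 v j 0 * pderiv j F w =
    \sum_j truncate i v j 0 * pderiv j F w + v i 0 * pderiv i F w.
  rewrite (bigD1 i)//= [in RHS](bigD1 i)//= !mxE ltnSn ltnn mul0r add0r.
  rewrite addrC; congr (_ + _); apply: eq_bigr => j ji.
  by rewrite !mxE ltnS leq_eqVlt val_eqE (negbTE ji).
suff H k : (k <= d)%N ->
    `|F (w + truncate k v) - F w - \sum_i truncate k v i 0 * pderiv i F w|
      <= M / 2 * norm1 (truncate k v) ^+ 2.
  by have := H d (leqnn _); rewrite truncate_all.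
elim: k => [_|k IH kd].
  rewrite truncate0 addr0 subrr /norm1 !big1 ?subrr ?normr0 ?expr0n ?mulr0//.
    by move=> i; rewrite mxE normr0.
  by move=> i; rewrite mxE mul0r.
have := IH (ltnW kd); set i := Ordinal kd; rewrite -[k]/(val i) => {}IH.
rewrite norm1_truncateS sumS truncateS addrA.
set x0 : 'cV[R]_d := w + truncate i v; set a : R := norm1 _; set c : R := v i 0.
(* along the i-th axis the increment of the derivative has a part due to the
   coordinates already moved and a part due to the i-th one *)
have step (s : R) : 0 <= s <= 1 ->
    `|c * pderiv i F (x0 + (s * c) *: delta_mx i 0) - c * pderiv i F w| <=
    `|c| * M * a + s * (M * c ^+ 2).
  move=> s01; rewrite -mulrBr normrM.
  have bu := @in_box_step 0 v i s s01; rewrite add0r in bu.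
  have := @lipschitz_box (pderiv i F) w _ M (ddF i)
    (fun j x bx => dM i j x (in_box_trans bu bx)).
  rewrite addrA => /le_trans le1.
  have M0 : 0 <= M.
    apply: le_trans (dM i i w _); first exact: normr_ge0.
    by move=> j; exists 0; rewrite ?lexx ?ler01 ?mul0r ?addr0.
  have le2 : M * norm1 (truncate i v + (s * c) *: delta_mx i 0) <= M * (a + s * `|c|).
    rewrite ler_wpM2l// (le_trans (norm1D _ _))// lerD2l norm1Z normrM.
    move: s01 => /andP[s0 _]; rewrite (ger0_norm s0).
    rewrite /norm1 (bigD1 i)//= big1 => [|j ji].
      by rewrite addr0 mxE !eqxx normr1 mulr1.
    by rewrite mxE (negbTE ji) normr0.
  apply: (@le_trans _ _ (`|c| * (M * (a + s * `|c|)))).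
    by rewrite ler_wpM2l// le1.
  by rewrite -[c ^+ 2]real_normK ?num_real//; nra.
have fD (s : R) : is_derive s 1
    (fun s : R => F (x0 + (s * c) *: delta_mx i 0) - c * pderiv i F w / 1%:R * s ^+ 1)
    (c * pderiv i F (x0 + (s * c) *: delta_mx i 0) - c * pderiv i F w * s ^+ 0).
  by apply: is_deriveB; [exact: coord_segment|exact: is_derive_monomial].
have gD (s : R) : is_derive s 1
    (fun s : R => `|c| * M * a / 1%:R * s ^+ 1 + M * c ^+ 2 / 2 * s ^+ 2)
    (`|c| * M * a * s ^+ 0 + M * c ^+ 2 * s ^+ 1).
  by apply: is_deriveD; exact: is_derive_monomial.
have /= := mean_value_ineq ler01 fD gD.
move=> /(_ _)/wrap[t t01|].
  by rewrite expr0 expr1 !mulr1 [_ * t]mulrC; exact: step.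
rewrite mul1r mul0r scale0r addr0 !divr1 !expr1 !expr1n !mulr1 !mulr0 subr0.
rewrite expr0n /= mulr0 addr0 subr0 -[c ^+ 2]real_normK ?num_real// => H1.
move: IH; rewrite -/i -/x0 -/a; set S := \sum_j _ => IH.
have -> : F (x0 + c *: delta_mx i 0) - F w - (S + c * pderiv i F w) =
  (F (x0 + c *: delta_mx i 0) - c * pderiv i F w - F x0) + (F x0 - F w - S) by ring.
apply: le_trans (ler_normD _ _) _.
by nra.
Qed.

End coordinates.

Lemma cvg_sum_ord (R : realType) (T : Type) (G : set_system T) {FG : Filter G} (n : nat)
    (u : 'I_n -> T -> R) (l : 'I_n -> R) :
  (forall i, u i x @[x --> G] --> l i) ->
  \sum_i u i x @[x --> G] --> \sum_i l i.
Proof.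
elim: n u l => [|n IH] u l ul.
  rewrite big_ord0 (_ : (fun _ => _) = cst 0); first exact: cvg_cst.
  by apply/funext => x; rewrite big_ord0.
rewrite big_ord_recl.
have -> : (fun x => \sum_i u i x) =
    (fun x => u ord0 x + \sum_(i < n) u (lift ord0 i) x).
  by apply/funext => x; rewrite big_ord_recl.
by apply: cvgD => //; apply: IH => i; exact: ul.
Qed.

Section chain.
Context {R : realType} {d : nat}.
Implicit Types (w v x : 'cV[R]_d) (F : 'cV[R]_d -> R) (i : 'I_d).

Definition locally_bounded F :=
  forall r : R, exists M, forall x, norm1 x <= r -> `|F x| <= M.

Lemma norm1_in_box w v x : in_box w v x -> norm1 x <= norm1 w + norm1 v.
Proof.
move=> bx; rewrite /norm1 -big_split ler_sum// => i _.
have [s /andP[s0 s1] ->] := bx i; rewrite (le_trans (ler_normD _ _))// lerD2l.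
by rewrite normrM ler_piMl// ger0_norm.
Qed.

Lemma is_derive_curve F (c : R -> 'cV[R]_d) (dc : 'I_d -> R) (t : R) :
  coord_derivable F -> (forall i, coord_derivable (pderiv i F)) ->
  (forall i j, locally_bounded (pderiv j (pderiv i F))) ->
  (forall i, is_derive t 1 (fun s : R => c s i 0) (dc i)) ->
  is_derive t 1 (fun s => F (c s)) (\sum_i dc i * pderiv i F (c t)).
Proof.
move=> dF ddF bF cD.
pose D (h : R) := c (h + t) - c t.
have Dq i : h^-1 * D h i 0 @[h --> 0^'] --> dc i.
  have [+ <-] := cD i; rewrite /derivable /derive /=.
  have -> : (fun h : R => h^-1 *: (c (h *: (1 : R) + t) i 0 - c t i 0)) =
            (fun h : R => h^-1 * D h i 0).
    by apply/funext => h; rewrite [h *: 1]mulr1 !mxE.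
  by [].
have D0 i : `|D h i 0| @[h --> 0^'] --> (0 : R).
  rewrite -[X in _ --> X](normr0 R); apply: cvg_norm.
  have : h * (h^-1 * D h i 0) @[h --> 0^'] --> 0 * dc i.
    by apply: cvgM; [exact: (cvg_within (F := nbhs (0:R)))|exact: Dq].
  rewrite mul0r; apply: cvg_trans; apply: near_eq_cvg; near=> h.
  have h0 : h != 0 by near: h; exact: nbhs_dnbhs_neq.
  by rewrite mulVKf.
have nD0 : norm1 (D h) @[h --> 0^'] --> (0 : R).
  rewrite [X in _ --> X](_ : 0 = \sum_(i < d) (0 : R)); last by rewrite big1.
  exact: cvg_sum_ord.
have [M MF] : exists M, forall i j x, norm1 x <= norm1 (c t) + 1 ->
    `|pderiv j (pderiv i F) x| <= M.
  have /choice[M0 HM0] : forall ij : 'I_d * 'I_d, exists M, forall x,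
    norm1 x <= norm1 (c t) + 1 -> `|pderiv ij.2 (pderiv ij.1 F) x| <= M.
    by move=> ij; exact: bF.
  exists (\sum_ij `|M0 ij|) => i j x /(HM0 (i, j))/le_trans; apply.
  by rewrite (bigD1 (i, j))//= (le_trans (ler_norm _))// lerDl sumr_ge0.
suff H : h^-1 *: (F (c (h *: (1 : R) + t)) - F (c t)) @[h --> 0^'] -->
    \sum_i dc i * pderiv i F (c t).
  by split; [exact: cvgP H|exact: cvg_lim H].
pose S (h : R) := \sum_i h^-1 * D h i 0 * pderiv i F (c t).
have SE : S h @[h --> 0^'] --> \sum_i dc i * pderiv i F (c t).
  by apply: cvg_sum_ord => i; apply: cvgM; [exact: Dq|exact: cvg_cst].
rewrite -[X in _ --> X]addr0.
have -> : (fun h : R => h^-1 *: (F (c (h *: (1 : R) + t)) - F (c t))) =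
  (fun h => S h + h^-1 * (F (c t + D h) - F (c t) -
               \sum_i D h i 0 * pderiv i F (c t))).
  apply/funext => h; have -> : c t + D h = c (h + t) by rewrite /D addrC subrK.
  have -> : S h = h^-1 * \sum_i D h i 0 * pderiv i F (c t).
    by rewrite /S mulr_sumr; apply: eq_bigr => i _; rewrite mulrA.
  by rewrite [h *: 1]mulr1 -mulrDr [in RHS]addrC subrK.
apply: cvgD => //; apply: norm_cvg0.
have up0 : M / 2 * (\sum_i `|h^-1 * D h i 0| * norm1 (D h)) @[h --> 0^'] --> (0 : R).
  rewrite [X in _ --> X](_ : 0 = M / 2 * (\sum_i `|dc i| * 0)); last first.
    by rewrite big1 ?mulr0// => i _; rewrite mulr0.
  apply: cvgM; first exact: cvg_cst.
  apply: cvg_sum_ord => i; apply: cvgM => //.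
  by apply: cvg_norm; exact: Dq.
apply: (squeeze_cvgr _ (cvg_cst _) up0).
near=> h; rewrite normr_ge0/= normrM -mulr_suml mulrA.
have D1 : norm1 (D h) <= 1.
  near: h; have /cvgr0Pnorm_le/(_ _ ltr01) := nD0.
  by apply: filterS => h; rewrite ger0_norm// norm1_ge0.
have /= := @taylor2_box R d F (c t) (D h) M dF ddF _.
move=> /(_ _)/wrap[i j x bx|H].
  by apply: MF; rewrite (le_trans (norm1_in_box bx))// lerD2l.
rewrite -[X in _ <= _ * X * _](_ : `|h|^-1 * norm1 (D h) = _); last first.
  by rewrite mulr_sumr; apply: eq_bigr => i _; rewrite normrM normfV.
rewrite [leRHS](_ : _ = `|h|^-1 * (M / 2 * norm1 (D h) ^+ 2)); last by ring.
by rewrite normfV ler_wpM2l ?invr_ge0.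
Unshelve. all: by end_near. Qed.

End chain.

Section taylor3.
Context {R : realType} {d : nat}.
Implicit Types (w v x : 'cV[R]_d) (F : 'cV[R]_d -> R) (i : 'I_d).

Lemma in_boxZ w v x (s : R) : 0 <= s <= 1 ->
  in_box w (s *: v) x -> in_box w v x.
Proof.
move=> s01; apply: in_box_trans => i; exists s => //.
by rewrite !mxE add0r.
Qed.

Lemma is_derive_line w v i (t : R) :
  is_derive t 1 (fun s : R => (w + s *: v) i 0) (v i 0).
Proof.
have -> : (fun s : R => (w + s *: v) i 0) = cst (w i 0) + v i 0 *: (id : R -> R).
  by apply/funext => s; rewrite !mxE /= [s * _]mulrC.
rewrite -[v i 0 in X in is_derive _ _ _ X]mulr1 -[X in is_derive _ _ _ X]add0r.
by apply: is_deriveD; exact: is_deriveZ.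
Qed.

Lemma taylor3_box F w v (M : R) : coord_derivable F ->
  (forall i, coord_derivable (pderiv i F)) ->
  (forall i j, coord_derivable (pderiv j (pderiv i F))) ->
  (forall i j, locally_bounded (pderiv j (pderiv i F))) ->
  (forall i j k x, in_box w v x ->
     `|pderiv k (pderiv j (pderiv i F)) x| <= M) ->
  `|F (w + v) - F w - \sum_i v i 0 * pderiv i F w
     - (\sum_i v i 0 * \sum_j v j 0 * pderiv j (pderiv i F) w) / 2|
  <= M / 6 * norm1 v ^+ 3.
Proof.
move=> dF ddF dddF bF dM.
set a : R := \sum_i v i 0 * pderiv i F w.
set b : R := \sum_i _ * _.
have fD (s : R) : is_derive s 1
    (fun s : R => F (w + s *: v) - a / 1%:R * s ^+ 1 - b / 2 * s ^+ 2)
    (\sum_i v i 0 * pderiv i F (w + s *: v) - a * s ^+ 0 - b * s ^+ 1).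
  apply: is_deriveB; last exact: is_derive_monomial.
  apply: is_deriveB; last exact: is_derive_monomial.
  by apply: is_derive_curve => // i; exact: is_derive_line.
have gD (s : R) : is_derive s 1
    (fun s : R => (M / 2 * norm1 v ^+ 3) / 3 * s ^+ 3)
    ((M / 2 * norm1 v ^+ 3) * s ^+ 2) by exact: is_derive_monomial.
have /= := mean_value_ineq ler01 fD gD.
move=> /(_ _)/wrap[t t01|].
  rewrite expr0 mulr1 expr1.
  have -> : \sum_i v i 0 * pderiv i F (w + t *: v) - a - b * t =
    \sum_i v i 0 * (pderiv i F (w + t *: v) - pderiv i F w -
        \sum_j (t *: v) j 0 * pderiv j (pderiv i F) w).
    rewrite /a /b mulr_suml -!sumrB; apply: eq_bigr => i _.
    rewrite !mulrBr -mulrA mulr_suml; congr (_ - _ - _ * _).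
    by apply: eq_bigr => j _; rewrite mxE; ring.
  rewrite (le_trans (ler_norm_sum _ _ _))//.
  have -> : M / 2 * norm1 v ^+ 3 * t ^+ 2 =
      \sum_i `|v i 0| * (M / 2 * norm1 (t *: v) ^+ 2).
    rewrite -mulr_suml -/(norm1 v) norm1Z ger0_norm; first by ring.
    by case/andP: t01.
  apply: ler_sum => i _; rewrite normrM ler_wpM2l//.
  apply: taylor2_box => // j k x bx; apply: dM; exact: in_boxZ t01 bx.
rewrite scale1r scale0r addr0 !divr1 !expr1 !expr1n !mulr1 !mulr0 !subr0.
rewrite !expr0n /= !mulr0 !subr0 => H.
rewrite (_ : M / 6 * norm1 v ^+ 3 = M / 2 * norm1 v ^+ 3 / 3); last by field.
apply: le_trans H; rewrite le_eqVlt; apply/orP; left; apply/eqP; congr `|_|.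
by ring.
Qed.

End taylor3.

Section partitions.
Variable I : eqType.
Implicit Types (i : I) (s : seq I) (pi : seq (seq I)).

Fixpoint insert_block i pi : seq (seq (seq I)) :=
  if pi is b :: q then ((i :: b) :: q) :: map (cons b) (insert_block i q)
  else [::].

Fixpoint set_partitions s : seq (seq (seq I)) :=
  if s is i :: s' then
    flatten [seq ([:: i] :: pi) :: insert_block i pi | pi <- set_partitions s']
  else [:: [::]].

Definition blocks_ok k pi := all (fun b => (0 < size b)%N) pi && (sumn (map size pi) == k).

Lemma insert_block_ok i k pi : blocks_ok k pi ->
  all (fun q => blocks_ok k.+1 q && (size q == size pi)) (insert_block i pi).
Proof.
elim: pi k => [//|b q IH] k /andP[/= /andP[b0 q0] /eqP <-].
rewrite /blocks_ok /= q0 addSn !eqxx /= all_map.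
have /IH : blocks_ok (sumn (map size q)) q by rewrite /blocks_ok q0 eqxx.
apply: sub_all => t /= /andP[/andP[-> /eqP ->] /eqP ->].
by rewrite b0 addnS !eqxx.
Qed.

Lemma set_partitions_ok s : all (blocks_ok (size s)) (set_partitions s).
Proof.
elim: s => //= i s /allP IH; apply/allP => q /flattenP[l /mapP[pi /IH pik ->]].
rewrite inE => /predU1P[->|/(allP (insert_block_ok i pik))/andP[]//].
by case/andP: pik => h /eqP hk; rewrite /blocks_ok /= h hk add1n eqxx.
Qed.

Lemma blocks_ok_size k pi : blocks_ok k pi -> (size pi <= k)%N.
Proof.
elim: pi k => [//|b q IH] k /andP[/= /andP[b0 q0] /eqP <-].
have := IH (sumn (map size q)); rewrite /blocks_ok q0 eqxx => /(_ isT).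
by move: b0; case: (size b) => // n _; rewrite addSn ltnS => /leq_trans; apply; exact: leq_addl.
Qed.

Lemma blocks_ok_block k pi : blocks_ok k pi ->
  all (fun b => (0 < size b <= k)%N) pi.
Proof.
elim: pi k => [//|b q IH] k /andP[/= /andP[b0 q0] /eqP <-].
rewrite b0 leq_addr /=.
have := IH (sumn (map size q)); rewrite /blocks_ok q0 eqxx => /(_ isT).
by apply: sub_all => c /andP[-> /leq_trans]; apply; exact: leq_addl.
Qed.

End partitions.

Section composition.
Context {R : realType} {d : nat}.
Implicit Types (w v x : 'cV[R]_d) (F g : 'cV[R]_d -> R) (i : 'I_d).

Lemma is_derive_dir_comp (h : R -> R) g w v (dh dg : R) :
  is_derive (g w) 1 h dh -> is_derive w v g dg ->
  is_derive w v (h \o g) (dg * dh).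
Proof.
move=> hD gD.
have E (f : 'cV[R]_d -> R) :
  (fun t : R => t^-1 *: (f (w + (t *: (1 : R) + 0) *: v) - f (w + (0 : R) *: v))) =
  (fun t : R => t^-1 *: ((f \o shift w) (t *: v) - f w)).
  apply/funext => t /=.
  by rewrite [t *: 1]mulr1 addr0 scale0r addr0 [w + _]addrC.
have gD0 : is_derive (0 : R) 1 (fun t : R => g (w + t *: v)) dg.
  have [d1 d2] := gD; split; first by rewrite /derivable /= E.
  by rewrite /derive /= E.
have hgD0 : is_derive (0 : R) 1 (fun t : R => h (g (w + t *: v))) (dg * dh).
  rewrite mulrC; apply: (@is_derive1_comp R h (fun t => g (w + t *: v))) => //.
  by rewrite scale0r addr0.
have [d1 d2] := hgD0; split.
  by move: d1; rewrite /derivable /= (E (h \o g)).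
by move: d2; rewrite /derive /= (E (h \o g)).
Qed.

Definition block_prod g (pi : seq (seq 'I_d)) w : R := \prod_(b <- pi) partial b g w.

Lemma is_derive_block_prod g pi w i :
  all (fun b => `[< derivable (partial b g) w (delta_mx i 0) >]) pi ->
  is_derive w (delta_mx i 0) (block_prod g pi)
    (\sum_(q <- insert_block i pi) block_prod g q w).
Proof.
rewrite /block_prod; elim: pi => [_|b pi IH] /=.
  rewrite big_nil; have -> : (fun w => \prod_(b <- [::]) partial b g w) = cst 1.
    by apply/funext => x; rewrite big_nil.
  exact: is_derive_cst.
move=> /andP[/asboolP db /IH {}IH].
have -> : (fun w => \prod_(c <- b :: pi) partial c g w) =
    partial b g * (fun w => \prod_(c <- pi) partial c g w).
  by apply/funext => x; rewrite big_cons.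
apply: (is_derive_eq (is_deriveM (derivableP db) IH)).
rewrite big_cons big_cons big_map addrC; congr (_ + _).
  by rewrite [LHS]mulrC.
rewrite [LHS]mulr_sumr; apply: eq_bigr => q _.
by rewrite big_cons.
Qed.

Definition faa_di_bruno (h : R -> R) g (s : seq 'I_d) w : R :=
  \sum_(pi <- set_partitions s) derive1n (size pi) h (g w) * block_prod g pi w.

Lemma is_derive_faa (h : R -> R) g (s : seq 'I_d) i w :
  (forall j (y : R), (j <= size s)%N -> derivable (derive1n j h) y 1) ->
  (forall b, (size b <= size s)%N -> derivable (partial b g) w (delta_mx i 0)) ->
  is_derive w (delta_mx i 0) (faa_di_bruno h g s) (faa_di_bruno h g (i :: s) w).
Proof.
move=> hD gD; rewrite /faa_di_bruno /= big_flatten big_map.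
have := set_partitions_ok s.
elim: (set_partitions s) => [_|pi ps IH /= /andP[pik /IH {}IH]].
  rewrite big_nil; have -> : (fun w => \sum_(pi <- [::]) derive1n (size pi) h (g w) *
      block_prod g pi w) = cst 0.
    by apply/funext => x; rewrite big_nil.
  exact: is_derive_cst.
have -> : (fun w => \sum_(pi <- pi :: ps) derive1n (size pi) h (g w) *
      block_prod g pi w) = (derive1n (size pi) h \o g) * block_prod g pi +
     (fun w => \sum_(pi <- ps) derive1n (size pi) h (g w) * block_prod g pi w).
  by apply/funext => x; rewrite big_cons.
rewrite big_cons; apply: is_deriveD => //.
have hgD := is_derive_dir_comp (derivableP (hD _ (g w) (blocks_ok_size pik)))
  (derivableP (gD [::] isT)).
have piD : is_derive w (delta_mx i 0) (block_prod g pi)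
    (\sum_(q <- insert_block i pi) block_prod g q w).
  apply: is_derive_block_prod; apply: sub_all (blocks_ok_block pik) => b.
  by move=> /andP[_ bs]; apply/asboolP/gD.
apply: (is_derive_eq (is_deriveM hgD piD)).
rewrite big_cons addrC; congr (_ + _).
  rewrite [LHS]mulr_sumr [LHS]big_seq [RHS]big_seq; apply: eq_bigr => q.
  by move=> /(allP (insert_block_ok i pik)) /andP[_ /eqP ->].
rewrite /block_prod big_cons /= derive1E [LHS]mulrC.
by rewrite [LHS]mulrAC [LHS]mulrC.
Qed.

Lemma partial_comp (m : nat) (h : R -> R) g :
  (forall j (y : R), (j < m)%N -> derivable (derive1n j h) y 1) ->
  (forall s i w, (size s < m)%N -> derivable (partial s g) w (delta_mx i 0)) ->
  forall s, (size s <= m)%N ->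
  partial s (h \o g) = faa_di_bruno h g s.
Proof.
move=> hD gD; elim=> [_|i s IH sm].
  apply/funext => w; rewrite /faa_di_bruno big_seq1 /block_prod big_nil mulr1.
  by [].
apply/funext => w /=; rewrite (IH (ltnW sm)).
have [_ <-//] : is_derive w (delta_mx i 0) (faa_di_bruno h g s)
  (faa_di_bruno h g (i :: s) w).
apply: is_derive_faa.
- by move=> j x js; apply: hD; exact: leq_ltn_trans js sm.
- by move=> b bs; apply: gD; exact: leq_ltn_trans bs sm.
Qed.

Lemma derivable_partial_comp (m : nat) (h : R -> R) g :
  (forall j (y : R), (j < m)%N -> derivable (derive1n j h) y 1) ->
  (forall s i w, (size s < m)%N -> derivable (partial s g) w (delta_mx i 0)) ->
  forall s i w, (size s < m)%N ->
  derivable (partial s (h \o g)) w (delta_mx i 0).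
Proof.
move=> hD gD s i w sm; rewrite (partial_comp hD gD (ltnW sm)).
have [//] : is_derive w (delta_mx i 0) (faa_di_bruno h g s)
  (faa_di_bruno h g (i :: s) w).
apply: is_derive_faa.
- by move=> j x js; apply: hD; exact: leq_ltn_trans js sm.
- by move=> b bs; apply: gD; exact: leq_ltn_trans bs sm.
Qed.

Lemma block_prod_le g (P : 'cV[R]_d -> R) (m k : nat) pi w : (0 < m)%N ->
  0 <= P w ->
  (forall s, (0 < size s <= m)%N -> `|partial s g w| `^ (m%:R / (size s)%:R) <= P w) ->
  (k <= m)%N -> (0 < k)%N -> blocks_ok k pi ->
  `|block_prod g pi w| <= P w `^ (k%:R / m%:R).
Proof.
move=> m0 P0 gP km.
have bP b : (0 < size b <= m)%N -> `|partial b g w| <= P w `^ ((size b)%:R / m%:R).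
  move=> bm; have := gP b bm; case/andP: bm => b0 bm.
  have q0 : 0 <= (size b)%:R / m%:R :> R by rewrite divr_ge0.
  move=> H.
  rewrite -[leLHS](powRr1 (normr_ge0 _)).
  rewrite [in leLHS](_ : 1 = m%:R / (size b)%:R * ((size b)%:R / m%:R)); last first.
    by rewrite mulrA divfK ?divff// pnatr_eq0 -lt0n.
  by rewrite powRrM; apply: (ge0_ler_powR q0); rewrite ?nnegrE ?powR_ge0.
rewrite /block_prod; elim: pi k km => [|b pi IH] k km k0.
  by rewrite /blocks_ok /= eq_sym eqn0Ngt k0.
move=> /andP[/= /andP[b0 q0] /eqP kE]; rewrite -kE natrD mulrDl big_cons normrM.
have bm : (size b <= m)%N by rewrite (leq_trans _ km)// -kE leq_addr.
have [E|] := eqVneq (sumn (map size pi)) 0%N.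
  have -> : pi = [::].
    case: pi q0 E {IH kE} => //= c q /andP[c0 _] /eqP.
    by rewrite addn_eq0 eqn0Ngt c0.
  by rewrite big_nil normr1 mulr1 /= mul0r addr0 bP// b0 bm.
rewrite -lt0n => s0.
rewrite powRD; last first.
  by rewrite -mulrDl -natrD kE mulf_eq0 invr_eq0 !pnatr_eq0 !eqn0Ngt k0 m0.
rewrite ler_pM// ?bP ?b0//; apply: IH => //.
  by rewrite (leq_trans _ km)// -kE leq_addl.
by rewrite /blocks_ok q0 eqxx.
Qed.

Lemma partial_comp_le (h : R -> R) g (P : 'cV[R]_d -> R) (c : nat -> R) (m : nat)
    (s : seq 'I_d) w :
  (forall j (y : R), (j < m)%N -> derivable (derive1n j h) y 1) ->
  (forall s i w, (size s < m)%N -> derivable (partial s g) w (delta_mx i 0)) ->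
  0 <= P w ->
  (forall s, (0 < size s <= m)%N -> `|partial s g w| `^ (m%:R / (size s)%:R) <= P w) ->
  (forall j (y : R), (0 < j <= m)%N -> `|derive1n j h y| <= c j) ->
  (0 < size s <= m)%N ->
  `|partial s (h \o g) w| <=
    (\sum_(pi <- set_partitions s) c (size pi)) * P w `^ ((size s)%:R / m%:R).
Proof.
move=> hD gD P0 gP hc /andP[s0 sm].
rewrite (partial_comp hD gD sm) /faa_di_bruno (le_trans (ler_norm_sum _ _ _))//.
rewrite mulr_suml big_seq [leRHS]big_seq; apply: ler_sum => pi.
move=> /(allP (set_partitions_ok s)) pik; rewrite normrM ler_pM//.
  apply: hc; rewrite (leq_trans (blocks_ok_size pik) sm) andbT.
  by case: pi pik => //; rewrite /blocks_ok /= eq_sym eqn0Ngt s0.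
by apply: block_prod_le pik => //; exact: leq_trans sm.
Qed.

Lemma sum_set_partitions4 (c : nat -> R) (s : seq 'I_d) : size s = 4 ->
  \sum_(pi <- set_partitions s) c (size pi) =
  \sum_(1 <= j < 5) (stirling2 4 j)%:R * c j.
Proof.
case: s => [//|a1 [//|a2 [//|a3 [//|a4 []//]]]] _ /=.
rewrite !big_cons big_nil /= unlock /=.
by rewrite /=; ring.
Qed.

Lemma sum_set_partitions_le (c : nat -> R) (s : seq 'I_d) :
  (forall j, 0 <= c j) -> (size s <= 4)%N ->
  \sum_(pi <- set_partitions s) c (size pi) <=
  15 * (c 0%N + c 1%N + c 2%N + c 3%N + c 4%N).
Proof.
move=> c0; have := (c0 0%N, c0 1%N, c0 2%N, c0 3%N, c0 4%N) => -[[[[h0 h1] h2] h3] h4].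
case: s => [|a1 [|a2 [|a3 [|a4 []//]]]] _ /=; rewrite !big_cons big_nil /=; lra.
Qed.

End composition.

Section independence.
Context {disp : measure_display} {T : measurableType disp} {R : realType}.
Variable (P : probability T R) (I : finType) (G : I -> set (set T)) (i0 : I).
Hypothesis indepG : mutually_independent P G.
Hypothesis algG : forall i, sigma_algebra setT (G i).
Hypothesis mG : forall i, G i `<=` measurable.

Definition other_generators : set (set T) :=
  \bigcup_(i in [set i | i != i0]) G i.

Lemma other_measurable C : <<s other_generators >> C -> measurable C.
Proof.
apply: smallest_sub; first exact: sigma_algebra_measurable.
by move=> A [i _]; exact: mG.
Qed.

Let rect : set (set T) :=
  [set C | exists2 A : I -> set T, (forall i, G i (A i)) &
           C = \bigcap_(i in [set` ~: [set i0]%SET]) A i].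

Let G_setT i : G i setT.
Proof.
have [G0 GC _] := algG i.
by rewrite -[setT]setD0; apply: GC.
Qed.

Let G_setI i A B : G i A -> G i B -> G i (A `&` B).
Proof.
move=> GA GB; have [G0 GC GU] := algG i.
have -> : A `&` B = setT `\` ((setT `\` A) `|` (setT `\` B)).
  by rewrite !setTD setCU !setCK.
apply: (GC); rewrite -bigcup2E; apply: GU => -[|[|n]] /=; by [exact: GC|].
Qed.

Let rect_setI : setI_closed rect.
Proof.
move=> _ _ [A GA ->] [B GB ->]; exists (fun i => A i `&` B i).
  by move=> i; exact: G_setI.
by rewrite bigcapI.
Qed.

Let prod_rect A B : G i0 A -> rect B -> P (A `&` B) = (P A * P B)%E.
Proof.
move=> GA [C GC ->].
pose C' i := if i == i0 then A else C i.
have GC' i : G i (C' i) by rewrite /C'; case: eqP => [->|_].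
have E : A `&` \bigcap_(i in [set` ~: [set i0]%SET]) C i =
    \bigcap_(i in [set` [set: I]%SET]) C' i.
  apply/seteqP; split => [x [Ax Cx] i _|x Cx]; rewrite /C'.
    by case: eqP => // /eqP ii0; apply: Cx; rewrite /= !inE.
  split; first by have := Cx i0; rewrite /C' eqxx; apply; rewrite /= inE.
  move=> i /=; rewrite !inE => ii0; have := Cx i.
  by rewrite /C' (negbTE ii0); apply; rewrite /= inE.
rewrite E indepG; last by move=> i _; exact: GC'.
rewrite indepG; last by move=> i _; exact: GC.
rewrite (bigD1 i0) ?inE//= {1}/C' eqxx; congr (_ * _)%E.
apply: eq_big => [i|i]; first by rewrite !inE.
by move=> /andP[_ ii0]; rewrite /C' (negbTE ii0).
Qed.

Lemma indep_other A C : G i0 A -> <<s other_generators >> C ->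
  P (A `&` C) = (P A * P C)%E.
Proof.
move=> GA oC; have mA : measurable A := mG GA.
have PA0 : 0 <= fine (P A) by rewrite fine_ge0.
have PAE : P A = (fine (P A))%:E by rewrite fineK// fin_num_measure.
pose m1 : {measure set T -> \bar R} := mrestr P mA.
pose m2 : {measure set T -> \bar R} := mscale (NngNum PA0) P.
suff : m1 C = m2 C by rewrite /= /mrestr /mscale /= -PAE setIC.
apply: (@g_sigma_algebra_measure_unique_trace _ R T rect setT) => //.
- move=> B [[B' GB' ->] _]; apply: fin_bigcap_measurable => // i _.
  by apply: mG; exact: GB'.
- by move=> X Y [rX _] [rY _]; split => //; exact: rect_setI.
- by rewrite /= /mrestr /mscale /= -PAE setTI probability_setT mule1.
- by move=> B [rB _]; rewrite /= /mrestr /mscale /= -PAE setIC prod_rect.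
- by rewrite /= /mrestr setTI (le_lt_trans (probability_le1 _ _))// ltry.
apply: (smallest_sub _ _ oC); first exact: smallest_sigma_algebra.
move=> B [i /= ii0 GB]; apply: sub_sigma_algebra; split => //.
exists (fun j => if j == i then B else setT).
  by move=> j; case: eqP => [->|_].
apply/seteqP; split => [x Bx j _|x].
  by case: eqP.
by move=> /(_ i) /=; rewrite eqxx !inE; apply.
Qed.

End independence.

Section independent_pair.
Context {disp d1 d2 : measure_display} {T : measurableType disp}
  {T1 : measurableType d1} {T2 : measurableType d2} {R : realType}.
Variables (P : probability T R) (U : {RV P >-> T1}) (V : {RV P >-> T2}).
Hypothesis indepUV : forall A B, measurable A -> measurable B ->
  P (U @^-1` A `&` V @^-1` B) = (P (U @^-1` A) * P (V @^-1` B))%E.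

Let mpair : measurable_fun setT (fun y : T => (V y, U y)).
Proof. exact: measurable_fun_pair. Qed.

Let pairRV : {RV P >-> (T2 * T1)%type} :=
  MeasurableFun.Pack (MeasurableFun.Class (isMeasurableFun.Build _ _ _ _ _ mpair)).

Lemma indep_pair_law X : measurable X ->
  (distribution P V \x distribution P U)%E X = distribution P pairRV X.
Proof.
apply: product_measure_unique => A B mA mB.
rewrite /distribution /pushforward /= muleC -indepUV//.
by rewrite setIC.
Qed.

Lemma ge0_indep_integral (Phi : T2 * T1 -> \bar R) :
  measurable_fun setT Phi -> (forall z, 0 <= Phi z)%E ->
  (\int[P]_y Phi (V y, U y) =
   \int[P]_y \int[distribution P U]_x Phi (V y, x))%E.
Proof.
move=> mPhi Phi0.
transitivity (\int[distribution P pairRV]_z Phi z)%E.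
  by rewrite ge0_integral_distribution.
transitivity (\int[distribution P V \x distribution P U]_z Phi z)%E.
  by apply: eq_measure_integral => A mA _; exact/esym/indep_pair_law.
rewrite fubini_tonelli1// ge0_integral_distribution//.
  exact: measurable_fun_fubini_tonelli_F.
by move=> y; apply: integral_ge0.
Qed.

Lemma indep_integral (Phi : T2 * T1 -> \bar R) :
  measurable_fun setT Phi -> P.-integrable setT (fun y => Phi (V y, U y)) ->
  (\int[P]_y Phi (V y, U y) =
   \int[P]_y \int[distribution P U]_x Phi (V y, x))%E.
Proof.
move=> mPhi iPhi.
have iprod : (distribution P V \x distribution P U)%E.-integrable setT Phi.
  apply/integrableP; split => //.
  rewrite (_ : (\int[_]_z _ = \int[distribution P pairRV]_z `|Phi z|)%E); last first.
    by apply: eq_measure_integral => A mA _; exact: indep_pair_law.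
  rewrite ge0_integral_distribution//=; last exact: measurableT_comp.
  by case/integrableP : iPhi.
transitivity (\int[distribution P pairRV]_z Phi z)%E.
  by rewrite integral_distribution.
transitivity (\int[distribution P V \x distribution P U]_z Phi z)%E.
  by apply: eq_measure_integral => A mA _; exact/esym/indep_pair_law.
have /integrableP[mF iF] := integrable_fubini_F iprod.
rewrite -integral12_prod_meas1// integral_distribution//.
apply/integrableP; split; first exact: measurableT_comp.
move: iF; rewrite ge0_integral_distribution//.
exact: measurableT_comp.
Qed.

End independent_pair.

Section independent_product.
Context {disp : measure_display} {T : measurableType disp} {R : realType}.
Variables (P : probability T R) (U V : {RV P >-> R}).
Hypothesis indepUV : forall A B : set R, measurable A -> measurable B ->
  P (U @^-1` A `&` V @^-1` B) = (P (U @^-1` A) * P (V @^-1` B))%E.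

Lemma indep_mul :
  P.-integrable setT (EFin \o U) -> P.-integrable setT (EFin \o V) ->
  P.-integrable setT (EFin \o (fun y => U y * V y)) /\
  \int[P]_y (U y * V y) = (\int[P]_y U y) * (\int[P]_y V y).
Proof.
move=> iU iV.
have mPhi : measurable_fun setT (fun z : R * R => (z.2 * z.1)%:E).
  by apply/measurable_EFinP; apply: measurable_funM.
have int1 : P.-integrable setT (fun y => (U y * V y)%:E).
  apply/integrableP; split.
    by apply/measurable_EFinP; exact: measurable_funM.
  have := @ge0_indep_integral _ _ _ _ _ _ _ P U V indepUV
    (abse \o (fun z : R * R => (z.2 * z.1)%:E)).
  move=> /(_ _ _)/wrap[|z|/= ->]; [exact: measurableT_comp|exact: abse_ge0|].
  under eq_integral => y _.
    under eq_integral => x _ do rewrite normrM EFinM muleC.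
    rewrite ge0_integralZl//; last exact: measurableT_comp.
    rewrite (@ge0_integral_distribution _ _ _ _ _ P U (fun x => `|x|%:E))//; last exact: measurableT_comp.
    over.
  rewrite /= ge0_integralZr//; last 2 first.
    by apply: measurableT_comp => //; exact: measurableT_comp.
    by apply: integral_ge0 => x _; rewrite lee_fin.
  apply: lte_mul_pinfty.
  - by apply: integral_ge0 => x _; rewrite lee_fin.
  - by apply: integrable_fin_num => //; exact: (integrable_abse iV).
  - by case/integrableP : iU.
split => //.
rewrite /Rintegral (@indep_integral _ _ _ _ _ _ _ P U V indepUV (fun z => (z.2 * z.1)%:E))//=.
have iU' : (distribution P U).-integrable setT EFin.
  exact: integrable_pushforward.
under eq_integral => y _.
  under eq_integral => x _ do rewrite EFinM muleC.
  rewrite integralZl//.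
  rewrite (integral_distribution (f := EFin))//.
  over.
have iUf := integrable_fin_num measurableT iU.
rewrite /= -(fineK iUf) integralZr//.
by rewrite fineM ?integrable_fin_num//= mulrC.
Qed.

End independent_product.

Section independent_coordinates.
Context {disp : measure_display} {T : measurableType disp} {R : realType}.
Variable (P : probability T R) (I : finType) (G : I -> set (set T)) (i0 : I).
Hypothesis indepG : mutually_independent P G.
Hypothesis algG : forall i, sigma_algebra setT (G i).
Hypothesis mG : forall i, G i `<=` measurable.

Let GT := g_sigma_algebraType (other_generators G i0).

Lemma measurable_fun_other d' (T' : measurableType d') (f : T -> T') :
  measurable_fun (setT : set GT) (f : GT -> T') -> measurable_fun setT f.
Proof.
move=> mf _ B mB; rewrite setTI; apply: (other_measurable mG (i0 := i0)).
by have := mf measurableT B mB; rewrite setTI.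
Qed.

Lemma measurable_to_other : measurable_fun setT (id : T -> GT).
Proof. by move=> _ B mB; rewrite setTI; exact: (@other_measurable _ _ _ G i0 mG B mB). Qed.

Lemma integral_mul_other (U V : T -> R) :
  (forall B : set R, measurable B -> G i0 (U @^-1` B)) ->
  measurable_fun (setT : set GT) (V : GT -> R) ->
  P.-integrable setT (EFin \o U) -> P.-integrable setT (EFin \o V) ->
  P.-integrable setT (EFin \o (fun y => U y * V y)) /\
  \int[P]_y (U y * V y) = (\int[P]_y U y) * (\int[P]_y V y).
Proof.
move=> GU mV iU iV.
have mU : measurable_fun setT U.
  by move=> _ B mB; rewrite setTI; apply: mG; exact: GU.
have mV' := measurable_fun_other mV.
pose URV : {RV P >-> R} :=
  MeasurableFun.Pack (MeasurableFun.Class (isMeasurableFun.Build _ _ _ _ U mU)).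
pose VRV : {RV P >-> R} :=
  MeasurableFun.Pack (MeasurableFun.Class (isMeasurableFun.Build _ _ _ _ V mV')).
apply: (@indep_mul _ _ _ P URV VRV) => // A B mA mB.
apply: (indep_other indepG algG mG (GU A mA)).
by have := mV measurableT B mB; rewrite setTI.
Qed.

End independent_coordinates.

Section measurability.
Context {disp : measure_display} {T : measurableType disp} {R : realType} {d : nat}.
Implicit Types (F : 'cV[R]_d -> R).

Definition norm1_continuous F := forall w (e : R), 0 < e ->
  exists2 c : R, 0 < c & forall v, norm1 v <= c -> `|F (w + v) - F w| <= e.

Lemma norm1_continuous_lipschitz F : coord_derivable F ->
  (forall i, locally_bounded (pderiv i F)) -> norm1_continuous F.
Proof.
move=> dF bF w e e0.
have /choice[M0 HM0] : forall i, exists M, forall x,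
    norm1 x <= norm1 w + 1 -> `|pderiv i F x| <= M by move=> i; exact: bF.
pose M := 1 + \sum_i `|M0 i|.
have M1 : 1 <= M by rewrite lerDl sumr_ge0.
have M_gt0 : 0 < M by exact: lt_le_trans M1.
exists (Num.min 1 (e / M)); first by rewrite lt_min ltr01 divr_gt0.
move=> v; rewrite le_min => /andP[v1 ve].
have := @lipschitz_box R d F w v M dF.
move=> /(_ _)/wrap[i x bx|/le_trans]; last first.
  by apply; rewrite mulrC -ler_pdivlMr.
have {bx} : norm1 x <= norm1 w + 1.
  by rewrite (le_trans (norm1_in_box bx))// lerD2l.
move=> /(HM0 i) /le_trans; apply; rewrite /M (bigD1 i)//= addrCA.
by rewrite (le_trans (ler_norm _))// lerDl addr_ge0// sumr_ge0.
Qed.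

Lemma measurable_quantized (V : T -> 'cV[R]_d) (F : 'cV[R]_d -> R) (a : R) :
  (forall j, measurable_fun setT (fun x => V x j 0)) ->
  measurable_fun setT (fun x => F (\col_j ((Num.floor (a * V x j 0))%:~R / a))).
Proof.
move=> mV _ B mB; rewrite setTI.
pose q (m : {ffun 'I_d -> int}) : 'cV[R]_d := \col_j ((m j)%:~R / a).
pose A (m : {ffun 'I_d -> int}) : set T :=
  \bigcap_(j in setT) [set x | Num.floor (a * V x j 0) = m j].
rewrite (_ : _ @^-1` _ = \bigcup_m (if F (q m) \in B then A m else set0)).
  apply: countable_bigcupT_measurable; first exact: countableP.
  move=> m; case: ifP => // _; apply: fin_bigcap_measurable => // j _.
  rewrite (_ : [set x | _] = (fun x => a * V x j 0) @^-1` `[(m j)%:~R, (m j + 1)%:~R[).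
    rewrite -[X in measurable X]setTI.
    by apply: measurable_funM => //; exact: measurable_itv.
  apply/seteqP; split => x /=; rewrite in_itv /=.
    by move/eqP; rewrite floor_eq.
  by move=> h; apply/eqP; rewrite floor_eq.
have qE x (m : {ffun 'I_d -> int}) : A m x ->
    q m = \col_j ((Num.floor (a * V x j 0))%:~R / a).
  by move=> Am; apply/colP => j; rewrite !mxE (Am j).
apply/seteqP; split => [x /= Bx|x [m _]].
  exists [ffun j => Num.floor (a * V x j 0)] => //.
  have Ax : A [ffun j => Num.floor (a * V x j 0)] x by move=> j _ /=; rewrite ffunE.
  by rewrite (qE _ _ Ax) mem_set.
by case: ifPn => // /set_mem Bq Ax /=; rewrite -(qE _ _ Ax).
Qed.

Lemma measurable_norm1_continuous (V : T -> 'cV[R]_d) (F : 'cV[R]_d -> R) :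
  norm1_continuous F ->
  (forall j, measurable_fun setT (fun x => V x j 0)) ->
  measurable_fun setT (fun x => F (V x)).
Proof.
move=> cF mV.
apply: (@measurable_fun_cvg _ _ _ setT (fun k x =>
    F (\col_j ((Num.floor (k.+1%:R * V x j 0))%:~R / k.+1%:R)))).
  by move=> k; exact: measurable_quantized.
move=> x _; apply/cvgrPdist_le => e e0.
have [c c0 cE] := cF (V x) e e0.
near=> k; rewrite distrC.
set w := \col_j _; have -> : w = V x + (w - V x) by rewrite addrC subrK.
apply: cE; apply: (@le_trans _ _ (d%:R / k.+1%:R)).
  rewrite /norm1 (_ : d%:R / _ = \sum_(j < d) (k.+1%:R^-1 : R)); last first.
    by rewrite sumr_const card_ord mulr_natl.
  apply: ler_sum => j _; rewrite !mxE.
  have k0 : 0 < k.+1%:R :> R by [].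
  have fE (a z : R) : a / k.+1%:R - z = (a - k.+1%:R * z) / k.+1%:R.
    by rewrite mulrBl [k.+1%:R * z]mulrC mulfK.
  rewrite fE.
  rewrite normrM normfV [`|k.+1%:R|]ger0_norm// ler_piMl ?invr_ge0//.
  have /andP[f1 f2] := floor_itv (k.+1%:R * V x j 0).
  rewrite intrD mulr1z in f2; rewrite ler_norml; apply/andP; split; lra.
rewrite ler_pdivrMr// -ler_pdivrMl//.
apply: (@le_trans _ _ k%:R); last by rewrite ler_nat.
by near: k; exact: nbhs_infty_ger.
Unshelve. all: by end_near. Qed.

End measurability.

Section standard_normal_law.
Context {R : realType}.
Notation mu := (@lebesgue_measure R).
Notation gamma := (@normal_prob R 0 1).
Notation pdf := (@normal_pdf R 0 1).

Lemma ge0_integral_normal (f : R -> \bar R) : measurable_fun setT f ->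
  (forall x, 0 <= f x)%E ->
  (\int[gamma]_x f x = \int[mu]_x (f x * (pdf x)%:E))%E.
Proof.
move=> mf f0; have dom := @normal_prob_dominates R 0 1.
rewrite -(Radon_Nikodym_SigmaFinite.change_of_variables dom f0)//.
have fint := Radon_Nikodym_SigmaFinite.f_integrable dom.
apply: ae_eq_integral => //.
- by apply: emeasurable_funM => //; exact: measurable_int fint.
- apply: emeasurable_funM => //.
  by apply/measurable_EFinP; exact: measurable_normal_pdf.
- apply: ae_eqe_mul2l => /=; apply: integral_ae_eq => //.
    by apply/measurable_EFinP; exact: measurable_normal_pdf.
  by move=> E _ mE; rewrite -(Radon_Nikodym_SigmaFinite.f_integral dom).
Qed.

Lemma integrable_normalP (f : R -> R) : measurable_fun setT f ->
  gamma.-integrable setT (EFin \o f) <->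
  mu.-integrable setT (EFin \o (fun x => f x * pdf x)).
Proof.
move=> mf.
have mfp : measurable_fun setT (fun x => f x * pdf x).
  by apply: measurable_funM => //; exact: measurable_normal_pdf.
have E : (\int[gamma]_x `|(f x)%:E| = \int[mu]_x `|(f x * pdf x)%:E|)%E.
  rewrite ge0_integral_normal//; last first.
    by apply: measurableT_comp => //; exact/measurable_EFinP.
  apply: eq_integral => x _; rewrite /= normrM EFinM.
  by rewrite (ger0_norm (normal_pdf_ge0 _ _ _)).
split => /integrableP[_ H]; apply/integrableP; split.
- exact/measurable_EFinP.
- by rewrite -E.
- exact/measurable_EFinP.
- by rewrite E.
Qed.

Lemma Rintegral_normal (f : R -> R) : gamma.-integrable setT (EFin \o f) ->
  \int[gamma]_x f x = \int[mu]_x (f x * pdf x).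
Proof.
move=> intf; have mf : measurable_fun setT f.
  by apply/measurable_EFinP; exact: measurable_int intf.
rewrite /Rintegral; congr fine.
rewrite [LHS]integralE [RHS]integralE.
have mp : measurable_fun setT (EFin \o pdf).
  by apply/measurable_EFinP; exact: measurable_normal_pdf.
rewrite !ge0_integral_normal//; last 2 first.
  exact/measurable_funeneg/measurable_EFinP.
  exact/measurable_funepos/measurable_EFinP.
congr (_ - _)%E; apply: eq_integral => x _.
  rewrite -[X in (_ * X)%E]/(EFin (pdf x)) !funeposE /= -EFin_max -EFin_max -EFinM.
  by rewrite maxr_pMl ?normal_pdf_ge0// mul0r.
rewrite -[X in (_ * X)%E]/(EFin (pdf x)) !funenegE /= -EFin_max -EFin_max -EFinM.
by rewrite maxr_pMl ?normal_pdf_ge0// mul0r mulNr.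
Qed.

Let c1 : R := normal_peak 1.

Let c1_gt0 : 0 < c1.
Proof. by rewrite normal_peak_gt0// oner_neq0. Qed.

Lemma normal_pdf01E x : pdf x = c1 * expR (- (x ^+ 2 / 2)).
Proof.
rewrite normal_pdfE ?oner_neq0// /normal_fun subr0 expr1n mulNr.
by rewrite /c1.
Qed.

Lemma expR_poly_bound (k : nat) : exists C : R, forall y, 0 <= y ->
  (2 + y) ^+ k <= C * expR y.
Proof.
pose K : R := k.+1%:R; exists (K ^+ k * expR 1) => y y0.
have K1 : 1 <= K by rewrite /K ler1n.
have K0 : 0 < K by exact: lt_le_trans K1.
rewrite -mulrA -expRD.
apply: (@le_trans _ _ ((K * expR ((1 + y) / K)) ^+ k)).
  rewrite lerXn2r ?nnegrE ?addr_ge0//.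
    by rewrite mulr_ge0 ?expR_ge0// ltW.
  apply: (@le_trans _ _ (K * (1 + (1 + y) / K))).
    rewrite mulrDr mulr1 mulrCA divff ?gt_eqF//; lra.
  by rewrite ler_wpM2l ?expR_ge1Dx// ltW.
rewrite exprMn ler_wpM2l ?exprn_ge0 ?(ltW K0)// -expRM_natl ler_expR.
rewrite mulrCA ler_piMr ?addr_ge0// -ler_pdivlMr ?invr_gt0//.
by rewrite invrK mul1r /K ler_nat.
Qed.

Lemma normal_pdf_poly_bound (k : nat) : exists C : R, forall x,
  (1 + `|x|) ^+ k * pdf x <= C * normal_pdf 0 (Num.sqrt 2) x.
Proof.
have [C HC] := expR_poly_bound k.
have s2 : Num.sqrt 2 != 0 :> R by rewrite gt_eqF// sqrtr_gt0.
pose c2 : R := normal_peak (Num.sqrt 2).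
have c20 : 0 < c2 by rewrite normal_peak_gt0.
exists (C * c1 / c2) => x.
rewrite normal_pdf01E (normal_pdfE 0 s2) /normal_fun subr0 sqr_sqrtr// mulNr.
rewrite -/c2 [leRHS]mulrA divfK ?gt_eqF//.
have -> : - (x ^+ 2 / 2) = - (x ^+ 2 / (2 *+ 2)) - x ^+ 2 / 4 by field.
rewrite expRD.
have h : (1 + `|x|) ^+ k <= C * expR (x ^+ 2 / 4).
  apply: le_trans (HC _ _); last by rewrite divr_ge0// sqr_ge0.
  rewrite lerXn2r ?nnegrE ?addr_ge0// ?divr_ge0 ?sqr_ge0//.
  by rewrite -[x ^+ 2]real_normK ?num_real//; have := sqr_ge0 (`|x| / 2 - 1); rewrite expr2; lra.
set e := expR (- (x ^+ 2 / (2 *+ 2))).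
set a := (_ ^+ k) in h *.
have h' : a * expR (- (x ^+ 2 / 4)) <= C.
  by rewrite expRN ler_pdivrMr ?expR_gt0.
have e0 : 0 <= e by exact: expR_ge0.
set b := expR _ in h' *; have := ltW c1_gt0 => c10.
rewrite (_ : a * (c1 * (e * b)) = (a * b) * (c1 * e)); last by ring.
by rewrite -[leRHS]mulrA ler_wpM2r// mulr_ge0.
Qed.

Lemma integrable_normal_moment (k : nat) :
  gamma.-integrable setT (EFin \o (fun x => (1 + `|x|) ^+ k)).
Proof.
have m1 : measurable_fun setT (fun x : R => (1 + `|x|) ^+ k).
  by apply: measurable_funX; apply: measurable_funD.
apply/integrable_normalP => //.
have [C HC] := normal_pdf_poly_bound k.
have ig : mu.-integrable setT (fun x => C%:E * (normal_pdf 0 (Num.sqrt 2) x)%:E)%E.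
  by apply: integrableZl => //; exact: integrable_normal_pdf.
apply: (le_integrable _ _ _ ig) => //.
  apply/measurable_EFinP; apply: measurable_funM => //.
  exact: measurable_normal_pdf.
move=> x _; rewrite /= lee_fin ger0_norm; last first.
  by rewrite mulr_ge0 ?normal_pdf_ge0// exprn_ge0// addr_ge0.
by rewrite (le_trans (HC x))// ler_norm.
Qed.

End standard_normal_law.

Section normal_ibp.
Context {R : realType}.
Notation mu := (@lebesgue_measure R).
Notation gamma := (@normal_prob R 0 1).
Notation pdf := (@normal_pdf R 0 1).

Lemma is_derive_normal_pdf (x : R) : is_derive x 1 pdf (- x * pdf x).
Proof.
have -> : pdf = (fun x => normal_peak 1 * expR (- (x ^+ 2 / 2)) : R).
  by apply/funext => y; exact: normal_pdf01E.
have D1 : is_derive x 1 (fun y : R => (-1) / 2 * y ^+ 2) (-1 * x ^+ 1).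
  exact: is_derive_monomial.
have -> : (fun y : R => normal_peak 1 * expR (- (y ^+ 2 / 2))) =
    normal_peak 1 *: (expR \o (fun y : R => (-1) / 2 * y ^+ 2)).
  apply/funext => y /=; congr (_ * expR _); by ring.
have D2 := is_deriveZ (normal_peak (1 : R))
  (@is_derive1_comp R expR (fun y : R => (-1) / 2 * y ^+ 2) x _ _
     (is_derive_expR _) D1).
apply: (is_derive_eq D2).
have E : (-1) / 2 * x ^+ 2 = - (x ^+ 2 / 2) by ring.
by rewrite /= -![_ *: _]/(_ * _) E; ring.
Qed.

Lemma integrable_normal_poly (f : R -> R) (C : R) (k : nat) :
  measurable_fun setT f -> (forall x, `|f x| <= C * (1 + `|x|) ^+ k) ->
  gamma.-integrable setT (EFin \o f).
Proof.
move=> mf fC.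
have ig : gamma.-integrable setT (fun x => C%:E * ((1 + `|x|) ^+ k)%:E)%E.
  by apply: integrableZl => //; exact: integrable_normal_moment.
apply: (le_integrable _ _ _ ig) => //; first exact/measurable_EFinP.
by move=> x _; rewrite /= lee_fin (le_trans (fC x))// ler_norm.
Qed.

Lemma normal_ibp (H dH : R -> R) (C : R) (k : nat) :
  (forall x : R, is_derive x 1 H (dH x)) -> continuous dH ->
  (forall x, `|H x| <= C * (1 + `|x|) ^+ k) ->
  (forall x, `|dH x| <= C * (1 + `|x|) ^+ k) ->
  \int[gamma]_x (x * H x) = \int[gamma]_x dH x.
Proof.
move=> HD cdH HC dHC.
have cH : continuous H.
  move=> x; apply: differentiable_continuous; apply/derivable1_diffP.
  by have [] := HD x.
have mH : measurable_fun setT H by exact: continuous_measurable_fun.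
have mdH : measurable_fun setT dH by exact: continuous_measurable_fun.
have ixH : gamma.-integrable setT (EFin \o (fun x => x * H x)).
  apply: (@integrable_normal_poly _ C k.+1).
    by apply: measurable_funM.
  move=> x; rewrite normrM exprS [leRHS]mulrCA ler_pM// lerDr//.
have idH : gamma.-integrable setT (EFin \o dH).
  exact: integrable_normal_poly dHC.
rewrite !Rintegral_normal//.
pose G x := dH x * pdf x - x * H x * pdf x.
have mpdf := @measurable_normal_pdf R 0 1.
have iG1 : mu.-integrable setT (EFin \o (fun x => dH x * pdf x)).
  by apply/integrable_normalP.
have iG2 : mu.-integrable setT (EFin \o (fun x => x * H x * pdf x)).
  by apply/integrable_normalP => //; exact: measurable_funM.
have iG : mu.-integrable setT (EFin \o G).
  exact: (integrableB measurableT iG1 iG2).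
suff : \int[mu]_x G x = 0.
  by rewrite /G RintegralB// => /subr0_eq.
pose F x := H x * pdf x.
have FD (x : R) : is_derive x 1 F (G x).
  have -> : F = H * pdf by [].
  apply: (is_derive_eq (is_deriveM (HD x) (is_derive_normal_pdf x))).
  by rewrite /G /= -![_ *: _]/(_ * _); ring.
have cpdf : continuous pdf by apply: continuous_normal_pdf; exact: oner_neq0.
have cG : continuous G.
  move=> x; apply: cvgB; apply: cvgM => //; [exact: cdH|exact: cpdf|apply: cvgM => //; exact: cH|exact: cpdf].
have cF : continuous F by move=> x; apply: cvgM; [exact: cH|exact: cpdf].
pose Gn (n : nat) x := (G \_ `[- n.+1%:R, n.+1%:R]) x.
have ftc n : \int[mu]_x Gn n x = F n.+1%:R - F (- n.+1%:R).
  rewrite /Gn -Rintegral_mkcond /Rintegral (@continuous_FTC2 _ G F)//.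
  - by have : 0 < n.+1%:R :> R by []; lra.
  - exact: continuous_subspaceT.
  - split=> [x _||]; first by have [] := FD x.
      exact/cvg_at_right_filter/cF.
    exact/cvg_at_left_filter/cF.
  - by move=> x _; rewrite derive1E; have [_ ->] := FD x.
have lim1 : \int[mu]_x Gn n x @[n --> \oo] --> \int[mu]_x G x.
  have mG : measurable_fun setT G by exact: continuous_measurable_fun.
  have [] := @dominated_convergence _ _ _ mu setT measurableT
    (fun n x => (Gn n x)%:E) (EFin \o G) (EFin \o (fun x => `|G x|)).
  - move=> n; apply/measurable_EFinP; rewrite /Gn.
    by apply/(measurable_restrictT _ _).1 => //; exact: measurable_funTS.
  - exact/measurable_EFinP.
  - apply: aeW => x _; apply: cvg_near_cst; near=> n.
    rewrite /Gn patchE mem_set// /= in_itv /= -ler_norml.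
    apply: (@le_trans _ _ n%:R); last by rewrite ler_nat.
    by near: n; exact: nbhs_infty_ger.
  - exact: (integrable_norm iG).
  - apply: aeW => x n _ /=; rewrite lee_fin /Gn patchE.
    by case: ifP => // _; rewrite normr0.
  - move=> _ _; rewrite /Rintegral => lim; apply: fine_cvg.
    by rewrite fineK//; exact: integrable_fin_num.
have [D HD'] := @normal_pdf_poly_bound R k.+1.
pose K := `|C| * (`|D| * normal_peak (Num.sqrt 2)).
have FK x : `|F x| <= K / (1 + `|x|).
  have x1 : 0 < 1 + `|x| by rewrite ltr_pwDl.
  rewrite ler_pdivlMr// /F normrM (ger0_norm (normal_pdf_ge0 _ _ _)).
  have s2 : Num.sqrt 2 != 0 :> R by rewrite gt_eqF// sqrtr_gt0.
  have pdf0 := normal_pdf_ge0 (0 : R) 1 x.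
  apply: (@le_trans _ _ (`|C| * (1 + `|x|) ^+ k * pdf x * (1 + `|x|))).
    rewrite ler_wpM2r ?(ltW x1)// ler_wpM2r// (le_trans (HC x))//.
    by rewrite ler_wpM2r ?exprn_ge0 ?(ltW x1)// ler_norm.
  have -> : `|C| * (1 + `|x|) ^+ k * pdf x * (1 + `|x|) =
    `|C| * ((1 + `|x|) ^+ k.+1 * pdf x) by rewrite exprSr; ring.
  rewrite ler_wpM2l// (le_trans (HD' x))//.
  apply: (@le_trans _ _ (`|D| * normal_pdf 0 (Num.sqrt 2) x)).
    by rewrite ler_wpM2r ?normal_pdf_ge0// ler_norm.
  by rewrite ler_wpM2l// normal_pdf_ub.
have lim0 : F n.+1%:R - F (- n.+1%:R) @[n --> \oo] --> (0 : R).
  apply: norm_cvg0.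
  have up : (2 * K) * (n.+1%:R)^-1 @[n --> \oo] --> (0 : R).
    rewrite -[X in _ --> X](mulr0 (2 * K)); apply: cvgM; first exact: cvg_cst.
    exact: cvg_harmonic.
  apply: (squeeze_cvgr _ (cvg_cst _) up); near=> n.
  rewrite normr_ge0 /= (le_trans (ler_normB _ _))//.
  have n0 : 0 < n.+1%:R :> R by [].
  have K0 : 0 <= K by rewrite !mulr_ge0// normal_peak_ge0.
  have le1 : K / (1 + n.+1%:R) <= K / n.+1%:R.
    by rewrite ler_wpM2l// lef_pV2 ?posrE ?addr_gt0// lerDr.
  have F1 : `|F n.+1%:R| <= K / n.+1%:R.
    by apply: le_trans le1; have := FK n.+1%:R; rewrite (ger0_norm (ltW n0)).
  have F2 : `|F (- n.+1%:R)| <= K / n.+1%:R.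
    by apply: le_trans le1; have := FK (- n.+1%:R); rewrite normrN (ger0_norm (ltW n0)).
  by rewrite (le_trans (lerD F1 F2))// -mulrA mulr_natl mulr2n.
rewrite (_ : (fun n => _) = (fun n => \int[mu]_x Gn n x)) in lim0; last first.
  by apply/funext => n; rewrite ftc.
exact: (cvg_unique _ lim1 lim0).
Unshelve. all: by end_near. Qed.

End normal_ibp.

Lemma powR_add1_sum (R : realType) (J : finType) (a : J -> R) (p : R) :
  0 <= p -> (forall j, 0 <= a j) ->
  (1 + \sum_j a j) `^ p <= #|J|.+1%:R `^ p * (1 + \sum_j a j `^ p).
Proof.
move=> p0 a0.
have sum0 : 0 <= \sum_j a j `^ p by apply: sumr_ge0 => j _; exact: powR_ge0.
suff [M [M1 aM Mp]] : exists M : R, [/\ 1 <= M, (forall j, a j <= M) &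
    M `^ p <= 1 + \sum_j a j `^ p].
  have M0 : 0 <= M by exact: le_trans M1.
  apply: (@le_trans _ _ ((#|J|.+1%:R * M) `^ p)).
    apply: ge0_ler_powR => //.
    - by rewrite nnegrE addr_ge0// sumr_ge0.
    - by rewrite nnegrE mulr_ge0.
    rewrite -natr1 mulrDl mul1r addrC lerD// mulr_natl -sumr_const.
    by apply: ler_sum.
  by rewrite powRM// ler_wpM2l// powR_ge0.
have [[j' aj']|noj] := pselect (exists j, forall i, Num.max 1 (a i) <= a j).
  exists (a j'); split.
  - by have := aj' j'; rewrite ge_max => /andP[].
  - by move=> i; have := aj' i; rewrite ge_max => /andP[].
  - rewrite (bigD1 j')//= addrCA lerDl addr_ge0// sumr_ge0// => i _.
    exact: powR_ge0.
exists 1; split => //; last by rewrite powR1 lerDl.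
move=> j; rewrite leNgt; apply/negP => aj; apply: noj.
have [i _ ai] := @arg_maxP _ _ J j predT a isT.
exists i => k; rewrite ge_max; apply/andP; split; last exact: ai.
by apply: (le_trans (ltW aj)); exact: ai.
Qed.

Section gaussian_vector.
Context {R : realType} {d : nat} {disp : measure_display}
  {T : measurableType disp} (Q : probability T R) (Z0 : 'I_d -> {RV Q >-> R}).
Hypothesis hZ0 : standard_normal_vector Z0.

Let V := random_vector (fun j => Z0 j : T -> R).

Let mid : measurable_fun setT (id : measurableTypeR R -> R).
Proof. exact: measurable_id. Qed.

Let idRV : {RV (@normal_prob R 0 1) >-> R} :=
  MeasurableFun.Pack (MeasurableFun.Class (isMeasurableFun.Build _ _ _ _ _ mid)).

Lemma ge0_integral_normal_coord (j : 'I_d) (f : R -> \bar R) :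
  measurable_fun setT f -> (forall x, 0 <= f x)%E ->
  (\int[distribution Q (Z0 j)]_x f x = \int[normal_prob 0 1]_x f x)%E.
Proof.
move=> mf f0.
rewrite -[RHS](@ge0_integral_distribution _ _ _ _ _ (@normal_prob R 0 1) idRV f)//.
by apply: eq_measure_integral => A mA _; exact: hZ0.1.
Qed.

Lemma integral_normal_coord (j : 'I_d) (f : R -> \bar R) :
  (@normal_prob R 0 1).-integrable setT f ->
  (\int[distribution Q (Z0 j)]_x f x = \int[normal_prob 0 1]_x f x)%E.
Proof.
move=> intf.
rewrite -[RHS](@integral_distribution _ _ _ _ _ (@normal_prob R 0 1) idRV f)//.
  by apply: eq_measure_integral => A mA _; exact: hZ0.1.
by have /integrableP[] := intf.
Qed.

Lemma integrable_normal_coord (j : 'I_d) (f : R -> R) (C : R) (k : nat) :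
  measurable_fun setT f -> (forall x, `|f x| <= C * (1 + `|x|) ^+ k) ->
  Q.-integrable setT (EFin \o (fun y => f (Z0 j y))).
Proof.
move=> mf fC; have /integrableP[_ iC] := integrable_normal_poly mf fC.
apply/integrableP; split.
  by apply/measurable_EFinP; exact: measurableT_comp.
rewrite -(@ge0_integral_distribution _ _ _ _ _ Q (Z0 j) (fun x => `|(f x)%:E|%E))//; last first.
  by apply: measurableT_comp => //; exact/measurable_EFinP.
rewrite ge0_integral_normal_coord//.
by apply: measurableT_comp => //; exact/measurable_EFinP.
Qed.

Lemma integrable_gaussian_norm1 (k : nat) :
  Q.-integrable setT (EFin \o (fun y => (1 + norm1 (V y)) ^+ k)).
Proof.
have mV : measurable_fun setT (fun y => norm1 (V y)).
  apply: measurable_sum => j; apply: measurableT_comp => //.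
  by rewrite (_ : (fun _ => _) = Z0 j)//; apply/funext => y; rewrite mxE.
have ij (j : 'I_d) : Q.-integrable setT (EFin \o (fun y => `|Z0 j y| ^+ k)).
  apply: (@integrable_normal_coord j (fun x => `|x| ^+ k) 1 k).
    by apply: measurable_funX.
  move=> x; rewrite mul1r normrX normr_id lerXn2r ?nnegrE ?addr_ge0//.
  by rewrite lerDr.
pose c : R := d.+1%:R `^ k%:R.
have ig : Q.-integrable setT (fun y => c%:E * (1 + \sum_(j < d) (`|Z0 j y| ^+ k)%:E))%E.
  apply: integrableZl => //; apply: integrableD => //.
    exact: finite_measure_integrable_cst.
  by apply: integrable_sum => // j _; exact: ij.
apply: (le_integrable _ _ _ ig) => //.
  apply/measurable_EFinP; apply: measurable_funX; exact: measurable_funD.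
move=> y _; rewrite sumEFin -EFinD -EFinM lee_fin.
rewrite ger0_norm ?exprn_ge0 ?addr_ge0 ?norm1_ge0// (le_trans _ (ler_norm _))//.
rewrite -powR_mulrn ?addr_ge0 ?norm1_ge0//.
have := @powR_add1_sum R 'I_d (fun j => `|Z0 j y|) k%:R.
rewrite card_ord => /(_ _ _)/wrap[||H]//.
rewrite (_ : norm1 (V y) = \sum_j `|Z0 j y|); last first.
  by apply: eq_bigr => j _; rewrite mxE.
apply: le_trans H _; rewrite ler_wpM2l ?powR_ge0// lerD2l ler_sum// => j _.
by rewrite powR_mulrn.
Qed.

Lemma integrable_gaussian (F : T -> R) (C : R) (k : nat) :
  measurable_fun setT F -> (forall y, `|F y| <= C * (1 + norm1 (V y)) ^+ k) ->
  Q.-integrable setT (EFin \o F).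
Proof.
move=> mF FC.
have ig : Q.-integrable setT (fun y => C%:E * ((1 + norm1 (V y)) ^+ k)%:E)%E.
  by apply: integrableZl => //; exact: integrable_gaussian_norm1.
apply: (le_integrable _ _ _ ig) => //; first exact/measurable_EFinP.
by move=> x _; rewrite /= lee_fin (le_trans (FC x))// ler_norm.
Qed.

Section coordinate.
Variable a : 'I_d.

Let G (j : 'I_d) : set (set T) := preimage_set_system setT (Z0 j : T -> R) measurable.

Let algG j : sigma_algebra setT (G j).
Proof. exact/sigma_algebra_preimage/sigma_algebra_measurable. Qed.

Let mG j : G j `<=` measurable.
Proof. by move=> _ [B mB <-]; exact: measurable_funPT. Qed.

Let GT := g_sigma_algebraType (other_generators G a).

Let otherRV : {RV Q >-> GT} := MeasurableFun.Pack (MeasurableFun.Class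
  (isMeasurableFun.Build _ _ _ _ _ (@measurable_to_other _ _ _ G a mG))).

Let indep_coord (A : set R) (C : set GT) : measurable A -> measurable C ->
  Q (Z0 a @^-1` A `&` otherRV @^-1` C) = (Q (Z0 a @^-1` A) * Q (otherRV @^-1` C))%E.
Proof.
move=> mA mC; apply: (indep_other hZ0.2 algG mG _ mC).
by exists A => //; rewrite setTI.
Qed.

Let base (y : T) : 'cV[R]_d := \col_j (if j == a then 0 else Z0 j y).

Let baseE y : base y + Z0 a y *: delta_mx a 0 = V y.
Proof.
apply/colP => j; rewrite !mxE; case: eqP => [->|_]; first by rewrite add0r mulr1.
by rewrite mulr0 addr0.
Qed.

Let measurable_split (F : 'cV[R]_d -> R) : norm1_continuous F ->
  measurable_fun setT (fun z : GT * R => F (base z.1 + z.2 *: delta_mx a 0)).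
Proof.
move=> cF; apply: measurable_norm1_continuous => // j.
have [->|ja] := eqVneq j a.
  rewrite (_ : (fun _ => _) = snd); first exact: measurable_snd.
  by apply/funext => z; rewrite !mxE !eqxx add0r mulr1.
rewrite (_ : (fun _ => _) = (Z0 j : GT -> R) \o fst); last first.
  by apply/funext => z; rewrite !mxE (negbTE ja) /= mulr0 addr0.
apply: measurableT_comp; last exact: measurable_fst.
move=> _ B mB; rewrite setTI; apply: sub_sigma_algebra.
by exists j => //; exists B => //; rewrite setTI.
Qed.

Lemma gaussian_ibp_coord (H dH : 'cV[R]_d -> R) (C : R) (k : nat) :
  (forall z (t : R), is_derive t 1 (fun s : R => H (z + s *: delta_mx a 0))
     (dH (z + t *: delta_mx a 0))) ->
  norm1_continuous H -> norm1_continuous dH ->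
  (forall z, `|H z| <= C * (1 + norm1 z) ^+ k) ->
  (forall z, `|dH z| <= C * (1 + norm1 z) ^+ k) ->
  \int[Q]_y (Z0 a y * H (V y)) = \int[Q]_y dH (V y).
Proof.
move=> HD cH cdH HC dHC.
have mV j : measurable_fun setT (fun y => V y j 0).
  by rewrite (_ : (fun _ => _) = Z0 j)//; apply/funext => y; rewrite mxE.
have mH := measurable_norm1_continuous cH mV.
have mdH := measurable_norm1_continuous cdH mV.
have normV y : `|Z0 a y| <= norm1 (V y).
  by have := le_norm1 (V y) a; rewrite mxE.
have C0 : 0 <= C.
  by have := HC 0; rewrite /norm1 big1 ?addr0 ?expr1n ?mulr1 => [|i _]; [exact: le_trans|rewrite mxE normr0].
have i1 : Q.-integrable setT (fun y => (Z0 a y * H (base y + Z0 a y *: delta_mx a 0))%:E).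
  under eq_fun do rewrite baseE.
  apply: (@integrable_gaussian _ C k.+1); first exact: measurable_funM.
  move=> y; rewrite normrM exprS mulrCA ler_pM// (le_trans (normV y))//.
  by rewrite lerDr.
have i2 : Q.-integrable setT (fun y => (dH (base y + Z0 a y *: delta_mx a 0))%:E).
  under eq_fun do rewrite baseE.
  by apply: (integrable_gaussian mdH) => y; exact: dHC.
have m1 : measurable_fun setT (fun z : GT * R =>
    (z.2 * H (base z.1 + z.2 *: delta_mx a 0))%:E).
  apply/measurable_EFinP; apply: measurable_funM; first exact: measurable_snd.
  exact: measurable_split.
have m2 : measurable_fun setT (fun z : GT * R => (dH (base z.1 + z.2 *: delta_mx a 0))%:E).
  by apply/measurable_EFinP; exact: measurable_split.
have := indep_integral indep_coord m1 i1.
have := indep_integral indep_coord m2 i2.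
rewrite /= => E2 E1; rewrite /Rintegral; congr fine.
under eq_integral do rewrite -baseE; rewrite E1.
under [RHS]eq_integral do rewrite -baseE; rewrite E2.
apply: eq_integral => y _.
have n1 : norm1 (delta_mx a 0 : 'cV[R]_d) = 1.
  rewrite /norm1 (bigD1 a)//= big1 => [|j ja]; rewrite !mxE.
    by rewrite !eqxx normr1 addr0.
  by rewrite (negbTE ja) normr0.
have bound x : (1 + norm1 (base y + x *: delta_mx a 0)) ^+ k <=
    (1 + norm1 (base y)) ^+ k * (1 + `|x|) ^+ k.
  rewrite -exprMn lerXn2r ?nnegrE ?mulr_ge0 ?addr_ge0 ?norm1_ge0//.
  have := norm1D (base y) (x *: delta_mx a 0); rewrite norm1Z n1 mulr1.
  by have := norm1_ge0 (base y); have := normr_ge0 x; nra.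
have Hx x : `|H (base y + x *: delta_mx a 0)| <=
    C * (1 + norm1 (base y)) ^+ k * (1 + `|x|) ^+ k.
  by rewrite (le_trans (HC _))// -mulrA ler_wpM2l.
have dHx x : `|dH (base y + x *: delta_mx a 0)| <=
    C * (1 + norm1 (base y)) ^+ k * (1 + `|x|) ^+ k.
  by rewrite (le_trans (dHC _))// -mulrA ler_wpM2l.
have cdHx : continuous (fun x : R => dH (base y + x *: delta_mx a 0)).
  move=> x; apply/cvgrPdist_le => e e0.
  have [c c0 cE] := cdH (base y + x *: delta_mx a 0) e e0.
  near=> x'; rewrite distrC.
  have -> : base y + x' *: delta_mx a 0 =
      base y + x *: delta_mx a 0 + (x' - x) *: delta_mx a 0.
    by rewrite -addrA -scalerDl [x + _]addrC subrK.
  apply: cE; rewrite norm1Z n1 mulr1 distrC.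
  by near: x'; exact: (@cvgr_dist_le _ _ _ _ _ id x).
have ibp := @normal_ibp R _ _ _ k (HD (base y)) cdHx Hx dHx.
have mHx : measurable_fun setT (fun x : R => H (base y + x *: delta_mx a 0)).
  apply: continuous_measurable_fun => x; apply: differentiable_continuous.
  by apply/derivable1_diffP; have [] := HD (base y) x.
have j1 : (@normal_prob R 0 1).-integrable setT
    (EFin \o (fun x => x * H (base y + x *: delta_mx a 0))).
  apply: (@integrable_normal_poly _ _ (C * (1 + norm1 (base y)) ^+ k) k.+1).
    by apply: measurable_funM.
  by move=> x; rewrite normrM exprS [leRHS]mulrCA ler_pM// lerDr.
have j2 : (@normal_prob R 0 1).-integrable setT
    (EFin \o (fun x => dH (base y + x *: delta_mx a 0))).
  by apply: integrable_normal_poly dHx; exact: continuous_measurable_fun.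
rewrite (integral_normal_coord a j1) (integral_normal_coord a j2).
have f1 := integrable_fin_num measurableT j1.
have f2 := integrable_fin_num measurableT j2.
by rewrite -[LHS](fineK f1) -[RHS](fineK f2); congr EFin.
Unshelve. all: by end_near. Qed.

End coordinate.
End gaussian_vector.

Lemma powR_ge_tangent (R : realType) (a y : R) : 1 <= a -> 0 <= y ->
  1 + a * (y - 1) <= y `^ a.
Proof.
rewrite le_eqVlt => /predU1P[<- y0|a1 y0]; first by rewrite mul1r powRr1// addrC subrK.
have a0 : 0 < a by exact: lt_trans a1.
have q0 : 0 < a / (a - 1) by rewrite divr_gt0// subr_gt0.
have := @conjugate_powR R y 1 a (a / (a - 1)) y0 ler01 a0 q0.
rewrite powR1 mulr1 => /(_ _)/wrap[|].
  have a0' : a != 0 by rewrite gt_eqF.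
  have a1' : a - 1 != 0 by rewrite subr_eq0 gt_eqF.
  by field; rewrite a0' a1'.
rewrite invf_div mul1r => H; have := ler_wpM2l (ltW a0) H.
rewrite mulrDr mulrCA mulfV ?gt_eqF// mulr1 mulrCA mulfV ?gt_eqF// mulr1.
lra.
Qed.

Lemma powR_le_tangent (R : realType) (s y : R) : 0 <= s <= 1 -> 0 <= y ->
  y `^ s <= 1 + s * (y - 1).
Proof.
move=> /andP[]; rewrite le_eqVlt => /predU1P[<- _ y0|s0 s1 y0].
  by rewrite powRr0 mul0r addr0.
have := @powR_ge_tangent R s^-1 (y `^ s).
rewrite -powRrM mulfV ?gt_eqF// powRr1// => /(_ _ _)/wrap[||H].
- by rewrite -[leLHS]invr1 lef_pV2 ?posrE.
- exact: powR_ge0.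
have := ler_wpM2l (ltW s0) H; rewrite mulrDr mulr1 mulrA mulfV ?gt_eqF// mul1r.
lra.
Qed.

Lemma abs_powRE (R : realType) (q x : R) : `|x| `^ q = (x ^+ 2) `^ (q / 2).
Proof.
rewrite -[x ^+ 2]real_normK ?num_real// -powR_mulrn// -powRrM; congr (_ `^ _).
by field.
Qed.

Lemma continuous_abs_powR (R : realType) (q : R) : 0 <= q ->
  continuous (fun x : R => `|x| `^ q).
Proof.
rewrite le_eqVlt => /predU1P[<- x|q0 x].
  by rewrite (_ : (fun _ => _) = cst 1)//; [exact: cvg_cst|apply/funext => y; rewrite powRr0].
have [->|x0] := eqVneq x 0.
  rewrite /continuous_at normr0 powR0 ?gt_eqF//; apply/cvgr0Pnorm_le => e e0.
  have c0 : 0 < e `^ q^-1 by rewrite powR_gt0.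
  apply: filterS (@nbhs0_le R R^o _ c0) => h hc.
  rewrite ger0_norm ?powR_ge0//.
  rewrite -[leRHS](powRr1 (ltW e0)) -(mulVf (lt0r_neq0 q0)) powRrM.
  by apply: ge0_ler_powR; rewrite ?nnegrE ?powR_ge0 ?(ltW q0).
apply: differentiable_continuous; apply/derivable1_diffP.
rewrite (_ : (fun _ => _) = (fun y => y `^ (q / 2)) \o (fun y : R => y ^+ 2)); last first.
  by apply/funext => y /=; rewrite abs_powRE.
have := @is_derive1_comp R (fun y => y `^ (q / 2)) (fun y : R => y ^+ 2) x _ _
  (is_derive1_powR _ _) (is_deriveX 2 (is_derive_id x 1)).
by move=> /(_ _)/wrap[|[]//]; rewrite exprn_even_gt0.
Qed.

Lemma is_derive_signed_powR (R : realType) (q x : R) : 0 <= q ->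
  is_derive x 1 (fun y : R => y * `|y| `^ q) ((q + 1) * `|x| `^ q).
Proof.
move=> q0; have [->|x0] := eqVneq x 0.
  have hE (h : R) : h *: (1 : R) + 0 = h by rewrite [_ *: _]mulr1 addr0.
  have H : h^-1 *: ((h *: (1 : R) + 0) * `|h *: (1 : R) + 0 : R| `^ q - 0 * `|0 : R| `^ q)
     @[h --> (0 : R)^'] --> (q + 1) * `|0 : R| `^ q.
    have [q0'|q0'] := eqVneq q 0.
      have pE (y : R) : y `^ q = 1 by rewrite q0' powRr0.
      rewrite [X in _ --> X](_ : _ = 1); last by rewrite pE q0' add0r mulr1.
      apply: cvg_near_cst.
      apply: filterS (@nbhs_dnbhs_neq R 0) => h h0.
      by rewrite hE !pE mul0r subr0 mulr1; exact: mulVf.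
    have L : `|h| `^ q @[h --> (0 : R)^'] --> `|0 : R| `^ q.
      by apply: cvg_within_filter; exact: (continuous_abs_powR q0 (x := 0)).
    rewrite normr0 powR0// in L.
    rewrite [X in _ --> X](_ : _ = 0); last by rewrite normr0 powR0// mulr0.
    apply: (cvg_trans _ L); apply: near_eq_cvg.
    apply: filterS (@nbhs_dnbhs_neq R 0) => h h0.
    by rewrite hE mul0r subr0 [_ *: _]mulrA mulVf ?mul1r.
  by split; [exact: cvgP H|exact: cvg_lim H].
have x2 : 0 < x ^+ 2 by rewrite exprn_even_gt0.
have D1 := @is_derive1_comp R (fun y => y `^ (q / 2)) (fun y : R => y ^+ 2) x _ _
  (is_derive1_powR (q / 2) x2) (is_deriveX 2 (is_derive_id x 1)).
have -> : (fun y : R => y * `|y| `^ q) = (id : R -> R) * ((fun y => y `^ (q / 2)) \o (fun y : R => y ^+ 2)).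
  by apply/funext => y /=; rewrite abs_powRE.
apply: (is_derive_eq (is_deriveM (is_derive_id x 1) D1)).
rewrite /= abs_powRE -![_ *: _]/(_ * _) expr1.
have [->|qn0] := eqVneq q 0; first by rewrite !mul0r; ring.
have <- : x ^+ 2 * (x ^+ 2) `^ (q / 2 - 1) = (x ^+ 2) `^ (q / 2).
  by rewrite mulr_powRB1// ?ltW// divr_gt0// lt_neqAle eq_sym qn0.
by field.
Qed.

Lemma expR_le_step (R : realType) (t a c : R) :
  expR t <= a -> a * a <= c -> expR (t + t) <= c.
Proof. by move=> ha; apply: le_trans; rewrite expRD ler_pM ?expR_ge0. Qed.

Lemma expR_le_inv (R : realType) (x c : R) : 0 < c -> 1 <= c * (1 - x) -> expR x <= c.
Proof.
move=> c0 cx; have := @expR_ge1Dx R (- x); rewrite expRN => h.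
have e0 := expR_gt0 x.
have : c * (1 - x) <= c * (expR x)^-1 by rewrite ler_wpM2l// ltW.
by move=> /(le_trans cx); rewrite ler_pdivlMr// mul1r.
Qed.

Lemma expR_odd_inverses (R : realType) : expR (1 + 1 / 3 + 1 / 5 + 1 / 7 + 1 / 9 : R) <= 6.
Proof.
pose x : R := (1 + 1 / 3 + 1 / 5 + 1 / 7 + 1 / 9) / 4 / 4 / 4 / 4 / 4.
have e0 : expR x <= (1 + (0 + (0 + (1 + (7 + (4 + 9 / 10) / 10) / 10) / 10) / 10) / 10) by apply: expR_le_inv; rewrite /x; lra.
pose x1 := x + x.
have e1 : expR x1 <= (1 + (0 + (0 + (3 + (5 + (0 + 2 / 10) / 10) / 10) / 10) / 10) / 10) by apply: (expR_le_step e0); lra.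
pose x2 := x1 + x1.
have e2 : expR x2 <= (1 + (0 + (0 + (7 + (0 + (1 + 7 / 10) / 10) / 10) / 10) / 10) / 10) by apply: (expR_le_step e1); lra.
pose x3 := x2 + x2.
have e3 : expR x3 <= (1 + (0 + (1 + (4 + (0 + (8 + 4 / 10) / 10) / 10) / 10) / 10) / 10) by apply: (expR_le_step e2); lra.
pose x4 := x3 + x3.
have e4 : expR x4 <= (1 + (0 + (2 + (8 + (3 + (6 + 7 / 10) / 10) / 10) / 10) / 10) / 10) by apply: (expR_le_step e3); lra.
pose x5 := x4 + x4.
have e5 : expR x5 <= (1 + (0 + (5 + (7 + (5 + (3 + 9 / 10) / 10) / 10) / 10) / 10) / 10) by apply: (expR_le_step e4); lra.
pose x6 := x5 + x5.
have e6 : expR x6 <= (1 + (1 + (1 + (8 + (3 + (8 + 9 / 10) / 10) / 10) / 10) / 10) / 10) by apply: (expR_le_step e5); lra.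
pose x7 := x6 + x6.
have e7 : expR x7 <= (1 + (2 + (5 + (0 + (7 + (9 + 4 / 10) / 10) / 10) / 10) / 10) / 10) by apply: (expR_le_step e6); lra.
pose x8 := x7 + x7.
have e8 : expR x8 <= (1 + (5 + (6 + (4 + (4 + (8 + 6 / 10) / 10) / 10) / 10) / 10) / 10) by apply: (expR_le_step e7); lra.
pose x9 := x8 + x8.
have e9 : expR x9 <= (2 + (4 + (4 + (7 + (6 + (1 + 7 / 10) / 10) / 10) / 10) / 10) / 10) by apply: (expR_le_step e8); lra.
pose x10 := x9 + x9.
have e10 : expR x10 <= (5 + (9 + (9 + (0 + (8 + (2 + 9 / 10) / 10) / 10) / 10) / 10) / 10) by apply: (expR_le_step e9); lra.
have -> : 1 + 1 / 3 + 1 / 5 + 1 / 7 + 1 / 9 = x10 by rewrite /x10 /x9 /x8 /x7 /x6 /x5 /x4 /x3 /x2 /x1 /x; lra.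
by apply: (le_trans e10); lra.
Qed.

Section linear_maps.
Context {R : realType} {d : nat}.
Implicit Types (S : 'M[R]_d) (v : 'cV[R]_d).

Definition mx_norm1 S : R := \sum_t \sum_a `|S t a|.

Lemma mx_norm1_ge0 S : 0 <= mx_norm1 S.
Proof. by apply: sumr_ge0 => t _; exact: sumr_ge0. Qed.

Lemma mulmx_col S v t : (S *m v) t 0 = \sum_a S t a * v a 0.
Proof. by rewrite mxE. Qed.

Lemma le_mulmx_coord S v t : `|(S *m v) t 0| <= (\sum_a `|S t a|) * norm1 v.
Proof.
rewrite mulmx_col (le_trans (ler_norm_sum _ _ _))// mulr_suml ler_sum// => a _.
by rewrite normrM ler_wpM2l// le_norm1.
Qed.

Lemma norm1_mulmx S v : norm1 (S *m v) <= mx_norm1 S * norm1 v.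
Proof.
rewrite /norm1 /mx_norm1 mulr_suml; apply: ler_sum => t _; exact: le_mulmx_coord.
Qed.

Lemma norm1_delta (a : 'I_d) : norm1 (delta_mx a 0 : 'cV[R]_d) = 1.
Proof.
rewrite /norm1 (bigD1 a)//= big1 => [|j ja]; rewrite !mxE.
  by rewrite !eqxx normr1 addr0.
by rewrite (negbTE ja) normr0.
Qed.

Lemma norm1_continuous_affine (F : 'cV[R]_d -> R) S b : norm1_continuous F ->
  norm1_continuous (fun v => F (b + S *m v)).
Proof.
move=> cF w e e0; have [c c0 cE] := cF (b + S *m w) e e0.
exists (c / (1 + mx_norm1 S)); first by rewrite divr_gt0// ltr_pwDl// mx_norm1_ge0.
move=> v vc; rewrite mulmxDr addrA; apply: cE.
rewrite (le_trans (norm1_mulmx _ _))//.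
have n0 := mx_norm1_ge0 S.
rewrite ler_pdivlMr ?ltr_pwDl// in vc.
by have := norm1_ge0 v; nra.
Qed.

Lemma norm1_continuous_coord (f : R -> R) (t : 'I_d) : continuous f ->
  norm1_continuous (fun v => f (v t 0)).
Proof.
move=> cf w e e0.
have /cvgrPdist_le/(_ e e0) := cf (w t 0).
move=> [c /= c0 cE]; exists (c / 2); first by rewrite divr_gt0.
move=> v vc; rewrite distrC; apply: cE => /=.
rewrite mxE opprD addrA subrr sub0r normrN (le_lt_trans (le_norm1 v t))//.
by rewrite (le_lt_trans vc)// ltr_pdivrMr// ltr_pMr// ltr1n.
Qed.

Lemma norm1_continuousZ (F : 'cV[R]_d -> R) (a : R) : norm1_continuous F ->
  norm1_continuous (fun v => a * F v).
Proof.
move=> cF w e e0.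
have a0 : 0 < 1 + `|a| by rewrite ltr_pwDl.
have [c c0 cE] := cF w (e / (1 + `|a|)) (divr_gt0 e0 a0); exists c => // v /cE.
rewrite ler_pdivlMr// -mulrBr normrM => /(le_trans _); apply.
by rewrite mulrC ler_wpM2l// lerDr.
Qed.

Lemma norm1_continuousD (F G : 'cV[R]_d -> R) : norm1_continuous F ->
  norm1_continuous G -> norm1_continuous (fun v => F v + G v).
Proof.
move=> cF cG w e e0.
have e20 : 0 < e / 2 by rewrite divr_gt0.
have [c c0 cE] := cF w _ e20; have [c' c'0 c'E] := cG w _ e20.
exists (Num.min c c'); first by rewrite lt_min c0.
move=> v; rewrite le_min => /andP[/cE h1 /c'E h2].
rewrite opprD addrACA (le_trans (ler_normD _ _))// (le_trans (lerD h1 h2))//.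
by rewrite -splitr.
Qed.

Lemma norm1_continuous_cst (a : R) : norm1_continuous (fun _ : 'cV[R]_d => a).
Proof. by move=> w e e0; exists 1 => // v _; rewrite subrr normr0 ltW. Qed.

Lemma norm1_continuous_sum (I : Type) (s : seq I) (F : I -> 'cV[R]_d -> R) :
  (forall i, norm1_continuous (F i)) ->
  norm1_continuous (fun v => \sum_(i <- s) F i v).
Proof.
move=> cF; elim: s => [|i s IH].
  rewrite (_ : (fun _ => _) = (fun=> 0)); first exact: norm1_continuous_cst.
  by apply/funext => v; rewrite big_nil.
rewrite (_ : (fun _ => _) = (fun v => F i v + \sum_(i <- s) F i v)).
  exact: norm1_continuousD.
by apply/funext => v; rewrite big_cons.
Qed.

Definition poly_bounded (F : 'cV[R]_d -> R) :=
  exists C k, 0 <= C /\ forall v, `|F v| <= C * (1 + norm1 v) ^+ k.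

Lemma poly_boundedZ F a : poly_bounded F -> poly_bounded (fun v => a * F v).
Proof.
move=> [C [k [C0 FC]]]; exists (`|a| * C), k; split; first exact: mulr_ge0.
by move=> v; rewrite normrM -mulrA ler_wpM2l.
Qed.

Lemma poly_boundedD F G : poly_bounded F -> poly_bounded G ->
  poly_bounded (fun v => F v + G v).
Proof.
move=> [C [k [C0 FC]]] [C' [k' [C'0 GC]]]; exists (C + C'), (k + k')%N.
split=> [|v]; first exact: addr_ge0.
rewrite (le_trans (ler_normD _ _))// mulrDl lerD//.
  rewrite (le_trans (FC v))// ler_wpM2l// ler_weXn2l ?leq_addr//.
  by rewrite lerDl norm1_ge0.
rewrite (le_trans (GC v))// ler_wpM2l// ler_weXn2l ?leq_addl//.
by rewrite lerDl norm1_ge0.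
Qed.

Lemma poly_bounded_cst a : poly_bounded (fun=> a).
Proof. by exists `|a|, 0%N; split=> // v; rewrite expr0 mulr1. Qed.

Lemma poly_bounded_sum (I : Type) (s : seq I) (F : I -> 'cV[R]_d -> R) :
  (forall i, poly_bounded (F i)) -> poly_bounded (fun v => \sum_(i <- s) F i v).
Proof.
move=> bF; elim: s => [|i s IH].
  rewrite (_ : (fun _ => _) = (fun=> 0)); first exact: poly_bounded_cst.
  by apply/funext => v; rewrite big_nil.
rewrite (_ : (fun _ => _) = (fun v => F i v + \sum_(i <- s) F i v)).
  exact: poly_boundedD.
by apply/funext => v; rewrite big_cons.
Qed.

Lemma poly_bounded_affine F b S : poly_bounded F ->
  poly_bounded (fun v => F (b + S *m v)).
Proof.
move=> [C [k [C0 FC]]]; exists (C * (1 + norm1 b + mx_norm1 S) ^+ k), k.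
have b0 := norm1_ge0 b; have S0 := mx_norm1_ge0 S.
split=> [|v]; first by rewrite mulr_ge0// exprn_ge0// !addr_ge0.
rewrite (le_trans (FC _))// -mulrA ler_wpM2l// -exprMn.
have v0 := norm1_ge0 v.
rewrite lerXn2r ?nnegrE ?mulr_ge0 ?addr_ge0 ?norm1_ge0//.
have := norm1D b (S *m v); have := norm1_mulmx S v; nra.
Qed.

Lemma poly_bounded_coord (f : R -> R) (t : 'I_d) (C : R) (k : nat) :
  0 <= C -> (forall x, `|f x| <= C * (1 + `|x|) ^+ k) ->
  poly_bounded (fun v => f (v t 0)).
Proof.
move=> C0 fC; exists C, k; split => // v; rewrite (le_trans (fC _))// ler_wpM2l//.
by rewrite lerXn2r ?nnegrE ?addr_ge0 ?norm1_ge0// lerD2l le_norm1.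
Qed.

Lemma is_derive_affine_coord S (b z : 'cV[R]_d) (a t : 'I_d) (s : R) :
  is_derive s 1 (fun u : R => (b + S *m (z + u *: delta_mx a 0)) t 0) (S t a).
Proof.
have -> : (fun u : R => (b + S *m (z + u *: delta_mx a 0)) t 0) =
    cst ((b + S *m z) t 0) + S t a *: (id : R -> R).
  have D : (S *m delta_mx a 0 : 'cV[R]_d) t 0 = S t a.
    rewrite mxE (bigD1 a)//= big1 => [|j ja]; rewrite mxE.
      by rewrite !eqxx mulr1 addr0.
    by rewrite (negbTE ja) mulr0.
  apply/funext => u; rewrite mulmxDr -scalemxAr addrA [LHS]mxE [X in _ + X]mxE D.
  by rewrite [u * _]mulrC.
rewrite -[S t a in X in is_derive _ _ _ X]mulr1 -[X in is_derive _ _ _ X]add0r.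
by apply: is_deriveD; exact: is_deriveZ.
Qed.

End linear_maps.

Section gaussian_linear_image.
Context {R : realType} {d : nat} {disp : measure_display}
  {T : measurableType disp} (Q : probability T R) (Z0 : 'I_d -> {RV Q >-> R}).
Hypothesis hZ0 : standard_normal_vector Z0.
Variable S : 'M[R]_d.
Hypothesis symS : S^T = S.

Let V := random_vector (fun j => Z0 j : T -> R).
Let Z y := S *m V y.

Lemma measurable_gaussian_coord j : measurable_fun setT (fun y => V y j 0).
Proof. by rewrite (_ : (fun _ => _) = Z0 j)//; apply/funext => y; rewrite mxE. Qed.

Lemma measurable_gaussian (F : 'cV[R]_d -> R) :
  norm1_continuous F -> measurable_fun setT (fun y => F (V y)).
Proof.
by move=> cF; apply: measurable_norm1_continuous => //; exact: measurable_gaussian_coord.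
Qed.

Lemma measurable_gaussian_image (F : 'cV[R]_d -> R) :
  norm1_continuous F -> measurable_fun setT (fun y => F (Z y)).
Proof.
move=> /(norm1_continuous_affine S 0) cF.
rewrite (_ : (fun _ => _) = (fun y => F (0 + S *m V y))); first exact: measurable_gaussian cF.
by apply/funext => y; rewrite add0r.
Qed.

Lemma integrable_gaussian_poly (F : 'cV[R]_d -> R) :
  norm1_continuous F -> poly_bounded F ->
  integrable_real Q (fun y => F (V y)).
Proof.
move=> cF [C [k [C0 FC]]]; apply: (integrable_gaussian hZ0 (C := C) (k := k)) => //.
exact: measurable_gaussian.
Qed.

Lemma integrable_gaussian_image (F : 'cV[R]_d -> R) :
  norm1_continuous F -> poly_bounded F ->
  integrable_real Q (fun y => F (Z y)).
Proof.
move=> /(norm1_continuous_affine S 0) cF /(poly_bounded_affine 0 S) bF.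
rewrite (_ : (fun _ => _) = (fun y => F (0 + S *m V y))).
  exact: (integrable_gaussian_poly cF bF).
by apply/funext => y; rewrite add0r.
Qed.

Lemma gaussian_ibp_image (H : 'cV[R]_d -> R) (dH : 'I_d -> 'cV[R]_d -> R) (j : 'I_d) :
  (forall z a (t : R), is_derive t 1 (fun s : R => H (z + s *: delta_mx a 0))
     (dH a (z + t *: delta_mx a 0))) ->
  norm1_continuous H -> (forall a, norm1_continuous (dH a)) ->
  poly_bounded H -> (forall a, poly_bounded (dH a)) ->
  \int[Q]_y (Z y j 0 * H (V y)) = \sum_a S j a * \int[Q]_y dH a (V y).
Proof.
move=> HD cH cdH [C [k [C0 HC]]] bdH.
have iZH a : integrable_real Q (fun y => Z0 a y * H (V y)).
  apply: (integrable_gaussian hZ0 (C := C) (k := k.+1)).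
    by apply: measurable_funM => //; exact: measurable_gaussian.
  move=> y; rewrite normrM exprS mulrCA ler_pM//.
  by have := le_norm1 (V y) a; rewrite mxE => /le_trans; apply; rewrite lerDr.
rewrite (_ : (fun y => _) = (fun y => \sum_a S j a * (Z0 a y * H (V y)))); last first.
  apply/funext => y; rewrite mulmx_col mulr_suml; apply: eq_bigr => a _.
  by rewrite mxE mulrA.
rewrite rintegral_sum; last by move=> a; exact: integrable_realZ.
apply: eq_bigr => a _; rewrite rintegralZ//; congr (_ * _).
have [C' [k' [C'0 dHC]]] := bdH a.
apply: (@gaussian_ibp_coord _ _ _ _ _ _ hZ0 a H (dH a) (C + C') (k + k')) => //.
  move=> z; rewrite (le_trans (HC z))// ler_pM ?exprn_ge0 ?addr_ge0 ?norm1_ge0//.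
    by rewrite lerDl.
  by rewrite ler_weXn2l ?leq_addr// lerDl norm1_ge0.
move=> z; rewrite (le_trans (dHC z))// ler_pM ?exprn_ge0 ?addr_ge0 ?norm1_ge0//.
  by rewrite lerDr.
by rewrite ler_weXn2l ?leq_addl// lerDl norm1_ge0.
Qed.

Lemma gaussian_ibp (F : 'cV[R]_d -> R) (b : 'cV[R]_d) (c : R) (j : 'I_d) :
  coord_derivable F -> (forall i, coord_derivable (pderiv i F)) ->
  (forall i l, locally_bounded (pderiv l (pderiv i F))) ->
  norm1_continuous F -> (forall i, norm1_continuous (pderiv i F)) ->
  poly_bounded F -> (forall i, poly_bounded (pderiv i F)) ->
  \int[Q]_y (Z y j 0 * F (b + c *: Z y)) =
    c * \sum_k (S *m S) j k * \int[Q]_y pderiv k F (b + c *: Z y).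
Proof.
move=> dF ddF bF cF cdF pF pdF.
have E v : b + c *: (S *m v) = b + (c *: S) *m v by rewrite -scalemxAl.
pose H v := F (b + (c *: S) *m v).
rewrite (_ : (fun y => _) = (fun y => Z y j 0 * H (V y))); last first.
  by apply/funext => y; rewrite /H /Z E.
pose dH (a : 'I_d) v := \sum_k (c *: S) k a * pderiv k F (b + (c *: S) *m v).
transitivity (\sum_a S j a * \int[Q]_y dH a (V y)); last first.
  rewrite /dH.
  have iF k : integrable_real Q (fun y => pderiv k F (b + (c *: S) *m V y)).
    apply: (integrable_gaussian_poly (F := fun v => pderiv k F (b + (c *: S) *m v))).
      exact: norm1_continuous_affine.
    exact: poly_bounded_affine.
  under eq_bigr => a _.
    rewrite rintegral_sum; last by move=> k; exact: integrable_realZ.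
    rewrite mulr_sumr.
    under eq_bigr => k _ do rewrite rintegralZ//.
    over.
  rewrite exchange_big mulr_sumr; apply: eq_bigr => k _.
  rewrite mxE !mulr_suml mulr_sumr; apply: eq_bigr => a _.
  rewrite (_ : (fun y => pderiv k F (b + c *: Z y)) = (fun y => pderiv k F (b + (c *: S) *m V y))); last first.
    by apply/funext => y; rewrite /Z E.
  have -> : S a k = S k a by rewrite -[in LHS]symS mxE.
  by rewrite mxE; ring.
apply: gaussian_ibp_image.
- move=> z a t.
  apply: (@is_derive_curve R d F (fun u => b + (c *: S) *m (z + u *: delta_mx a 0))
    (fun k => (c *: S) k a) t) => // k.
  exact: is_derive_affine_coord.
- exact: norm1_continuous_affine.
- move=> a; apply: norm1_continuous_sum => k; apply: norm1_continuousZ.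
  exact: norm1_continuous_affine.
- exact: poly_bounded_affine.
- move=> a; apply: poly_bounded_sum => k; apply: poly_boundedZ.
  exact: poly_bounded_affine.
Qed.

Lemma gaussian_ibp_scalar (psi dpsi : R -> R) (t : 'I_d) (C : R) (k : nat) :
  (forall x : R, is_derive x 1 psi (dpsi x)) -> continuous psi -> continuous dpsi ->
  0 <= C -> (forall x, `|psi x| <= C * (1 + `|x|) ^+ k) ->
  (forall x, `|dpsi x| <= C * (1 + `|x|) ^+ k) ->
  \int[Q]_y (Z y t 0 * psi (Z y t 0)) = (S *m S) t t * \int[Q]_y dpsi (Z y t 0).
Proof.
move=> psiD cpsi cdpsi C0 psiC dpsiC.
have c1 : norm1_continuous (fun v : 'cV[R]_d => psi ((0 + S *m v) t 0)).
  apply: (norm1_continuous_affine (F := fun v => psi (v t 0)) S 0).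
  exact: norm1_continuous_coord.
have c2 : norm1_continuous (fun v : 'cV[R]_d => dpsi ((0 + S *m v) t 0)).
  apply: (norm1_continuous_affine (F := fun v => dpsi (v t 0)) S 0).
  exact: norm1_continuous_coord.
have b1 : poly_bounded (fun v : 'cV[R]_d => psi ((0 + S *m v) t 0)).
  apply: (poly_bounded_affine (F := fun v => psi (v t 0)) 0 S).
  exact: poly_bounded_coord psiC.
have b2 : poly_bounded (fun v : 'cV[R]_d => dpsi ((0 + S *m v) t 0)).
  apply: (poly_bounded_affine (F := fun v => dpsi (v t 0)) 0 S).
  exact: poly_bounded_coord dpsiC.
pose H (v : 'cV[R]_d) := psi ((0 + S *m v) t 0).
rewrite (_ : (fun y => _) = (fun y => Z y t 0 * H (V y))); last first.
  by apply/funext => y; rewrite /H add0r.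
pose dH (a : 'I_d) (v : 'cV[R]_d) := S t a * dpsi ((0 + S *m v) t 0).
transitivity (\sum_a S t a * \int[Q]_y dH a (V y)); last first.
  rewrite mxE mulr_suml; apply: eq_bigr => a _.
  rewrite rintegralZ; last exact: (integrable_gaussian_poly c2 b2).
  rewrite mulrA -[in S a t]symS mxE; congr (_ * _).
  by congr Rintegral; apply/funext => y; rewrite add0r.
apply: gaussian_ibp_image => //.
- move=> z a s.
  rewrite /dH mulrC.
  apply: (@is_derive1_comp R psi (fun u => (0 + S *m (z + u *: delta_mx a 0)) t 0)).
  exact: is_derive_affine_coord.
- by move=> a; exact: norm1_continuousZ.
- by move=> a; exact: poly_boundedZ.
Qed.

End gaussian_linear_image.

Lemma abs_powR_poly (R : realType) (q : R) : 0 <= q ->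
  exists k : nat, q <= k%:R /\ forall x : R, `|x| `^ q <= (1 + `|x|) ^+ k.
Proof.
move=> q0; exists (Num.bound q); have qk := ltW (archi_boundP q0); split=> // x.
rewrite -powR_mulrn ?addr_ge0//; apply: (@le_trans _ _ ((1 + `|x|) `^ q)).
  by apply: ge0_ler_powR; rewrite ?nnegrE ?addr_ge0// lerDr.
by apply: ler_powR => //; rewrite lerDl.
Qed.

Section gaussian_moments.
Context {R : realType} {d : nat} {disp : measure_display}
  {T : measurableType disp} (Q : probability T R) (Z0 : 'I_d -> {RV Q >-> R}).
Hypothesis hZ0 : standard_normal_vector Z0.
Variable S : 'M[R]_d.
Hypothesis symS : S^T = S.

Let Z y := S *m random_vector (fun j => Z0 j : T -> R) y.
Let var t : R := (S *m S) t t.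

Lemma integrable_gaussian_abs (t : 'I_d) (q : R) : 0 <= q ->
  integrable_real Q (fun y => `|Z y t 0| `^ q).
Proof.
move=> q0; have [k [_ qk]] := abs_powR_poly q0.
apply: (integrable_gaussian_image hZ0 S (F := fun v : 'cV[R]_d => `|v t 0| `^ q)).
  by apply: (norm1_continuous_coord (f := fun x => `|x| `^ q)); exact: continuous_abs_powR.
apply: (poly_bounded_coord (f := fun x => `|x| `^ q) t ler01 (k := k)) => x.
by rewrite mul1r ger0_norm ?powR_ge0.
Qed.

Lemma gaussian_mean (t : 'I_d) : \int[Q]_y Z y t 0 = 0.
Proof.
have : \int[Q]_y (Z y t 0 * cst 1 (Z y t 0)) = var t * \int[Q]_y cst 0 (Z y t 0).
  apply: (@gaussian_ibp_scalar _ _ _ _ _ _ hZ0 S symS (cst 1) (cst 0) t 1 0) => // x.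
  - exact: cvg_cst.
  - exact: cvg_cst.
  - by rewrite normr1 mulr1.
  - by rewrite normr0 mulr1.
rewrite /= rintegral0 mulr0 => <-.
by congr Rintegral; apply/funext => y; rewrite mulr1.
Qed.

Lemma gaussian_moment_step (t : 'I_d) (q : R) : 0 <= q ->
  \int[Q]_y `|Z y t 0| `^ (q + 2) = (q + 1) * var t * \int[Q]_y `|Z y t 0| `^ q.
Proof.
move=> q0; have [k [_ qk]] := abs_powR_poly q0.
have q1 : 1 <= q + 1 by rewrite lerDr.
have q10 : 0 <= q + 1 by exact: le_trans q1.
pose psi (x : R) := x * `|x| `^ q; pose dpsi (x : R) := (q + 1) * `|x| `^ q.
have : \int[Q]_y (Z y t 0 * psi (Z y t 0)) = var t * \int[Q]_y dpsi (Z y t 0).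
apply: (@gaussian_ibp_scalar _ _ _ _ _ _ hZ0 S symS psi dpsi t (q + 1) k.+1) => // x.
- exact: is_derive_signed_powR.
- apply: differentiable_continuous; apply/derivable1_diffP.
  by have [] := is_derive_signed_powR x q0.
- by apply: cvgM; [exact: cvg_cst|exact: continuous_abs_powR].
- rewrite /psi normrM (ger0_norm (powR_ge0 _ _)) exprS.
  rewrite -[leLHS]mul1r ler_pM ?mulr_ge0 ?powR_ge0// ler_pM ?powR_ge0//.
  by rewrite lerDr.
- rewrite /dpsi normrM ger0_norm// (ger0_norm (powR_ge0 _ _)) ler_wpM2l//.
  by rewrite (le_trans (qk x))// ler_weXn2l// lerDl.
rewrite /dpsi /psi rintegralZ; last exact: integrable_gaussian_abs.
rewrite mulrCA mulrA => <-; congr Rintegral; apply/funext => y.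
rewrite powRD; last by rewrite gt_eqF// ltr_wpDl.
by rewrite powR_mulrn// real_normK ?num_real// expr2 -/(Z y); ring.
Qed.

Lemma gaussian_second_moment (t : 'I_d) : \int[Q]_y (Z y t 0) ^+ 2 = var t.
Proof.
have := gaussian_moment_step t (lexx 0).
rewrite !add0r mul1r (_ : \int[Q]_y `|Z y t 0| `^ 0 = 1) ?mulr1 => [<-|].
  by congr Rintegral; apply/funext => y; rewrite powR_mulrn// real_normK ?num_real.
rewrite -[RHS](rintegral_cst Q 1); congr Rintegral.
by apply/funext => y; rewrite powRr0.
Qed.

Lemma odd_product_le (r : R) : 0 <= r ->
  (r + 1) * (r + 3) * (r + 5) * (r + 7) * (r + 9) <= (3 * 5 * 7 * 9) * 6 `^ r.
Proof.
move=> r0; rewrite (_ : (6 : R) `^ r = expR (r * ln 6)); last first.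
  by rewrite /powR gt_eqF.
pose s : R := 1 + 1 / 3 + 1 / 5 + 1 / 7 + 1 / 9.
have ln6 : s <= ln 6.
  by rewrite -ler_expR lnK ?posrE//; exact: expR_odd_inverses.
have c0 : 0 <= 3 * 5 * 7 * 9 :> R by rewrite !mulr_ge0.
apply: (@le_trans _ _ ((3 * 5 * 7 * 9) * expR (r * s))); last first.
  by apply: (ler_wpM2l c0); rewrite ler_expR; apply: ler_wpM2l.
have -> : r * s = r + r / 3 + r / 5 + r / 7 + r / 9 by rewrite /s; field.
rewrite !expRD.
have e (c : R) : 0 < c -> r + c <= c * expR (r / c).
  move=> cp; have := expR_ge1Dx (r / c).
  by rewrite -(ler_pM2l cp) mulrDr mulr1 mulrCA divff ?gt_eqF// mulr1 addrC.
have e1 : r + 1 <= expR r by rewrite addrC expR_ge1Dx.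
have e3 := e 3 ltac:(by []); have e5 := e 5 ltac:(by []).
have e7 := e 7 ltac:(by []); have e9 := e 9 ltac:(by []).
have -> : (3 * 5 * 7 * 9) * (expR r * expR (r / 3) * expR (r / 5) * expR (r / 7) * expR (r / 9)) =
  expR r * (3 * expR (r / 3)) * (5 * expR (r / 5)) * (7 * expR (r / 7)) * (9 * expR (r / 9)).
  by ring.
by rewrite !ler_pM ?mulr_ge0 ?addr_ge0 ?expR_ge0.
Qed.

Lemma gaussian_abs_moment_ge (t : 'I_d) (r : R) : 0 <= r <= 1 ->
  var t `^ (r / 2) <= 2 `^ r * \int[Q]_y `|Z y t 0| `^ r.
Proof.
move=> /andP[r0 r1].
pose m q := \int[Q]_y `|Z y t 0| `^ q.
have v0 : 0 <= var t.
  by rewrite -gaussian_second_moment; apply: Rintegral_ge0 => y _; exact: sqr_ge0.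
have m_ge0 q : 0 <= m q by apply: Rintegral_ge0 => y _; exact: powR_ge0.
have [->|rn0] := eqVneq r 0.
  rewrite mul0r !powRr0 mul1r (_ : (fun y => _) = (fun=> 1)) ?rintegral_cst//.
  by apply/funext => y; rewrite powRr0.
have rpos : 0 < r by rewrite lt_neqAle eq_sym rn0.
have [vE|vn0] := eqVneq (var t) 0.
  rewrite vE powR0; last by rewrite gt_eqF ?divr_gt0.
  by apply: mulr_ge0; [exact: powR_ge0|exact: m_ge0].
have vpos : 0 < var t by rewrite lt_neqAle eq_sym vn0.
set v := var t in v0 vn0 vpos *.
have st q : 0 <= q -> m (q + 2) = (q + 1) * v * m q by exact: gaussian_moment_step.
have m0 : m 0 = 1.
  by rewrite /m -[RHS](rintegral_cst Q 1); congr Rintegral; apply/funext => y; rewrite powRr0.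
have m8 : m 8 = (3 * 5 * 7) * v ^+ 4.
  have -> : (8 : R) = 0 + 2 + 2 + 2 + 2 by ring.
  rewrite !st ?m0 ?addr_ge0//; ring.
have m10 : m 10 = 9 * v * m 8.
  have -> : (10 : R) = 8 + 2 by ring.
  by rewrite st//; congr (_ * _ * _); ring.
have mr10 : m (10 + r) = (r + 1) * (r + 3) * (r + 5) * (r + 7) * (r + 9) * v ^+ 5 * m r.
  have -> : 10 + r = r + 2 + 2 + 2 + 2 + 2 by ring.
  rewrite !st ?addr_ge0//; ring.
have lower : (9 * v) `^ (1 + r / 2) * m 8 <= m (10 + r).
  pose a : R := 1 + r / 2.
  have v9 : 0 < 9 * v by rewrite mulr_gt0.
  have i8 : integrable_real Q (fun y => `|Z y t 0| `^ 8) by exact: integrable_gaussian_abs.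
  have i10 : integrable_real Q (fun y => `|Z y t 0| `^ 10) by exact: integrable_gaussian_abs.
  have ir : integrable_real Q (fun y => `|Z y t 0| `^ (10 + r)).
    by apply: integrable_gaussian_abs; rewrite addr_ge0.
  have -> : (9 * v) `^ (1 + r / 2) * m 8 =
      \int[Q]_y ((9 * v) `^ a * ((1 - a) * `|Z y t 0| `^ 8 + a / (9 * v) * `|Z y t 0| `^ 10)).
    rewrite rintegralZ; last by apply: integrable_realD; exact: integrable_realZ.
    rewrite rintegralD; [|exact: integrable_realZ..].
    rewrite !rintegralZ// -/(m 8) -/(m 10) m10; congr (_ * _).
    by field; rewrite vn0.
  apply: rintegral_le => //.
    by apply: integrable_realZ; apply: integrable_realD; exact: integrable_realZ.
  move=> y; set x := `|Z y t 0|; have x0 : 0 <= x by exact: normr_ge0.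
  have y0 : 0 <= x ^+ 2 / (9 * v) by rewrite divr_ge0 ?sqr_ge0// ltW.
  have a1 : 1 <= a by rewrite /a lerDl divr_ge0.
  have tg := powR_ge_tangent a1 y0.
  have x8 : 0 <= x ^+ 8 by rewrite exprn_ge0.
  have -> : x `^ (10 + r) = (9 * v) `^ a * (x ^+ 8 * (x ^+ 2 / (9 * v)) `^ a).
    rewrite mulrCA -powRM//; last exact: ltW.
    rewrite [X in X `^ a]mulrCA divff ?gt_eqF// mulr1.
    rewrite -(powR_mulrn 8)// -(powR_mulrn 2)// -powRrM -powRD; last first.
      by rewrite gt_eqF// ltr_wpDr ?mulr_ge0 ?addr_ge0 ?divr_ge0.
    by congr (_ `^ _); rewrite /a; field.
  rewrite ler_wpM2l ?powR_ge0//.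
  rewrite (powR_mulrn 10)// (powR_mulrn 8)//.
  apply: (le_trans _ (ler_wpM2l x8 tg)).
  rewrite le_eqVlt; apply/orP; left; apply/eqP.
  by field; rewrite vn0.
rewrite mr10 m8 in lower.
have v9 : 0 <= 9 * v by rewrite mulr_ge0.
have v9' : 0 < 9 * v by rewrite mulr_gt0.
rewrite powRD ?gt_eqF ?ltr_pwDl ?divr_ge0// in lower.
rewrite powRr1// powRM// in lower.
have n3 : (9 : R) `^ (r / 2) = 3 `^ r.
  have -> : (9 : R) = 3 `^ 2 by rewrite powR_mulrn// expr2; ring.
  by rewrite -powRrM; congr (_ `^ _); field.
rewrite n3 in lower.
have prod := odd_product_le r0.
have v5 : 0 < v ^+ 5 by rewrite exprn_gt0.
have n6 : (6 : R) `^ r = 3 `^ r * 2 `^ r.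
  by rewrite -powRM//; congr (_ `^ _); ring.
have p3 : 0 < (3 : R) `^ r by rewrite powR_gt0.
rewrite n6 in prod.
have c0 : 0 < 3 * 5 * 7 * 9 :> R by rewrite !mulr_gt0.
rewrite -(ler_pM2l (mulr_gt0 (mulr_gt0 c0 v5) p3)).
rewrite [leLHS](_ : _ = 9 * v * (3 `^ r * v `^ (r / 2)) * (3 * 5 * 7 * v ^+ 4)); last by ring.
rewrite (le_trans lower)// -/(m r).
rewrite [leRHS](_ : _ = ((3 * 5 * 7 * 9) * (3 `^ r * 2 `^ r)) * v ^+ 5 * m r); last by ring.
by rewrite ler_wpM2r// ler_wpM2r// ltW.
Qed.

End gaussian_moments.

Section smooth4.
Context {R : realType} {d : nat}.
Variables (f : 'cV[R]_d -> R) (C q : R).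
Hypothesis C0 : 0 <= C.
Hypothesis q0 : 0 <= q.

Definition smooth4 :=
  (forall (s : seq 'I_d) i w, (size s < 4)%N ->
     derivable (partial s f) w (delta_mx i 0)) /\
  (forall (s : seq 'I_d) w, (0 < size s <= 4)%N ->
     `|partial s f w| <= C * (1 + norm1 w) `^ q).

Hypothesis fS : smooth4.

Lemma smooth4_derivable s : (size s < 4)%N -> coord_derivable (partial s f).
Proof. by move=> s4 i w; apply: fS.1. Qed.

Lemma smooth4_locally_bounded (s : seq 'I_d) : (0 < size s <= 4)%N ->
  locally_bounded (partial s f).
Proof.
move=> s4 r; exists (C * (1 + `|r|) `^ q) => w wr.
rewrite (le_trans (fS.2 _ _ s4))// ler_wpM2l//.
have w0 := norm1_ge0 w.
apply: ge0_ler_powR; rewrite ?nnegrE ?addr_ge0// lerD2l.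
by rewrite (le_trans wr)// ler_norm.
Qed.

Lemma smooth4_continuous (s : seq 'I_d) : (size s < 4)%N ->
  norm1_continuous (partial s f).
Proof.
move=> s4; apply: norm1_continuous_lipschitz; first exact: smooth4_derivable.
by move=> i; apply: (@smooth4_locally_bounded (i :: s)).
Qed.

Lemma smooth4_poly_bounded (s : seq 'I_d) : (0 < size s <= 4)%N ->
  poly_bounded (partial s f).
Proof.
move=> s4; exists C, (Num.bound q); split => // w.
rewrite (le_trans (fS.2 _ _ s4))// ler_wpM2l//.
have w0 := norm1_ge0 w.
rewrite -powR_mulrn ?addr_ge0// ler_powR ?lerDl//.
exact: ltW (archi_boundP q0).
Qed.

Lemma smooth4_growth w : `|f w| <= `|f 0| + C * (1 + norm1 w) `^ (q + 1).
Proof.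
have w0 := norm1_ge0 w.
have := @lipschitz_box R d f 0 w (C * (1 + norm1 w) `^ q) (smooth4_derivable (s := [::]) isT).
rewrite add0r => /(_ _)/wrap[i x bx|H].
  rewrite (le_trans (fS.2 [:: i] _ isT))// ler_wpM2l//.
  apply: ge0_ler_powR; rewrite ?nnegrE ?addr_ge0 ?norm1_ge0// lerD2l.
  apply: le_trans (norm1_in_box bx) _.
  by rewrite {1}/norm1 big1 ?add0r// => j _; rewrite mxE normr0.
rewrite -[f w](subrK (f 0)) addrC (le_trans (ler_normD _ _))// lerD2l.
apply: le_trans H _; rewrite powRD; last by rewrite gt_eqF// ltr_wpDl.
rewrite powRr1 ?addr_ge0// -mulrA ler_wpM2l// ler_wpM2l ?powR_ge0//.
by rewrite lerDr.
Qed.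

End smooth4.

Section one_summand.
Context {R : realType} {d : nat} {disp : measure_display}
  {T : measurableType disp} (P : probability T R).
Variables (f : 'cV[R]_d -> R) (C q : R).
Hypotheses (C0 : 0 <= C) (q0 : 0 <= q) (fS : smooth4 f C q).
Variables (Y V : T -> 'cV[R]_d) (M : T -> R) (rho : 'I_d -> 'I_d -> R) (s : R).
Hypothesis s0 : 0 <= s.
Hypothesis MB : forall x u (js : seq 'I_d), size js = 4 ->
  in_box (V x) (s *: Y x) u -> `|partial js f u| <= M x.
Let N x := norm1 (Y x).
Hypothesis iM : forall k, (k <= 4)%N -> integrable_real P (fun x => N x ^+ k * M x).
Hypothesis mY : forall j, measurable_fun setT (fun x => Y x j 0).
Hypothesis mV : forall j, measurable_fun setT (fun x => V x j 0).
Hypothesis iYF : forall j, integrable_real P (fun x => Y x j 0 * partial [:: j] f (V x + s *: Y x)).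
Hypothesis iF : forall j k, integrable_real P (fun x => partial [:: k; j] f (V x + s *: Y x)).
Hypothesis iF0 : forall j k, integrable_real P (fun x => partial [:: k; j] f (V x)).
Hypothesis E1 : forall j, integrable_real P (fun x => Y x j 0 * partial [:: j] f (V x)) /\
  \int[P]_x (Y x j 0 * partial [:: j] f (V x)) = 0.
Hypothesis E2 : forall j k, integrable_real P (fun x => Y x j 0 * Y x k 0 * partial [:: k; j] f (V x)) /\
  \int[P]_x (Y x j 0 * Y x k 0 * partial [:: k; j] f (V x)) =
  rho j k * \int[P]_x partial [:: k; j] f (V x).
Hypothesis E3 : forall j k l, integrable_real P (fun x => Y x j 0 * Y x k 0 * Y x l 0 * partial [:: l; k; j] f (V x)) /\
  \int[P]_x (Y x j 0 * Y x k 0 * Y x l 0 * partial [:: l; k; j] f (V x)) = 0.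
Hypothesis E1' : forall j k l, integrable_real P (fun x => Y x l 0 * partial [:: l; k; j] f (V x)) /\
  \int[P]_x (Y x l 0 * partial [:: l; k; j] f (V x)) = 0.

Let absYN_le j k x : (k < 4)%N -> `| `|Y x j 0| * (N x ^+ k * M x)| <= N x ^+ k.+1 * M x.
Proof.
move=> k4; have M0 : 0 <= M x.
  apply: le_trans (@MB x (V x) [:: j; j; j; j] erefl _); first exact: normr_ge0.
  by move=> i; exists 0; rewrite ?lexx ?ler01// mul0r addr0.
have N0 : 0 <= N x by exact: norm1_ge0.
rewrite ger0_norm; last by rewrite mulr_ge0// mulr_ge0// exprn_ge0.
by rewrite exprS -[leRHS]mulrA ler_wpM2r ?mulr_ge0 ?exprn_ge0// le_norm1.
Qed.

Let mN : measurable_fun setT N.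
Proof. by apply: measurable_sum => j; exact: measurableT_comp. Qed.

Let mM : measurable_fun setT M.
Proof.
have := integrable_real_measurable (iM (k := 0) isT).
by congr measurable_fun; apply/funext => x; rewrite expr0 mul1r.
Qed.

Lemma first_order_remainder j :
  `|\int[P]_x (Y x j 0 * partial [:: j] f (V x + s *: Y x)) -
    s * \sum_k rho j k * \int[P]_x partial [:: k; j] f (V x)| <=
  s ^+ 3 / 6 * \int[P]_x (`|Y x j 0| * (N x ^+ 3 * M x)).
Proof.
pose T1 x := \sum_k Y x j 0 * Y x k 0 * partial [:: k; j] f (V x).
pose T2 x := \sum_k \sum_l Y x j 0 * Y x k 0 * Y x l 0 * partial [:: l; k; j] f (V x).
have iT1 : integrable_real P T1 by apply: integrable_real_sum => k; exact: (E2 j k).1.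
have iT2 : integrable_real P T2.
  by apply: integrable_real_sum => k; apply: integrable_real_sum => l; exact: (E3 j k l).1.
have T1E : \int[P]_x T1 x = \sum_k rho j k * \int[P]_x partial [:: k; j] f (V x).
  rewrite rintegral_sum; last by move=> k; exact: (E2 j k).1.
  by apply: eq_bigr => k _; exact: (E2 j k).2.
have T2E : \int[P]_x T2 x = 0.
  rewrite rintegral_sum; last first.
    by move=> k; apply: integrable_real_sum => l; exact: (E3 j k l).1.
  rewrite big1// => k _; rewrite rintegral_sum; last by move=> l; exact: (E3 j k l).1.
  by rewrite big1// => l _; exact: (E3 j k l).2.
have -> : \int[P]_x (Y x j 0 * partial [:: j] f (V x + s *: Y x)) -
    s * \sum_k rho j k * \int[P]_x partial [:: k; j] f (V x) =
  \int[P]_x (Y x j 0 * partial [:: j] f (V x + s *: Y x) -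
    Y x j 0 * partial [:: j] f (V x) - s * T1 x - s ^+ 2 / 2 * T2 x).
  rewrite !rintegralB ?rintegralZ//; last first.
  all: repeat (apply: integrable_realB || apply: integrable_realZ) => //.
  all: try exact: (E1 j).1.
  by rewrite (E1 j).2 T1E T2E; ring.
have iR : integrable_real P (fun x => `|Y x j 0| * (N x ^+ 3 * M x)).
  apply: (@integrable_real_le _ _ _ _ _ (fun x => N x ^+ 4 * M x)).
  - apply: measurable_funM; first exact: measurableT_comp.
    by apply: measurable_funM => //; exact: measurable_funX.
  - exact: iM.
  - by move=> x; exact: absYN_le.
rewrite -rintegralZ//; apply: rintegral_norm_le.
- repeat (apply: integrable_realB || apply: integrable_realZ) => //.
  exact: (E1 j).1.
- exact: integrable_realZ.
move=> x.
have -> : Y x j 0 * partial [:: j] f (V x + s *: Y x) -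
    Y x j 0 * partial [:: j] f (V x) - s * T1 x - s ^+ 2 / 2 * T2 x =
  Y x j 0 * (partial [:: j] f (V x + s *: Y x) - partial [:: j] f (V x) -
    \sum_k (s *: Y x) k 0 * pderiv k (partial [:: j] f) (V x) -
    (\sum_k (s *: Y x) k 0 * \sum_l (s *: Y x) l 0 *
       pderiv l (pderiv k (partial [:: j] f)) (V x)) / 2).
  have -> : T1 x = Y x j 0 * \sum_k Y x k 0 * partial [:: k; j] f (V x).
    by rewrite mulr_sumr; apply: eq_bigr => k _; rewrite mulrA.
  have -> : T2 x = Y x j 0 * \sum_k Y x k 0 * \sum_l Y x l 0 * partial [:: l; k; j] f (V x).
    rewrite mulr_sumr; apply: eq_bigr => k _; rewrite !mulr_sumr.
    by apply: eq_bigr => l _; rewrite !mulrA.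
  have -> : \sum_k (s *: Y x) k 0 * pderiv k (partial [:: j] f) (V x) =
      s * \sum_k Y x k 0 * partial [:: k; j] f (V x).
    by rewrite mulr_sumr; apply: eq_bigr => k _; rewrite mxE mulrA.
  have -> : \sum_k (s *: Y x) k 0 * \sum_l (s *: Y x) l 0 *
       pderiv l (pderiv k (partial [:: j] f)) (V x) =
      s ^+ 2 * \sum_k Y x k 0 * \sum_l Y x l 0 * partial [:: l; k; j] f (V x).
    rewrite mulr_sumr; apply: eq_bigr => k _; rewrite mxE.
    rewrite (_ : \sum_l (s *: Y x) l 0 * _ = s * \sum_l Y x l 0 * partial [:: l; k; j] f (V x)).
      by ring.
    by rewrite mulr_sumr; apply: eq_bigr => l _; rewrite mxE mulrA.
  by ring.
have := @taylor3_box R d (partial [:: j] f) (V x) (s *: Y x) (M x).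
move=> /(_ _ _ _ _ _)/wrap[||||i k l u|H].
- exact: smooth4_derivable fS _ _.
- by move=> i; exact: (smooth4_derivable fS (s := [:: i; j])).
- by move=> i k; exact: (smooth4_derivable fS (s := [:: k; i; j])).
- by move=> i k; exact: (smooth4_locally_bounded C0 q0 fS (s := [:: k; i; j])).
- exact: (MB (js := [:: l; k; i; j])).
rewrite normrM (le_trans (ler_wpM2l (normr_ge0 _) H))//.
rewrite norm1Z (ger0_norm s0) -/(N x) le_eqVlt; apply/orP; left; apply/eqP; ring.
Qed.

Lemma second_order_remainder j k :
  `|\int[P]_x partial [:: k; j] f (V x + s *: Y x) -
    \int[P]_x partial [:: k; j] f (V x)| <=
  s ^+ 2 / 2 * \int[P]_x (N x ^+ 2 * M x).
Proof.
pose T1 x := \sum_l Y x l 0 * partial [:: l; k; j] f (V x).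
have iT1 : integrable_real P T1 by apply: integrable_real_sum => l; exact: (E1' j k l).1.
have T1E : \int[P]_x T1 x = 0.
  rewrite rintegral_sum; last by move=> l; exact: (E1' j k l).1.
  by rewrite big1// => l _; exact: (E1' j k l).2.
have -> : \int[P]_x partial [:: k; j] f (V x + s *: Y x) -
    \int[P]_x partial [:: k; j] f (V x) =
  \int[P]_x (partial [:: k; j] f (V x + s *: Y x) - partial [:: k; j] f (V x) - s * T1 x).
  rewrite !rintegralB ?rintegralZ//; last first.
  all: repeat (apply: integrable_realB || apply: integrable_realZ) => //.
  by rewrite T1E mulr0 subr0.
rewrite -rintegralZ; last exact: iM.
apply: rintegral_norm_le.
- by repeat (apply: integrable_realB || apply: integrable_realZ).
- by apply: integrable_realZ; exact: iM.
move=> x.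
have -> : s * T1 x = \sum_l (s *: Y x) l 0 * pderiv l (partial [:: k; j] f) (V x).
  by rewrite mulr_sumr; apply: eq_bigr => l _; rewrite mxE mulrA.
have := @taylor2_box R d (partial [:: k; j] f) (V x) (s *: Y x) (M x).
move=> /(_ _ _ _)/wrap[||i l u|H].
- exact: (smooth4_derivable fS (s := [:: k; j])).
- by move=> i; exact: (smooth4_derivable fS (s := [:: i; k; j])).
- exact: (MB (js := [:: l; i; k; j])).
apply: le_trans H _.
rewrite norm1Z (ger0_norm s0) -/(N x) le_eqVlt; apply/orP; left; apply/eqP; ring.
Qed.

Lemma one_summand_bound :
  `|\sum_j \int[P]_x (Y x j 0 * partial [:: j] f (V x + s *: Y x)) -
    s * \sum_j \sum_k rho j k * \int[P]_x partial [:: k; j] f (V x + s *: Y x)| <=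
  s ^+ 3 * (6^-1 * \int[P]_x (N x ^+ 4 * M x) +
            2^-1 * (\sum_j \sum_k `|rho j k|) * \int[P]_x (N x ^+ 2 * M x)).
Proof.
have iR j : integrable_real P (fun x => `|Y x j 0| * (N x ^+ 3 * M x)).
  apply: (@integrable_real_le _ _ _ _ _ (fun x => N x ^+ 4 * M x)).
  - apply: measurable_funM; first exact: measurableT_comp.
    by apply: measurable_funM => //; exact: measurable_funX.
  - exact: iM.
  - by move=> x; exact: absYN_le.
have -> : \sum_j \int[P]_x (Y x j 0 * partial [:: j] f (V x + s *: Y x)) -
    s * \sum_j \sum_k rho j k * \int[P]_x partial [:: k; j] f (V x + s *: Y x) =
  \sum_j (\int[P]_x (Y x j 0 * partial [:: j] f (V x + s *: Y x)) -
    s * \sum_k rho j k * \int[P]_x partial [:: k; j] f (V x)) -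
  s * \sum_j \sum_k rho j k * (\int[P]_x partial [:: k; j] f (V x + s *: Y x) -
      \int[P]_x partial [:: k; j] f (V x)).
  rewrite sumrB -mulr_sumr.
  under [X in _ = _ - s * X]eq_bigr => j _.
    under eq_bigr => k _ do rewrite mulrBr.
    rewrite sumrB.
    over.
  by rewrite sumrB mulrBr opprB addrA subrK.
rewrite (le_trans (ler_normB _ _))// mulrDr lerD//.
  rewrite (le_trans (ler_norm_sum _ _ _))//.
  apply: (le_trans (ler_sum _ (fun j _ => first_order_remainder j))).
  rewrite -mulr_sumr -rintegral_sum// -mulrA le_eqVlt; apply/orP; left; apply/eqP.
  congr (_ * (_ * _)); congr Rintegral; apply/funext => x.
  by rewrite -mulr_suml -/(norm1 (Y x)) -/(N x); ring.
rewrite normrM ger0_norm//.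
have -> : s ^+ 3 * (2^-1 * (\sum_j \sum_k `|rho j k|) * \int[P]_x (N x ^+ 2 * M x)) =
  s * \sum_j \sum_k `|rho j k| * (s ^+ 2 / 2 * \int[P]_x (N x ^+ 2 * M x)).
  under [X in _ = s * X]eq_bigr => j _ do rewrite -mulr_suml.
  by rewrite -mulr_suml; ring.
rewrite ler_wpM2l// (le_trans (ler_norm_sum _ _ _))// ler_sum// => j _.
rewrite (le_trans (ler_norm_sum _ _ _))// ler_sum// => k _.
by rewrite normrM ler_wpM2l// second_order_remainder.
Qed.

End one_summand.

Lemma powR_add_le (R : realType) (r a b : R) : 0 <= r -> 0 <= a -> 0 <= b ->
  (a + b) `^ r <= 2 `^ r * (a `^ r + b `^ r).
Proof.
move=> r0 a0 b0; wlog ab : a b a0 b0 / a <= b => [H|].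
  by case/orP: (le_total a b) => ab; [|rewrite addrC [X in _ * X]addrC]; apply: H.
apply: (@le_trans _ _ ((2 * b) `^ r)).
  by apply: ge0_ler_powR; rewrite ?nnegrE ?addr_ge0 ?mulr_ge0//; lra.
by rewrite powRM// ler_wpM2l ?powR_ge0// lerDr powR_ge0.
Qed.

Lemma powR_add_subadditive (R : realType) (r a b : R) : 0 <= r <= 1 -> 0 <= a -> 0 <= b ->
  (a + b) `^ r <= a `^ r + b `^ r.
Proof.
move=> /andP[r0 r1] a0 b0; have [ab0|ab0] := eqVneq (a + b) 0.
  have -> : a = 0 by apply/eqP; move/eqP: ab0; rewrite paddr_eq0// => /andP[].
  have -> : b = 0 by apply/eqP; move/eqP: ab0; rewrite paddr_eq0// => /andP[].
  by rewrite addr0 lerDl powR_ge0.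
have abp : 0 < a + b by rewrite lt_neqAle eq_sym ab0 addr_ge0.
have H x : 0 <= x -> x <= a + b -> x / (a + b) * (a + b) `^ r <= x `^ r.
  move=> x0 xab; rewrite -{2}[x](divfK ab0) powRM; [|by rewrite divr_ge0// ltW|exact: ltW].
  rewrite ler_wpM2r ?powR_ge0//.
  have [->|xn0] := eqVneq x 0; first by rewrite mul0r powR_ge0.
  have y0 : 0 < x / (a + b) by rewrite divr_gt0// lt_neqAle eq_sym xn0.
  have y1 : x / (a + b) <= 1 by rewrite ler_pdivrMr// mul1r.
  rewrite -[leLHS]powRr1; last exact: ltW.
  by rewrite ger_powR// y0.
have -> : (a + b) `^ r = a / (a + b) * (a + b) `^ r + b / (a + b) * (a + b) `^ r.
  by rewrite -mulrDl -mulrDl divff// mul1r.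
by rewrite lerD// H// ?lerDl ?lerDr.
Qed.

Definition split_power (R : realType) (r s z w : R) : R :=
  if r < 1 then `|s * w + z| `^ r else 4 `^ r * `|w| `^ r + 2 `^ r * `|z| `^ r.

Lemma split_power_ge0 (R : realType) (r s z w : R) : 0 <= split_power r s z w.
Proof.
by rewrite /split_power; case: ifP => _; rewrite ?addr_ge0 ?mulr_ge0 ?powR_ge0.
Qed.

Lemma split_power_le (R : realType) (r s z w y u : R) :
  0 <= r -> 0 <= s <= 1 -> 0 <= u <= 1 ->
  `|s * w + z + u * (s * y)| `^ r <= split_power r s z w + 4 `^ r * `|y| `^ r.
Proof.
move=> r0 /andP[s0 s1] /andP[u0 u1].
have usy : `|u * (s * y)| <= `|y|.
  by rewrite mulrA normrM ler_piMl// ger0_norm ?mulr_ge0//; nra.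
have mono (a b : R) : 0 <= a -> a <= b -> a `^ r <= b `^ r.
  by move=> a0 ab; apply: ge0_ler_powR; rewrite ?nnegrE// (le_trans a0).
rewrite /split_power; case: ltP => r1.
  apply: (le_trans (mono _ _ (normr_ge0 _) (ler_normD _ _))).
  apply: (le_trans (powR_add_subadditive _ (normr_ge0 _) (normr_ge0 _))).
    by rewrite r0 ltW.
  rewrite lerD2l (le_trans (mono _ _ (normr_ge0 _) usy))// ler_peMl ?powR_ge0//.
  by rewrite -[leLHS](powRr0 4); apply: ler_powR => //; lra.
have sw : `|s * w| <= `|w| by rewrite normrM ler_piMl// ger0_norm.
have -> : (4 : R) `^ r = 2 `^ r * 2 `^ r by rewrite -powRM//; congr (_ `^ _); lra.
apply: (@le_trans _ _ ((`|w| + `|y| + `|z|) `^ r)).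
  apply: mono => //; rewrite (le_trans (ler_normD _ _))// addrAC lerD//.
  by rewrite (le_trans (ler_normD _ _))// lerD.
apply: (le_trans (powR_add_le r0 _ _)); rewrite ?addr_ge0//.
have := powR_add_le r0 (normr_ge0 w) (normr_ge0 y).
have p2 : 0 <= (2 : R) `^ r by rewrite powR_ge0.
move=> /(ler_wpM2l p2); lra.
Qed.

Lemma split_power_upper (R : realType) (r s z w : R) : 0 <= r -> 0 <= s <= 1 ->
  split_power r s z w <= 4 `^ r * `|w| `^ r + 2 `^ r * `|z| `^ r.
Proof.
move=> r0 /andP[s0 s1]; rewrite /split_power; case: ltP => // r1.
have sw : `|s * w| <= `|w| by rewrite normrM ler_piMl// ger0_norm.
apply: (@le_trans _ _ ((`|w| + `|z|) `^ r)).
  apply: ge0_ler_powR; rewrite ?nnegrE ?addr_ge0//.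
  by rewrite (le_trans (ler_normD _ _))// lerD.
rewrite (le_trans (powR_add_le r0 _ _))// mulrDr lerD2r ler_wpM2r ?powR_ge0//.
by apply: ge0_ler_powR; rewrite ?nnegrE//; lra.
Qed.

Lemma measurable_abs_powR {disp : measure_display} {T : measurableType disp} {R : realType}
  (f : T -> R) (r : R) : measurable_fun setT f ->
  measurable_fun setT (fun x => `|f x| `^ r).
Proof.
move=> mf; apply: (measurableT_comp (measurable_powR r)).
exact: measurableT_comp.
Qed.

Lemma measurable_split_power {disp : measure_display} {T : measurableType disp} {R : realType}
  (f g : T -> R) (r s : R) : measurable_fun setT f -> measurable_fun setT g ->
  measurable_fun setT (fun x => split_power r s (g x) (f x)).
Proof.
move=> mf mg; rewrite /split_power; case: (r < 1).
  by apply: measurable_abs_powR; apply: measurable_funD => //; exact: measurable_funM.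
by apply: measurable_funD; apply: measurable_funM => //; exact: measurable_abs_powR.
Qed.

Lemma abs_powR_tangent (R : realType) (r w y : R) : 1 <= r ->
  `|w| `^ r + r * (w * `|w| `^ (r - 2)) * y <= `|w + y| `^ r.
Proof.
move=> r1; have r0 : 0 < r by lra.
have [->|w0] := eqVneq w 0.
  by rewrite normr0 powR0 ?gt_eqF// mul0r mulr0 mul0r addr0 powR_ge0.
have a0 : 0 < `|w| by rewrite normr_gt0.
have tg := @powR_ge_tangent R r (`|w + y| / `|w|) r1 ltac:(by rewrite divr_ge0).
have -> : `|w + y| `^ r = `|w| `^ r * (`|w + y| / `|w|) `^ r.
  by rewrite -powRM ?divr_ge0// mulrC divfK ?gt_eqF.
apply: (le_trans _ (ler_wpM2l (powR_ge0 _ _) tg)).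
have -> : `|w| `^ r = `|w| `^ (r - 2) * (w * w).
  rewrite -{1}[r](subrK 2) [LHS]powRD; last by rewrite (gt_eqF a0) implybT.
  by rewrite (powR_mulrn 2)// -expr2 real_normK ?num_real.
have p0 : 0 <= `|w| `^ (r - 2) by rewrite powR_ge0.
have key : w * y <= w * w * (`|w + y| / `|w| - 1).
  have ww : w * w = `|w| * `|w| by rewrite -normrM ger0_norm// -expr2 sqr_ge0.
  rewrite mulrBr mulr1 {1}ww mulrACA divff ?gt_eqF// mulr1 lerBrDr -mulrDr addrC.
  by rewrite -normrM ler_norm.
have := ler_wpM2l (mulr_ge0 (ltW r0) p0) key.
nra.
Qed.

Section dominated_fubini.
Context {R : realType} {d1 d2 : measure_display} {T1 : measurableType d1} {T2 : measurableType d2}.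
Variables (P : probability T1 R) (Q : probability T2 R).
Variables (f : T1 * T2 -> R) (a : T1 -> R) (b : T2 -> R).
Hypothesis mf : measurable_fun setT f.
Hypotheses (ia : integrable_real P a) (ib : integrable_real Q b).
Hypotheses (a0 : forall x, 0 <= a x) (b0 : forall y, 0 <= b y).
Hypothesis fab : forall x y, `|f (x, y)| <= a x * b y.

Lemma dominated_section1 x : integrable_real Q (fun y => f (x, y)).
Proof.
apply: (integrable_real_le _ (integrable_realZ (a x) ib)) => //.
exact: (measurableT_comp mf (measurable_pair1 x)).
Qed.

Lemma dominated_section2 y : integrable_real P (fun x => f (x, y)).
Proof.
apply: (integrable_real_le _ (integrable_realZ (b y) ia)); last by move=> x; rewrite mulrC.
exact: (measurableT_comp mf (measurable_pair2 y)).
Qed.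

Lemma dominated_integrable : integrable_real (P \x Q)%E f.
Proof. exact: (integrable_prod_le mf ia ib). Qed.

Lemma dominated_fubini12 : \int[(P \x Q)%E]_z f z = \int[P]_x \int[Q]_y f (x, y).
Proof. exact: (rintegral_prod12 dominated_integrable dominated_section1). Qed.

Lemma dominated_fubini21 : \int[(P \x Q)%E]_z f z = \int[Q]_y \int[P]_x f (x, y).
Proof. exact: (rintegral_prod21 dominated_integrable dominated_section2). Qed.

Lemma dominated_partial1 : integrable_real P (fun x => \int[Q]_y f (x, y)).
Proof. exact: (integrable_prod_fst dominated_integrable dominated_section1). Qed.

Lemma dominated_partial2 : integrable_real Q (fun y => \int[P]_x f (x, y)).
Proof. exact: (integrable_prod_snd mf ia ib). Qed.

End dominated_fubini.

Section interpolation.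
Context {R : realType} {d : nat} {d1 d2 : measure_display} {T : measurableType d1}
  {T' : measurableType d2} (P : probability T R) (Q : probability T' R).
Variables (Z0 : 'I_d -> {RV Q >-> R}) (S : 'M[R]_d) (W : T -> 'cV[R]_d).
Variables (f : 'cV[R]_d -> R) (C q : R).
Hypothesis hZ0 : standard_normal_vector Z0.
Hypothesis symS : S^T = S.
Hypotheses (C0 : 0 <= C) (q0 : 0 <= q) (fS : smooth4 f C q).
Hypothesis mW : forall j, measurable_fun setT (fun x => W x j 0).
Hypothesis iW : integrable_real P (fun x => (1 + norm1 (W x)) `^ (q + 1)).

Let Z y := S *m random_vector (fun j => Z0 j : T' -> R) y.
Let a x := (1 + norm1 (W x)) `^ (q + 1).
Let b y := (1 + norm1 (Z y)) `^ (q + 1).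
Let U (t : R) (w : T * T') := sin t *: W w.1 + cos t *: Z w.2.

Let mZ j : measurable_fun setT (fun y => Z y j 0).
Proof.
apply: (measurable_gaussian_image Z0 S (F := fun v => v j 0)).
by apply: (norm1_continuous_coord (f := id)) => x; exact: cvg_id.
Qed.

Let a0 x : 0 <= a x. Proof. exact: powR_ge0. Qed.
Let b0 y : 0 <= b y. Proof. exact: powR_ge0. Qed.

Let ib : integrable_real Q b.
Proof.
pose k := Num.bound (q + 1).
have mb : measurable_fun setT b.
  apply: (measurableT_comp (measurable_powR _)); apply: measurable_funD => //.
  by apply: measurable_sum => j; apply: measurableT_comp.
apply: (integrable_gaussian hZ0 (C := (1 + mx_norm1 S) ^+ k) (k := k) mb) => y.
have z0 := norm1_ge0 (Z y); have S0 := mx_norm1_ge0 S.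
have v0 := norm1_ge0 (random_vector (fun j => Z0 j : T' -> R) y).
rewrite ger0_norm// -exprMn -powR_mulrn; last by rewrite mulr_ge0 ?addr_ge0.
apply: (@le_trans _ _ ((1 + norm1 (Z y)) `^ k%:R)).
  rewrite /b ler_powR ?lerDl//.
  by apply: ltW; apply: archi_boundP; rewrite addr_ge0.
have h : 1 + norm1 (Z y) <=
    (1 + mx_norm1 S) * (1 + norm1 (random_vector (fun j => Z0 j : T' -> R) y)).
  have := norm1_mulmx S (random_vector (fun j => Z0 j : T' -> R) y); rewrite -/(Z y).
  by move: S0 v0; set u := mx_norm1 S; set v := norm1 (random_vector _ _); nra.
have z1 : 0 <= 1 + norm1 (Z y) by rewrite addr_ge0.
by apply: ge0_ler_powR; rewrite // nnegrE (le_trans z1).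
Qed.

Let mU t j : measurable_fun setT (fun w => U t w j 0).
Proof.
rewrite (_ : (fun w => _) = (fun w : T * T' => sin t * W w.1 j 0 + cos t * Z w.2 j 0)); last first.
  by apply/funext => w; rewrite !mxE.
apply: measurable_funD; apply: measurable_funM => //.
  exact: (measurableT_comp (mW j) measurable_fst).
exact: (measurableT_comp (mZ j) measurable_snd).
Qed.

Let mF t (js : seq 'I_d) : (size js < 4)%N ->
  measurable_fun setT (fun w => partial js f (U t w)).
Proof.
by move=> js4; apply: measurable_norm1_continuous => //; exact: (smooth4_continuous C0 q0 fS).
Qed.

Let ew x : 1 <= 1 + norm1 (W x). Proof. by rewrite lerDl norm1_ge0. Qed.
Let ez y : 1 <= 1 + norm1 (Z y). Proof. by rewrite lerDl norm1_ge0. Qed.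
Let ew0 x : 0 <= 1 + norm1 (W x). Proof. exact: le_trans (ew x). Qed.
Let ez0 y : 0 <= 1 + norm1 (Z y). Proof. exact: le_trans (ez y). Qed.

Let norm1U t x y : 1 + norm1 (U t (x, y)) <= (1 + norm1 (W x)) * (1 + norm1 (Z y)).
Proof.
have h : norm1 (U t (x, y)) <= norm1 (W x) + norm1 (Z y).
  rewrite (le_trans (norm1D _ _))// !norm1Z lerD// ler_piMl ?norm1_ge0//.
    by rewrite ler_norml sin_geN1 sin_le1.
  by rewrite ler_norml cos_geN1 cos_le1.
have := norm1_ge0 (W x); have := norm1_ge0 (Z y); nra.
Qed.

Let partial_le t (js : seq 'I_d) x y : (0 < size js <= 4)%N ->
  `|partial js f (U t (x, y))| <= C * ((1 + norm1 (W x)) `^ q * (1 + norm1 (Z y)) `^ q).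
Proof.
move=> js4; rewrite (le_trans (fS.2 _ _ js4))// ler_wpM2l// -powRM//.
by apply: ge0_ler_powR; rewrite ?nnegrE ?mulr_ge0// addr_ge0// norm1_ge0.
Qed.

Let aE x : a x = (1 + norm1 (W x)) * (1 + norm1 (W x)) `^ q.
Proof.
by rewrite /a powRD ?(gt_eqF (lt_le_trans ltr01 (ew x))) ?implybT// powRr1// mulrC.
Qed.

Let bE y : b y = (1 + norm1 (Z y)) * (1 + norm1 (Z y)) `^ q.
Proof.
by rewrite /b powRD ?(gt_eqF (lt_le_trans ltr01 (ez y))) ?implybT// powRr1// mulrC.
Qed.

(* every integrand below is a factor at most [(1 + |W|)(1 + |Z|)] times a
   partial derivative *)
Let dom (t : R) (u : T * T' -> R) (js : seq 'I_d) x y : (0 < size js <= 4)%N ->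
  `|u (x, y)| <= (1 + norm1 (W x)) * (1 + norm1 (Z y)) ->
  `|u (x, y) * partial js f (U t (x, y))| <= a x * (C * b y).
Proof.
move=> js4 ule; rewrite normrM.
apply: (le_trans (ler_pM (normr_ge0 _) (normr_ge0 _) ule (partial_le t x y js4))).
by rewrite aE bE le_eqVlt; apply/orP; left; apply/eqP; ring.
Qed.

Let Cb0 y : 0 <= C * b y. Proof. exact: mulr_ge0. Qed.
Let iCb : integrable_real Q (fun y => C * b y). Proof. exact: integrable_realZ. Qed.

Let f_le t x y : `|f (U t (x, y))| <= a x * ((`|f 0| + C) * b y).
Proof.
have ab1 : 1 <= a x * b y.
  apply: mulr_ege1.
    by rewrite /a -[leLHS](powRr0 (1 + norm1 (W x))) ler_powR// addr_ge0.
  by rewrite /b -[leLHS](powRr0 (1 + norm1 (Z y))) ler_powR// addr_ge0.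
apply: (le_trans (smooth4_growth C0 q0 fS _)).
have -> : a x * ((`|f 0| + C) * b y) = `|f 0| * (a x * b y) + C * (a x * b y) by ring.
rewrite lerD ?ler_peMr// ler_wpM2l// -powRM//.
by apply: ge0_ler_powR; rewrite ?nnegrE ?mulr_ge0 ?addr_ge0 ?norm1_ge0.
Qed.

Let I1 t j := \int[(P \x Q)%E]_w (W w.1 j 0 * partial [:: j] f (U t w)).
Let I2 t j := \int[(P \x Q)%E]_w (Z w.2 j 0 * partial [:: j] f (U t w)).
Let I3 t j k := \int[(P \x Q)%E]_w partial [:: k; j] f (U t w).

Let le_W j x y : `|W x j 0| <= (1 + norm1 (W x)) * (1 + norm1 (Z y)).
Proof. by have := le_norm1 (W x) j; have := ew x; have := ez y; nra. Qed.

Let le_Z j x y : `|Z y j 0| <= (1 + norm1 (W x)) * (1 + norm1 (Z y)).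
Proof. by have := le_norm1 (Z y) j; have := ew x; have := ez y; nra. Qed.

Let le_1 x y : `|1 : R| <= (1 + norm1 (W x)) * (1 + norm1 (Z y)).
Proof. by rewrite normr1; have := ew x; have := ez y; nra. Qed.

Let m1 t j : measurable_fun setT (fun w => W w.1 j 0 * partial [:: j] f (U t w)).
Proof.
by apply: measurable_funM; [exact: (measurableT_comp (mW j) measurable_fst)|exact: mF].
Qed.

Let m2 t j : measurable_fun setT (fun w => Z w.2 j 0 * partial [:: j] f (U t w)).
Proof.
by apply: measurable_funM; [exact: (measurableT_comp (mZ j) measurable_snd)|exact: mF].
Qed.

Let domW t j x y := dom t (u := fun w => W w.1 j 0) (js := [:: j]) isT (le_W j x y).
Let domZ t j x y := dom t (u := fun w => Z w.2 j 0) (js := [:: j]) isT (le_Z j x y).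
Let dom1 t j k x y : `|partial [:: k; j] f (U t (x, y))| <= a x * (C * b y).
Proof. by have := dom t (u := fun=> 1) (js := [:: k; j]) isT (le_1 x y); rewrite mul1r. Qed.

Definition interpolant t := \int[(P \x Q)%E]_w f (U t w).

Lemma is_derive_interpolant (t : R) :
  is_derive t 1 interpolant (cos t * \sum_j I1 t j - sin t * \sum_j I2 t j).
Proof.
pose g s w := \sum_j (cos s * W w.1 j 0 - sin s * Z w.2 j 0) * partial [:: j] f (U s w).
have gD (s : R) w : is_derive s 1 (fun s : R => f (U s w)) (g s w).
  apply: is_derive_curve; [exact: (smooth4_derivable fS (s := [::]))|
    by move=> i; exact: (smooth4_derivable fS (s := [:: i]))|
    by move=> i j; exact: (smooth4_locally_bounded C0 q0 fS (s := [:: j; i]))|].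
  move=> j; rewrite (_ : (fun s => _) = W w.1 j 0 *: (sin : R -> R) + Z w.2 j 0 *: (cos : R -> R)); last first.
    by apply/funext => u; rewrite !mxE /= mulrC [cos u * _]mulrC.
  rewrite (_ : cos s * _ - _ = W w.1 j 0 *: (cos s : R) + Z w.2 j 0 *: (- sin s : R)); last first.
    by rewrite /GRing.scale /=; ring.
  by apply: is_deriveD; apply: is_deriveZ.
have gE (s : R) w : derive1 (fun s : R => f (U s w)) s = g s w.
  by rewrite derive1E; have [_ ->] := gD s w.
have iF1 s j := dominated_integrable (m1 s j) iW iCb a0 Cb0 (domW s j).
have iF2 s j := dominated_integrable (m2 s j) iW iCb a0 Cb0 (domZ s j).
have iG : integrable_real (P \x Q)%E (fun w => C * (a w.1 * b w.2)).
  apply: integrable_realZ; apply: (integrable_prod_le (a := a) (b := b)) => //.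
    apply: measurable_funM.
      exact: (measurableT_comp (integrable_real_measurable iW) measurable_fst).
    exact: (measurableT_comp (integrable_real_measurable ib) measurable_snd).
  by move=> x y; rewrite ger0_norm// mulr_ge0.
have iu s w : `]t - 1, t + 1[%classic s -> True -> derivable (fun s => f (U s w)) s 1.
  by move=> _ _; have [] := gD s w.
have tI : (`]t - 1, t + 1[%classic : set R) t.
  by rewrite /= in_itv /= ltrBlDr ltrDl ltr01.
have fI s : integrable_real (P \x Q)%E (fun w => f (U s w)).
  apply: (dominated_integrable (a := a) (b := fun y => (`|f 0| + C) * b y)) => //.
  - by apply: measurable_norm1_continuous => //; exact: (smooth4_continuous C0 q0 fS (s := [::])).
  - exact: integrable_realZ.
  - by move=> y; rewrite mulr_ge0 ?addr_ge0.
have G0 w : 0 <= C * (a w.1 * b w.2) by rewrite !mulr_ge0.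
have Gub s w : (`]t - 1, t + 1[%classic : set R) s -> True ->
    `|partial1of2 (fun s w => f (U s w)) s w| <= C * (a w.1 * b w.2).
  move=> _ _; rewrite /partial1of2 gE; case: w => x y /=.
  rewrite (le_trans (ler_norm_sum _ _ _))//.
  have cs : `|cos s| <= 1 by rewrite ler_norml cos_geN1 cos_le1.
  have ss : `|sin s| <= 1 by rewrite ler_norml sin_geN1 sin_le1.
  apply: (@le_trans _ _ (\sum_j (`|W x j 0| + `|Z y j 0|) *
      (C * ((1 + norm1 (W x)) `^ q * (1 + norm1 (Z y)) `^ q)))).
    apply: ler_sum => j _; rewrite normrM ler_pM//; last exact: partial_le.
    by rewrite (le_trans (ler_normB _ _))// !normrM lerD// ler_piMl.
  rewrite -mulr_suml big_split -/(norm1 (W x)) -/(norm1 (Z y)) aE bE.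
  have p0 : 0 <= C * ((1 + norm1 (W x)) `^ q * (1 + norm1 (Z y)) `^ q).
    by rewrite !mulr_ge0 ?powR_ge0.
  have h : norm1 (W x) + norm1 (Z y) <= (1 + norm1 (W x)) * (1 + norm1 (Z y)).
    by have := norm1_ge0 (W x); have := norm1_ge0 (Z y); nra.
  apply: (le_trans (ler_wpM2r p0 h)).
  by rewrite le_eqVlt; apply/orP; left; apply/eqP; ring.
have D := derivable_under_integral measurableT tI (fun s _ => fI s) iu G0 iG Gub.
have E := differentiation_under_integral measurableT tI (fun s _ => fI s) iu G0 iG Gub.
apply: DeriveDef; first exact: D.
rewrite -derive1E E /partial1of2.
transitivity (\int[(P \x Q)%E]_w (cos t * (\sum_j W w.1 j 0 * partial [:: j] f (U t w)) -
    sin t * (\sum_j Z w.2 j 0 * partial [:: j] f (U t w)))).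
  apply: eq_Rintegral => w _; rewrite gE /g !mulr_sumr -sumrB.
  by apply: eq_bigr => j _; rewrite mulrBl !mulrA.
have iS1 : integrable_real (P \x Q)%E (fun w => \sum_j W w.1 j 0 * partial [:: j] f (U t w)).
  by apply: integrable_real_sum => j; exact: iF1.
have iS2 : integrable_real (P \x Q)%E (fun w => \sum_j Z w.2 j 0 * partial [:: j] f (U t w)).
  by apply: integrable_real_sum => j; exact: iF2.
rewrite rintegralB; [|exact: integrable_realZ..].
by rewrite !rintegralZ// !rintegral_sum//.
Qed.

Definition stein_defect s (z : 'cV[R]_d) :=
  \sum_j \int[P]_x (W x j 0 * partial [:: j] f (s *: W x + z)) -
  s * \sum_j \sum_k (S *m S) j k * \int[P]_x partial [:: k; j] f (s *: W x + z).

Lemma integrable_stein_defect (t : R) :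
  integrable_real Q (fun y => stein_defect (sin t) (cos t *: Z y)).
Proof.
apply: integrable_realB; first by apply: integrable_real_sum => j;
  exact: (dominated_partial2 (m1 t j) iW iCb a0 Cb0 (domW t j)).
apply: integrable_realZ; apply: integrable_real_sum => j; apply: integrable_real_sum => k.
apply: integrable_realZ.
exact: (dominated_partial2 (mF t (js := [:: k; j]) isT) iW iCb a0 Cb0 (dom1 t j k)).
Qed.

Lemma interpolant_derivative_stein (t : R) :
  cos t * \sum_j I1 t j - sin t * \sum_j I2 t j =
  cos t * \int[Q]_y stein_defect (sin t) (cos t *: Z y).
Proof.
have E2 j : I2 t j = cos t * \sum_k (S *m S) j k * I3 t j k.
  rewrite /I2 (dominated_fubini12 (m2 t j) iW iCb a0 Cb0 (domZ t j)).
  have iK k := dominated_partial1 (mF t (js := [:: k; j]) isT) iW iCb a0 Cb0 (dom1 t j k).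
  transitivity (\int[P]_x (cos t * \sum_k (S *m S) j k * \int[Q]_y partial [:: k; j] f (U t (x, y)))).
    apply: eq_Rintegral => x _.
    apply: (gaussian_ibp hZ0 symS (F := partial [:: j] f) (sin t *: W x) (cos t) j).
    - exact: (smooth4_derivable fS (s := [:: j])).
    - by move=> i; exact: (smooth4_derivable fS (s := [:: i; j])).
    - by move=> i l; exact: (smooth4_locally_bounded C0 q0 fS (s := [:: l; i; j])).
    - exact: (smooth4_continuous C0 q0 fS (s := [:: j])).
    - by move=> i; exact: (smooth4_continuous C0 q0 fS (s := [:: i; j])).
    - exact: (smooth4_poly_bounded C0 q0 fS (s := [:: j])).
    - by move=> i; exact: (smooth4_poly_bounded C0 q0 fS (s := [:: i; j])).
  rewrite rintegralZ; last by apply: integrable_real_sum => k; exact: integrable_realZ.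
  rewrite rintegral_sum; last by move=> k; exact: integrable_realZ.
  congr (_ * _); apply: eq_bigr => k _; rewrite rintegralZ//.
  by rewrite -(dominated_fubini12 (mF t (js := [:: k; j]) isT) iW iCb a0 Cb0 (dom1 t j k)).
have p1 j := dominated_partial2 (m1 t j) iW iCb a0 Cb0 (domW t j).
have p3 j k := dominated_partial2 (mF t (js := [:: k; j]) isT) iW iCb a0 Cb0 (dom1 t j k).
rewrite /stein_defect rintegralB; last 2 first.
- by apply: integrable_real_sum => j; exact: p1.
- apply: integrable_realZ; apply: integrable_real_sum => j; apply: integrable_real_sum => k.
  by apply: integrable_realZ; exact: p3.
rewrite rintegral_sum; last by move=> j; exact: p1.
rewrite rintegralZ; last first.
  apply: integrable_real_sum => j; apply: integrable_real_sum => k.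
  by apply: integrable_realZ; exact: p3.
rewrite rintegral_sum; last first.
  by move=> j; apply: integrable_real_sum => k; apply: integrable_realZ; exact: p3.
have e1 j : \int[Q]_y \int[P]_x (W x j 0 * partial [:: j] f (sin t *: W x + cos t *: Z y)) = I1 t j.
  by rewrite /I1 (dominated_fubini21 (m1 t j) iW iCb a0 Cb0 (domW t j)).
have e3 j : \int[Q]_y (\sum_k (S *m S) j k *
      \int[P]_x partial [:: k; j] f (sin t *: W x + cos t *: Z y)) =
    \sum_k (S *m S) j k * I3 t j k.
  rewrite rintegral_sum; last by move=> k; apply: integrable_realZ; exact: p3.
  apply: eq_bigr => k _; rewrite rintegralZ; last exact: p3.
  by rewrite /I3 (dominated_fubini21 (mF t (js := [:: k; j]) isT) iW iCb a0 Cb0 (dom1 t j k)).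
rewrite (eq_bigr _ (fun j _ => e1 j)) (eq_bigr _ (fun j _ => e3 j)) (eq_bigr _ (fun j _ => E2 j)).
by rewrite -mulr_sumr mulrBr mulrCA.
Qed.

Lemma gaussian_interpolation_bound (L : R) :
  (forall t, 0 <= sin t -> 0 <= cos t ->
    `|\int[Q]_y stein_defect (sin t) (cos t *: Z y)| <= sin t ^+ 3 * L) ->
  `|\int[P]_x f (W x) - \int[Q]_y f (Z y)| <= L / 4.
Proof.
move=> HL.
have fI s (x : T) : integrable_real Q (fun y => f (U s (x, y))).
  apply: (dominated_section1 (f := fun w => f (U s w)) (a := a) (b := fun y => (`|f 0| + C) * b y)).
  - by apply: measurable_norm1_continuous => //; exact: (smooth4_continuous C0 q0 fS (s := [::])).
  - exact: integrable_realZ.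
  - by move=> u v; exact: f_le.
have ef s : interpolant s = \int[P]_x \int[Q]_y f (U s (x, y)).
  apply: (dominated_fubini12 (f := fun w => f (U s w)) (a := a) (b := fun y => (`|f 0| + C) * b y)).
  - by apply: measurable_norm1_continuous => //; exact: (smooth4_continuous C0 q0 fS (s := [::])).
  - exact: iW.
  - exact: integrable_realZ.
  - exact: a0.
  - by move=> y; rewrite mulr_ge0 ?addr_ge0.
  - by move=> u v; exact: f_le.
have -> : \int[P]_x f (W x) = interpolant (pi / 2).
  rewrite ef; apply: eq_Rintegral => x _.
  rewrite -[LHS](rintegral_cst Q); apply: eq_Rintegral => y _.
  by rewrite /U sin_pihalf cos_pihalf scale1r scale0r addr0.
have -> : \int[Q]_y f (Z y) = interpolant 0.
  rewrite ef -[LHS](rintegral_cst P); apply: eq_Rintegral => x _; apply: eq_Rintegral => y _.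
  by rewrite /U sin0 cos0 scale1r scale0r add0r.
have -> : L / 4 = L / 4 * sin (pi / 2) ^+ 4 - L / 4 * sin 0 ^+ 4.
  by rewrite sin_pihalf sin0 expr1n expr0n mulr0 mulr1 subr0.
apply: (@mean_value_ineq R interpolant _ (fun t => L / 4 * sin t ^+ 4)
  (fun t => cos t * (L * sin t ^+ 3)) 0 (pi / 2)).
- by rewrite divr_ge0 ?pi_ge0.
- exact: is_derive_interpolant.
- move=> t; rewrite [cos t * _]mulrC; apply: (@is_derive1_comp R (fun s => L / 4%:R * s ^+ 4) sin).
  exact: (is_derive_monomial L (sin t) 3).
- move=> t /andP[t0 t1].
  have s0 : 0 <= sin t.
    apply: sin_ge0_pi; rewrite t0 (le_trans t1)//.
    by rewrite ler_pdivrMr// ler_peMr ?pi_ge0 ?ler1n.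
  have c0 : 0 <= cos t.
    apply: cos_ge0_pihalf; rewrite t1 andbT (le_trans _ t0)// oppr_le0.
    by rewrite divr_ge0 ?pi_ge0.
  rewrite interpolant_derivative_stein normrM (ger0_norm c0) ler_wpM2l//.
  by rewrite [L * _]mulrC; exact: HL.
Qed.

End interpolation.

Section independent_rows.
Context {R : realType} {n d : nat} {disp : measure_display}
  {T : measurableType disp} (P : probability T R).
Variables (Y : 'I_n -> T -> 'cV[R]_d) (G : 'I_n -> set (set T)) (q : R).
Hypothesis indepG : mutually_independent P G.
Hypothesis algG : forall i, sigma_algebra setT (G i).
Hypothesis mG : forall i, G i `<=` measurable.
Hypothesis hG : forall i j (B : set R), measurable B ->
  G i ((fun x => Y i x j 0) @^-1` B).
Hypothesis q0 : 0 <= q.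
Hypothesis iY : forall i j, integrable_real P (fun x => `|Y i x j 0| `^ (q + 4)).
Hypothesis meanY : forall i j, \int[P]_x Y i x j 0 = 0.
Hypothesis thirdY : forall i j k l, \int[P]_x (Y i x j 0 * Y i x k 0 * Y i x l 0) = 0.

Definition row_sum x : 'cV[R]_d := \sum_i Y i x.

Definition other_rows i x : 'cV[R]_d := \sum_(k | k != i) Y k x.

Definition envelope x : R := 1 + \sum_(ij : 'I_n * 'I_d) `|Y ij.1 x ij.2 0|.

Lemma row_sum_split i x : row_sum x = other_rows i x + Y i x.
Proof. by rewrite /row_sum (bigD1 i)//= addrC. Qed.

Lemma measurable_row i j : measurable_fun setT (fun x => Y i x j 0).
Proof. by move=> _ B mB; rewrite setTI; apply: mG; exact: hG. Qed.

Lemma measurable_row_own i j :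
  measurable_fun (setT : set (g_sigma_algebraType (G i))) (fun x => Y i x j 0).
Proof. by move=> _ B mB; rewrite setTI; apply: sub_sigma_algebra; exact: hG. Qed.

Lemma measurable_other_rows_own i j :
  measurable_fun (setT : set (g_sigma_algebraType (other_generators G i)))
    (fun x => other_rows i x j 0).
Proof.
rewrite (_ : (fun x => _) = (fun x => \sum_(k <- enum (fun k => k != i)) Y k x j 0)); last first.
  by apply/funext => x; rewrite /other_rows summxE big_enum.
rewrite [X in measurable_fun _ X](_ : _ = (fun x => \sum_(k <- enum (fun k => k != i))
    (if k != i then Y k x j 0 else 0))); last first.
  apply/funext => x; apply: eq_big_seq => k; rewrite mem_enum => ki.
  by rewrite (_ : k != i)//.
apply: measurable_sum => k; case: eqP => [_|ki]; first exact: measurable_cst.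
move=> _ B mB; rewrite setTI; apply: sub_sigma_algebra; exists k; first exact/eqP.
exact: hG.
Qed.

Lemma measurable_other_rows i j : measurable_fun setT (fun x => other_rows i x j 0).
Proof. exact: (measurable_fun_other mG (@measurable_other_rows_own i j)). Qed.

Lemma measurable_row_sum j : measurable_fun setT (fun x => row_sum x j 0).
Proof.
rewrite (_ : (fun x => _) = (fun x => \sum_i Y i x j 0)).
  by apply: measurable_sum => i; exact: measurable_row.
by apply/funext => x; rewrite summxE.
Qed.

Lemma envelope_ge1 x : 1 <= envelope x.
Proof. by rewrite lerDl sumr_ge0. Qed.

Let env0 x : 0 < envelope x.
Proof. exact: lt_le_trans (envelope_ge1 x). Qed.

Lemma sum_norm1_rows x : \sum_i norm1 (Y i x) = envelope x - 1.
Proof.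
by rewrite /envelope addrAC subrr add0r pair_big.
Qed.

Lemma norm1_sum (I : finType) (A : pred I) (v : I -> 'cV[R]_d) :
  norm1 (\sum_(i | A i) v i) <= \sum_(i | A i) norm1 (v i).
Proof.
apply: (big_ind2 (fun a b => norm1 a <= b)) => //.
- by rewrite /norm1 big1// => j _; rewrite mxE normr0.
- by move=> a1 b1 a2 b2 h1 h2; rewrite (le_trans (norm1D _ _))// lerD.
Qed.

Lemma norm1_other_rows i x : norm1 (other_rows i x) + norm1 (Y i x) <= envelope x - 1.
Proof.
by rewrite -sum_norm1_rows [leRHS](bigD1 i)//= addrC lerD2r norm1_sum.
Qed.

Lemma norm1_row i x : norm1 (Y i x) <= envelope x.
Proof.
have := norm1_other_rows i x; have := norm1_ge0 (other_rows i x); lra.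
Qed.

Lemma norm1_row_sum x : norm1 (row_sum x) <= envelope x - 1.
Proof. by rewrite -sum_norm1_rows norm1_sum. Qed.

Lemma integrable_envelope : integrable_real P (fun x => envelope x `^ (q + 4)).
Proof.
have q4 : 0 <= q + 4 by rewrite addr_ge0.
pose c : R := #|{: 'I_n * 'I_d}|.+1%:R `^ (q + 4).
apply: (@integrable_real_le _ _ _ _ _
    (fun x => c * (1 + \sum_(ij : 'I_n * 'I_d) `|Y ij.1 x ij.2 0| `^ (q + 4)))).
- apply: (measurableT_comp (measurable_powR _)); apply: measurable_funD => //.
  by apply: measurable_sum => ij; apply: measurableT_comp => //; exact: measurable_row.
- apply: integrable_realZ; apply: integrable_realD; first exact: integrable_real_cst.
  by apply: integrable_real_sum => ij; exact: iY.
- by move=> x; rewrite ger0_norm ?powR_ge0// powR_add1_sum.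
Qed.

Lemma envelope_exp_le x a b : a <= b -> envelope x `^ a <= envelope x `^ b.
Proof. by move=> ab; rewrite ler_powR// envelope_ge1. Qed.

Lemma integrable_le_envelope (U : T -> R) (c a : R) : measurable_fun setT U -> a <= q + 4 ->
  0 <= c -> (forall x, `|U x| <= c * envelope x `^ a) -> integrable_real P U.
Proof.
move=> mU aq c0 Uc; apply: (integrable_real_le mU (integrable_realZ c integrable_envelope)).
by move=> x; rewrite (le_trans (Uc x))// ler_wpM2l// envelope_exp_le.
Qed.

Lemma integrable_le_envelopeM (k : nat) (U D : T -> R) (c a : R) : k%:R + a <= q + 4 ->
  measurable_fun setT U -> measurable_fun setT D -> 0 <= c ->
  (forall x, `|U x| <= envelope x ^+ k) -> (forall x, `|D x| <= c * envelope x `^ a) ->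
  integrable_real P (fun x => U x * D x).
Proof.
move=> ka mU mD c0 Uk Dq.
apply: (@integrable_le_envelope _ c (k%:R + a)) => //.
  exact: measurable_funM.
move=> x; rewrite normrM powRD ?(gt_eqF (env0 x)) ?implybT// mulrCA ler_pM//.
by rewrite powR_mulrn ?Uk// ltW.
Qed.

Lemma integrable_le_envelope_exp (k : nat) (U : T -> R) : k%:R <= q + 4 ->
  measurable_fun setT U -> (forall x, `|U x| <= envelope x ^+ k) ->
  integrable_real P U.
Proof.
move=> kq mU Uk.
apply: (@integrable_le_envelope _ 1 k%:R) => //.
by move=> x; rewrite mul1r powR_mulrn ?Uk// ltW.
Qed.

Lemma independent_row_mul i (k : nat) (U D : T -> R) (c a : R) : k%:R + a <= q + 4 -> 0 <= a ->
  measurable_fun (setT : set (g_sigma_algebraType (G i))) U ->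
  measurable_fun (setT : set (g_sigma_algebraType (other_generators G i))) D -> 0 <= c ->
  (forall x, `|U x| <= envelope x ^+ k) -> (forall x, `|D x| <= c * envelope x `^ a) ->
  integrable_real P (fun x => U x * D x) /\
  \int[P]_x (U x * D x) = \int[P]_x U x * \int[P]_x D x.
Proof.
move=> ka a0 mU mD c0 Uk Dq.
have GU (B : set R) : measurable B -> G i (U @^-1` B).
  move=> mB; rewrite -(sigma_algebra_id (algG i)).
  by have := mU measurableT B mB; rewrite setTI.
apply: (integral_mul_other indepG algG mG GU mD).
  have kq : k%:R <= q + 4 by rewrite (le_trans _ ka)// lerDl.
  apply: (integrable_le_envelope_exp kq _ Uk) => _ B mB; rewrite setTI.
  by apply: mG; exact: GU.
apply: (integrable_le_envelope _ _ c0 Dq); last by rewrite (le_trans _ ka)// lerDr.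
exact: (measurable_fun_other mG mD).
Qed.

Let k4q (k : nat) : (k <= 4)%N -> k%:R + q <= q + 4.
Proof. by move=> k4; rewrite addrC lerD2l (ler_nat _ k 4). Qed.

Lemma growth_factor_le x (z v : 'cV[R]_d) : norm1 v <= envelope x - 1 + norm1 z ->
  (1 + norm1 v) `^ q <= (1 + norm1 z) `^ q * envelope x `^ q.
Proof.
move=> vx; have e1 := envelope_ge1 x; have z0 := norm1_ge0 z; have v0 := norm1_ge0 v.
have e0 : 0 <= envelope x by rewrite ltW.
have ez : norm1 z <= norm1 z * envelope x by rewrite ler_peMr.
have z1 : 0 <= 1 + norm1 z by rewrite addr_ge0.
rewrite -powRM//.
have h : 1 + norm1 v <= (1 + norm1 z) * envelope x by rewrite mulrDl mul1r; lra.
have v1 : 0 <= 1 + norm1 v by rewrite addr_ge0.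
by apply: ge0_ler_powR; rewrite // nnegrE (le_trans v1).
Qed.

Variables (f : 'cV[R]_d -> R) (C K A : R) (B r : 'I_d -> R).
Hypotheses (C0 : 0 <= C) (fS : smooth4 f C q).
Hypotheses (K0 : 0 <= K) (B0 : forall t, 0 <= B t).
Hypotheses (r0 : forall t, 0 <= r t) (rq : forall t, r t <= q).
Hypothesis fK : forall (js : seq 'I_d) u, size js = 4 ->
  `|partial js f u| <= K * growth A B r u.

Definition row_weight i k (alpha : 'I_d -> R) : R :=
  K * (A * \int[P]_x (norm1 (Y i x) ^+ k) +
    \sum_t B t * (\int[P]_x (norm1 (Y i x) ^+ k) * alpha t +
      4 `^ r t * \int[P]_x (norm1 (Y i x) ^+ k * `|Y i x t 0| `^ r t))).

Definition row_covariance i j k : R := \int[P]_x (Y i x j 0 * Y i x k 0).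

Section fixed_row.
Variables (i : 'I_n) (s : R) (z : 'cV[R]_d).
Hypothesis s01 : 0 <= s <= 1.

Let V x := s *: other_rows i x + z.
Let N x := norm1 (Y i x).
Let a t x := split_power (r t) s (z t 0) (other_rows i x t 0).
Let M x := K * (A + \sum_t B t * (a t x + 4 `^ r t * `|Y i x t 0| `^ r t)).

Let VE x : V x + s *: Y i x = s *: row_sum x + z.
Proof. by rewrite /V (row_sum_split i) scalerDr addrAC. Qed.

Let normV x : norm1 (V x) + norm1 (s *: Y i x) <= envelope x - 1 + norm1 z.
Proof.
have [s0 s1] : 0 <= s /\ s <= 1 by apply/andP.
have h1 : norm1 (V x) <= norm1 (other_rows i x) + norm1 z.
  rewrite (le_trans (norm1D _ _))// lerD2r norm1Z (ger0_norm s0) ler_piMl//.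
  exact: norm1_ge0.
have h2 : norm1 (s *: Y i x) <= norm1 (Y i x).
  by rewrite norm1Z (ger0_norm s0) ler_piMl// norm1_ge0.
by have := norm1_other_rows i x; lra.
Qed.

Let partial_le (js : seq 'I_d) x v : (0 < size js <= 4)%N ->
  norm1 v <= norm1 (V x) + norm1 (s *: Y i x) ->
  `|partial js f v| <= C * (1 + norm1 z) `^ q * envelope x `^ q.
Proof.
move=> js4 vx; rewrite (le_trans (fS.2 _ _ js4))// -mulrA ler_wpM2l//.
by apply: growth_factor_le; exact: le_trans (normV x).
Qed.

Let cz0 : 0 <= C * (1 + norm1 z) `^ q.
Proof. by rewrite mulr_ge0 ?powR_ge0. Qed.

Let mN : measurable_fun (setT : set (g_sigma_algebraType (G i))) N.
Proof.
by apply: measurable_sum => j; apply: measurableT_comp => //; exact: measurable_row_own.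
Qed.

Let mN' : measurable_fun setT N.
Proof. by apply: measurable_sum => j; apply: measurableT_comp => //; exact: measurable_row. Qed.

Let mVo j : measurable_fun (setT : set (g_sigma_algebraType (other_generators G i)))
  (fun x => V x j 0).
Proof.
rewrite (_ : (fun x => _) = (fun x => s * other_rows i x j 0 + z j 0)).
  apply: measurable_funD => //; apply: measurable_funM => //.
  exact: measurable_other_rows_own.
by apply/funext => x; rewrite !mxE.
Qed.

Let mF (js : seq 'I_d) : (size js < 4)%N ->
  measurable_fun (setT : set (g_sigma_algebraType (other_generators G i)))
    (fun x => partial js f (V x)).
Proof.
by move=> js4; apply: measurable_norm1_continuous => //; exact: (smooth4_continuous C0 q0 fS).
Qed.

Let ma t : measurable_fun (setT : set (g_sigma_algebraType (other_generators G i))) (a t).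
Proof. by apply: measurable_split_power => //; exact: measurable_other_rows_own. Qed.

Let Nk (k : nat) x : `|N x ^+ k| <= envelope x ^+ k.
Proof.
rewrite ger0_norm ?exprn_ge0 ?norm1_ge0// lerXn2r ?nnegrE ?norm1_row ?norm1_ge0//.
exact: ltW.
Qed.

Let row_le j x : `|Y i x j 0| <= envelope x.
Proof. exact: le_trans (le_norm1 _ _) (norm1_row _ _). Qed.

Let abs_pow_le t x (y : R) : `|y| <= envelope x -> `|y| `^ r t <= envelope x `^ q.
Proof.
move=> yx; apply: le_trans (envelope_exp_le x (rq t)).
by apply: ge0_ler_powR; rewrite ?nnegrE// ltW.
Qed.

Let a_le t x : `|a t x| <= (4 `^ r t + 2 `^ r t * `|z t 0| `^ r t) * envelope x `^ q.
Proof.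
rewrite ger0_norm ?split_power_ge0//.
apply: (le_trans (split_power_upper _ _ (r0 t) s01)).
rewrite mulrDl lerD//.
  rewrite ler_wpM2l ?powR_ge0//; apply: abs_pow_le.
  apply: (le_trans (le_norm1 _ _)).
  by have := norm1_other_rows i x; have := norm1_ge0 (Y i x); lra.
rewrite ler_peMr ?mulr_ge0 ?powR_ge0//.
by rewrite -[leLHS](powRr0 (envelope x)) envelope_exp_le.
Qed.

Let iN k : (k <= 4)%N -> integrable_real P (fun x => N x ^+ k).
Proof.
move=> k4; apply: (integrable_le_envelope_exp _ _ (Nk k)).
  by apply: le_trans (k4q k4); rewrite lerDl.
exact: measurable_funX.
Qed.

Let iNY k t : (k <= 4)%N -> integrable_real P (fun x => N x ^+ k * `|Y i x t 0| `^ r t).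
Proof.
move=> k4; apply: (integrable_le_envelopeM (c := 1) (k4q k4) _ _ _ (Nk k)) => //.
- exact: measurable_funX.
- by apply: measurable_abs_powR; exact: measurable_row.
- by move=> x; rewrite ger0_norm ?powR_ge0// mul1r abs_pow_le.
Qed.

Let Na k t : (k <= 4)%N -> integrable_real P (fun x => N x ^+ k * a t x) /\
  \int[P]_x (N x ^+ k * a t x) = \int[P]_x (N x ^+ k) * \int[P]_x a t x.
Proof.
move=> k4; apply: (independent_row_mul (k4q k4) q0 _ _ _ (Nk k) (a_le t)) => //.
- exact: measurable_funX.
Qed.

Let NM k : (k <= 4)%N -> integrable_real P (fun x => N x ^+ k * M x) /\
  \int[P]_x (N x ^+ k * M x) = row_weight i k (fun t => \int[P]_x a t x).
Proof.
move=> k4.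
pose g t x := N x ^+ k * a t x + 4 `^ r t * (N x ^+ k * `|Y i x t 0| `^ r t).
have ig t : integrable_real P (g t).
  by apply: integrable_realD; [exact: (Na t k4).1|apply: integrable_realZ; exact: iNY].
have iBg t : integrable_real P (fun x => B t * g t x) by exact: integrable_realZ.
have iA : integrable_real P (fun x => A * N x ^+ k) by apply: integrable_realZ; exact: iN.
have iS : integrable_real P (fun x => \sum_t B t * g t x) by exact: integrable_real_sum.
have E x : N x ^+ k * M x = K * (A * N x ^+ k + \sum_t B t * g t x).
  rewrite /M mulrCA mulrDr [N x ^+ k * A]mulrC mulr_sumr; congr (_ * (_ + _)).
  by apply: eq_bigr => t _; rewrite /g; ring.
split.
  rewrite (_ : (fun x => _) = (fun x => K * (A * N x ^+ k + \sum_t B t * g t x))).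
    by apply: integrable_realZ; exact: integrable_realD.
  exact/funext.
rewrite (_ : (fun x => _) = (fun x => K * (A * N x ^+ k + \sum_t B t * g t x))); last exact/funext.
rewrite rintegralZ; last exact: integrable_realD.
rewrite rintegralD// rintegralZ; last exact: iN.
rewrite rintegral_sum// /row_weight; congr (_ * (_ + _)); apply: eq_bigr => t _.
rewrite rintegralZ// rintegralD; [|exact: (Na t k4).1|by apply: integrable_realZ; exact: iNY].
by rewrite (Na t k4).2 rintegralZ//; exact: iNY.
Qed.

Lemma row_bound :
  `|\sum_j \int[P]_x (Y i x j 0 * partial [:: j] f (s *: row_sum x + z)) -
    s * \sum_j \sum_k row_covariance i j k * \int[P]_x partial [:: k; j] f (s *: row_sum x + z)| <=
  s ^+ 3 * (6^-1 * row_weight i 4 (fun t => \int[P]_x a t x) +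
    2^-1 * (\sum_j \sum_k `|row_covariance i j k|) *
    row_weight i 2 (fun t => \int[P]_x a t x)).
Proof.
have [s0 s1] : 0 <= s /\ s <= 1 by apply/andP.
have nV x : norm1 (V x) <= norm1 (V x) + norm1 (s *: Y i x) by rewrite lerDl norm1_ge0.
have mF' (js : seq 'I_d) : (size js < 4)%N -> measurable_fun setT (fun x => partial js f (V x)).
  by move=> js4; exact: (measurable_fun_other mG (mF js4)).
have mFs (js : seq 'I_d) : (size js < 4)%N ->
    measurable_fun setT (fun x => partial js f (V x + s *: Y i x)).
  move=> js4; apply: measurable_norm1_continuous; first exact: (smooth4_continuous C0 q0 fS).
  move=> j; rewrite (_ : (fun x => _) = (fun x => V x j 0 + s * Y i x j 0)).
    apply: measurable_funD; first exact: (measurable_fun_other mG (mVo j)).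
    by apply: measurable_funM => //; exact: measurable_row.
  by apply/funext => x; rewrite !mxE.
have b1 (U : T -> R) : U =1 cst 1 -> forall x, `|U x| <= envelope x ^+ 0.
  by move=> U1 x; rewrite U1 normr1 expr0.
have bY j x : `|Y i x j 0| <= envelope x ^+ 1 by rewrite expr1.
have bYY j k x : `|Y i x j 0 * Y i x k 0| <= envelope x ^+ 2.
  by rewrite normrM expr2 ler_pM.
have bYYY j k l x : `|Y i x j 0 * Y i x k 0 * Y i x l 0| <= envelope x ^+ 3.
  by rewrite !normrM exprSr expr2 !ler_pM ?mulr_ge0.
have iD (js : seq 'I_d) : (0 < size js < 4)%N ->
    integrable_real P (fun x => partial js f (V x)).
  move=> /andP[js0 js4]; have js4' : (0 < size js <= 4)%N by rewrite js0 ltnW.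
  apply: (integrable_le_envelope (a := q) (mF' _ js4) _ cz0); first by rewrite lerDl.
  by move=> x; apply: partial_le js4' _; exact: nV.
have iDs (js : seq 'I_d) : (0 < size js < 4)%N ->
    integrable_real P (fun x => partial js f (V x + s *: Y i x)).
  move=> /andP[js0 js4]; have js4' : (0 < size js <= 4)%N by rewrite js0 ltnW.
  apply: (integrable_le_envelope (a := q) (mFs _ js4) _ cz0); first by rewrite lerDl.
  by move=> x; apply: partial_le js4' _; exact: norm1D.
have mul (k : nat) (U : T -> R) (js : seq 'I_d) : (k <= 4)%N -> (0 < size js < 4)%N ->
    measurable_fun (setT : set (g_sigma_algebraType (G i))) U ->
    (forall x, `|U x| <= envelope x ^+ k) ->
    integrable_real P (fun x => U x * partial js f (V x)) /\
    \int[P]_x (U x * partial js f (V x)) = \int[P]_x U x * \int[P]_x partial js f (V x).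
  move=> k4 /andP[js0 js4] mU Uk.
  have js4' : (0 < size js <= 4)%N by rewrite js0 ltnW.
  apply: (independent_row_mul (k4q k4) q0 mU (mF js4) cz0 Uk) => x.
  by apply: partial_le js4' _; exact: nV.
have m1 j := @measurable_row_own i j.
have H := @one_summand_bound R d disp T P f C q C0 q0 fS (Y i) V M (row_covariance i) s s0.
move: H => /(_ _ _ _ _ _ _ _ _ _ _)/wrap[||||||||||H].
- move=> x u js js4 bu; apply: (le_trans (fK _ js4)); rewrite ler_wpM2l// lerD2l.
  apply: ler_sum => t _; rewrite ler_wpM2l//.
  have [tau tau01 ->] := bu t.
  have := split_power_le (z t 0) (other_rows i x t 0) (Y i x t 0) (r0 t) s01 tau01.
  by rewrite !mxE.
- by move=> k k4; exact: (NM k4).1.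
- exact: measurable_row.
- move=> j; apply: (integrable_le_envelopeM (k := 1) (k4q _) _ _ cz0 (bY j)) => //.
  + exact: measurable_row.
  + exact: mFs.
  + by move=> x; apply: partial_le => //; exact: norm1D.
- by move=> j k; exact: iDs.
- by move=> j k; exact: iD.
- move=> j; have [h1 h2] := mul 1%N (fun x => Y i x j 0) [:: j] isT isT (m1 j) (bY j).
  by split => //; rewrite h2 meanY mul0r.
- move=> j k; apply: (mul 2%N (fun x => Y i x j 0 * Y i x k 0) [:: k; j]) => //.
  exact: measurable_funM.
- move=> j k l.
  have [|h1 h2] := mul 3%N (fun x => Y i x j 0 * Y i x k 0 * Y i x l 0) [:: l; k; j] isT isT _ (bYYY j k l).
    by do 2 (apply: measurable_funM => //).
  by split => //; rewrite h2 thirdY mul0r.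
- move=> j k l; have [h1 h2] := mul 1%N (fun x => Y i x l 0) [:: l; k; j] isT isT (m1 l) (bY l).
  by split => //; rewrite h2 meanY mul0r.
rewrite (NM (k := 4) isT).2 (NM (k := 2) isT).2 in H.
have e1 j : \int[P]_x (Y i x j 0 * partial [:: j] f (s *: row_sum x + z)) =
    \int[P]_x (Y i x j 0 * partial [:: j] f (V x + s *: Y i x)).
  by apply: eq_Rintegral => x _; rewrite VE.
have e3 j k : \int[P]_x partial [:: k; j] f (s *: row_sum x + z) =
    \int[P]_x partial [:: k; j] f (V x + s *: Y i x).
  by apply: eq_Rintegral => x _; rewrite VE.
have e2 j : \sum_k row_covariance i j k * \int[P]_x partial [:: k; j] f (s *: row_sum x + z) =
    \sum_k row_covariance i j k * \int[P]_x partial [:: k; j] f (V x + s *: Y i x).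
  by apply: eq_bigr => k _; rewrite e3.
rewrite (eq_bigr _ (fun j _ => e1 j)) (eq_bigr _ (fun j _ => e2 j)).
exact: H.
Qed.

End fixed_row.

Let env_ge0 x : 0 <= envelope x. Proof. exact: ltW. Qed.

Let abs_coord_row i j x : `|Y i x j 0| <= envelope x.
Proof. exact: le_trans (le_norm1 _ _) (norm1_row _ _). Qed.

Let abs_coord_other i j x : `|other_rows i x j 0| <= envelope x.
Proof.
apply: (le_trans (le_norm1 _ _)).
by have := norm1_other_rows i x; have := norm1_ge0 (Y i x); lra.
Qed.

Let abs_coord_sum j x : `|row_sum x j 0| <= envelope x.
Proof.
apply: (le_trans (le_norm1 _ _)); have := norm1_row_sum x; lra.
Qed.

Lemma integrable_abs_powR (u : T -> R) a : measurable_fun setT u -> 0 <= a <= q + 4 ->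
  (forall x, `|u x| <= envelope x) -> integrable_real P (fun x => `|u x| `^ a).
Proof.
move=> mu /andP[a0 aq] uS.
apply: (@integrable_le_envelope _ 1 a) => //; first exact: measurable_abs_powR.
move=> x; rewrite mul1r ger0_norm ?powR_ge0//.
by apply: ge0_ler_powR; rewrite ?nnegrE.
Qed.

Lemma row_sum_covariance j k :
  integrable_real P (fun x => row_sum x j 0 * row_sum x k 0) /\
  \int[P]_x (row_sum x j 0 * row_sum x k 0) = \sum_i row_covariance i j k.
Proof.
have q2 : 1%:R + 1 <= q + 4 by have := q0; lra.
have iYY i : integrable_real P (fun x => Y i x j 0 * Y i x k 0).
  apply: (integrable_le_envelopeM (k := 1) (c := 1) q2) => //; try exact: measurable_row.
  by move=> x; rewrite mul1r powRr1.
have cross i : integrable_real P (fun x => Y i x j 0 * other_rows i x k 0) /\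
    \int[P]_x (Y i x j 0 * other_rows i x k 0) = 0.
  have [|||||h1 h2] := @independent_row_mul i 1 (fun x => Y i x j 0)
    (fun x => other_rows i x k 0) 1 1 q2 ler01.
  - exact: measurable_row_own.
  - exact: measurable_other_rows_own.
  - exact: ler01.
  - by move=> x; rewrite expr1.
  - by move=> x; rewrite mul1r powRr1.
  by split => //; rewrite h2 meanY mul0r.
have E x : row_sum x j 0 * row_sum x k 0 =
    \sum_i (Y i x j 0 * Y i x k 0 + Y i x j 0 * other_rows i x k 0).
  rewrite {1}/row_sum summxE mulr_suml; apply: eq_bigr => i _.
  by rewrite (row_sum_split i) mxE mulrDr addrC.
have iE i : integrable_real P (fun x => Y i x j 0 * Y i x k 0 + Y i x j 0 * other_rows i x k 0).
  by apply: integrable_realD => //; exact: (cross i).1.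
rewrite (_ : (fun x => _) = (fun x => \sum_i (Y i x j 0 * Y i x k 0 + Y i x j 0 * other_rows i x k 0))); last exact/funext.
split; first exact: integrable_real_sum.
rewrite rintegral_sum//; apply: eq_bigr => i _.
by rewrite rintegralD//; [rewrite (cross i).2 addr0|exact: (cross i).1].
Qed.

Lemma integrable_row_sum j : integrable_real P (fun x => row_sum x j 0).
Proof.
apply: (@integrable_le_envelope _ 1 1) => //.
- exact: measurable_row_sum.
- by have := q0; lra.
- by move=> x; rewrite mul1r powRr1.
Qed.

Lemma row_sum_mean j : \int[P]_x row_sum x j 0 = 0.
Proof.
rewrite (_ : (fun x => _) = (fun x => \sum_i Y i x j 0)); last first.
  by apply/funext => x; rewrite summxE.
rewrite rintegral_sum => [|i]; first by rewrite big1.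
apply: (@integrable_le_envelope _ 1 1) => //.
- exact: measurable_row.
- by have := q0; lra.
- by move=> x; rewrite mul1r powRr1.
Qed.

Lemma other_rows_mean i j : \int[P]_x other_rows i x j 0 = 0.
Proof.
have -> : (fun x => other_rows i x j 0) = (fun x => row_sum x j 0 - Y i x j 0).
  by apply/funext => x; rewrite (row_sum_split i) [in RHS]mxE addrK.
rewrite rintegralB ?row_sum_mean ?meanY ?subrr//; first exact: integrable_row_sum.
apply: (@integrable_le_envelope _ 1 1) => //.
- exact: measurable_row.
- by have := q0; lra.
- by move=> x; rewrite mul1r powRr1.
Qed.

Lemma other_rows_moment_le i t a : 1 <= a <= q + 4 ->
  \int[P]_x `|other_rows i x t 0| `^ a <= \int[P]_x `|row_sum x t 0| `^ a.
Proof.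
move=> /andP[a1 aq]; have a0 : 0 <= a by lra.
pose D x := other_rows i x t 0 * `|other_rows i x t 0| `^ (a - 2).
have DS x : `|D x| <= 1 * envelope x `^ (a - 1).
  rewrite mul1r normrM [`|_ `^ _|]ger0_norm ?powR_ge0//.
  have [->|w0] := eqVneq (other_rows i x t 0) 0; first by rewrite normr0 mul0r powR_ge0.
  have w0' : 0 < `|other_rows i x t 0| by rewrite normr_gt0.
  rewrite -{1}[`|_|]powRr1// -powRD; last by rewrite (gt_eqF w0') implybT.
  have -> : 1 + (a - 2) = a - 1 by ring.
  by apply: ge0_ler_powR; rewrite ?nnegrE ?subr_ge0.
have mo := @measurable_other_rows_own i t.
have [|||||||iD ED] := @independent_row_mul i 1 (fun x => Y i x t 0) D 1 (a - 1).
- by rewrite addrC subrK.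
- by rewrite subr_ge0.
- exact: measurable_row_own.
- by apply: measurable_funM => //; exact: measurable_abs_powR.
- exact: ler01.
- by move=> x; rewrite expr1.
- exact: DS.
rewrite meanY mul0r in ED.
have iW : integrable_real P (fun x => `|row_sum x t 0| `^ a).
  by apply: integrable_abs_powR; rewrite ?a0//; exact: measurable_row_sum.
have iO : integrable_real P (fun x => `|other_rows i x t 0| `^ a).
  by apply: integrable_abs_powR; rewrite ?a0//; exact: measurable_other_rows.
rewrite -[leLHS]addr0 -[X in _ + X](mulr0 a) -ED -rintegralZ// -rintegralD//; last first.
  exact: integrable_realZ.
apply: rintegral_le => //; first by apply: integrable_realD => //; exact: integrable_realZ.
move=> x; rewrite (row_sum_split i) [X in _ <= `|X| `^ _]mxE.
apply: le_trans (abs_powR_tangent _ _ a1).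
by rewrite /D le_eqVlt; apply/orP; left; apply/eqP; ring.
Qed.

Lemma sum_rows_bound (s : R) (z : 'cV[R]_d) : 0 <= s <= 1 ->
  `|\sum_j \int[P]_x (row_sum x j 0 * partial [:: j] f (s *: row_sum x + z)) -
    s * \sum_j \sum_k (\sum_i row_covariance i j k) *
      \int[P]_x partial [:: k; j] f (s *: row_sum x + z)| <=
  s ^+ 3 * \sum_i (6^-1 * row_weight i 4
        (fun t => \int[P]_x split_power (r t) s (z t 0) (other_rows i x t 0)) +
    2^-1 * (\sum_j \sum_k `|row_covariance i j k|) * row_weight i 2
        (fun t => \int[P]_x split_power (r t) s (z t 0) (other_rows i x t 0))).
Proof.
move=> s01; have [s0 s1] : 0 <= s /\ s <= 1 by apply/andP.
pose e1 i j := \int[P]_x (Y i x j 0 * partial [:: j] f (s *: row_sum x + z)).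
pose e2 j k := \int[P]_x partial [:: k; j] f (s *: row_sum x + z).
have E1 j : \int[P]_x (row_sum x j 0 * partial [:: j] f (s *: row_sum x + z)) = \sum_i e1 i j.
  rewrite -rintegral_sum.
    by congr Rintegral; apply/funext => x; rewrite {1}/row_sum summxE mulr_suml.
  move=> i; apply: (@integrable_le_envelopeM 1 _ _ (C * (1 + norm1 z) `^ q) q).
  - by have := q0; lra.
  - exact: measurable_row.
  - apply: measurable_norm1_continuous; first exact: (smooth4_continuous C0 q0 fS).
    move=> k; rewrite (_ : (fun x => _) = (fun x => s * row_sum x k 0 + z k 0)).
      by apply: measurable_funD => //; apply: measurable_funM => //; exact: measurable_row_sum.
    by apply/funext => x; rewrite !mxE.
  - by rewrite mulr_ge0 ?powR_ge0.
  - by move=> x; rewrite expr1.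
  - move=> x; rewrite (le_trans (fS.2 [:: j] _ isT))// -mulrA ler_wpM2l//.
    apply: growth_factor_le; apply: (le_trans (norm1D _ _)); rewrite lerD2r.
    rewrite norm1Z (ger0_norm s0) (le_trans _ (norm1_row_sum x))// ler_piMl//.
    exact: norm1_ge0.
have -> : \sum_j \int[P]_x (row_sum x j 0 * partial [:: j] f (s *: row_sum x + z)) -
    s * \sum_j \sum_k (\sum_i row_covariance i j k) *
      \int[P]_x partial [:: k; j] f (s *: row_sum x + z) =
  \sum_i (\sum_j e1 i j - s * \sum_j \sum_k row_covariance i j k * e2 j k).
  rewrite (eq_bigr _ (fun j _ => E1 j)) exchange_big sumrB; congr (_ - _).
  rewrite -mulr_sumr [in RHS]exchange_big; congr (_ * _); apply: eq_bigr => j _.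
  rewrite exchange_big; apply: eq_bigr => k _; by rewrite mulr_suml.
rewrite (le_trans (ler_norm_sum _ _ _))// mulr_sumr ler_sum// => i _.
exact: row_bound.
Qed.

Section gaussian_average.
Context {d2 : measure_display} {T2 : measurableType d2} (Q : probability T2 R).
Variables (zeta : T2 -> R) (i : 'I_n) (t : 'I_d).
Hypothesis mzeta : measurable_fun setT zeta.
Hypothesis izeta2 : integrable_real Q (fun y => zeta y ^+ 2).
Hypothesis izetar : integrable_real Q (fun y => `|zeta y| `^ r t).
Hypothesis zeta2 : \int[Q]_y (zeta y ^+ 2) = \int[P]_x (row_sum x t 0 ^+ 2).
Hypothesis zetar : r t <= 1 ->
  (\int[Q]_y (zeta y ^+ 2)) `^ (r t / 2) <= 2 `^ r t * \int[Q]_y `|zeta y| `^ r t.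
Variables (s c : R).
Hypotheses (s0 : 0 <= s) (c0 : 0 <= c) (sc : s ^+ 2 + c ^+ 2 = 1).

Let s1 : s <= 1. Proof. by move: s0 c0 sc; nra. Qed.
Let c1 : c <= 1. Proof. by move: s0 c0 sc; nra. Qed.
Let w x := other_rows i x t 0.

Let rq4 : r t <= q + 4. Proof. by rewrite (le_trans (rq t))// lerDl. Qed.

Let iw : integrable_real P (fun x => `|w x| `^ r t).
Proof.
apply: integrable_abs_powR; [exact: measurable_other_rows|by rewrite r0|].
by move=> x; exact: abs_coord_other.
Qed.

Let iw2 : integrable_real P (fun x => w x ^+ 2).
Proof.
rewrite (_ : (fun x => _) = (fun x => `|w x| `^ 2)).
  apply: integrable_abs_powR; [exact: measurable_other_rows|by have := q0; lra|].
  by move=> x; exact: abs_coord_other.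
by apply/funext => x; rewrite (powR_mulrn 2)// real_normK ?num_real.
Qed.

Let iw1 : integrable_real P w.
Proof.
apply: (@integrable_le_envelope _ 1 1) => //.
- exact: measurable_other_rows.
- by have := q0; lra.
- by move=> x; rewrite mul1r powRr1//; exact: abs_coord_other.
Qed.

Let czeta y : `|c * zeta y| `^ r t <= `|zeta y| `^ r t.
Proof.
by apply: ge0_ler_powR; rewrite ?nnegrE// normrM ler_piMl// (ger0_norm c0).
Qed.

Let split_le x y : `|split_power (r t) s (c * zeta y) (w x)| <=
  envelope x `^ q * (4 `^ r t + 2 `^ r t * `|zeta y| `^ r t).
Proof.
rewrite ger0_norm ?split_power_ge0//.
have s01 : 0 <= s <= 1 by rewrite s0.
apply: (le_trans (split_power_upper _ _ (r0 t) s01)).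
have p4 : 0 <= (4 : R) `^ r t by exact: powR_ge0.
have p2 : 0 <= (2 : R) `^ r t by exact: powR_ge0.
rewrite mulrDr lerD//.
  rewrite mulrC ler_wpM2r//; apply: le_trans (envelope_exp_le x (rq t)).
  by apply: ge0_ler_powR; rewrite ?nnegrE//; exact: abs_coord_other.
apply: (le_trans (ler_wpM2l p2 (czeta y))).
rewrite ler_peMl ?mulr_ge0 ?powR_ge0//.
by rewrite -[leLHS](powRr0 (envelope x)) envelope_exp_le.
Qed.

Let isplit y : integrable_real P (fun x => split_power (r t) s (c * zeta y) (w x)).
Proof.
apply: (@integrable_le_envelope _ (4 `^ r t + 2 `^ r t * `|zeta y| `^ r t) q).
- by apply: measurable_split_power => //; exact: measurable_other_rows.
- by rewrite lerDl.
- by rewrite addr_ge0 ?mulr_ge0 ?powR_ge0.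
- by move=> x; rewrite [leRHS]mulrC; exact: split_le.
Qed.

Lemma integrable_mean_split_power :
  integrable_real Q (fun y => \int[P]_x split_power (r t) s (c * zeta y) (w x)).
Proof.
apply: (@integrable_prod_snd _ _ _ _ _ P Q
  (fun xy => split_power (r t) s (c * zeta xy.2) (w xy.1))
  (fun x => envelope x `^ q) (fun y => 4 `^ r t + 2 `^ r t * `|zeta y| `^ r t)).
- apply: measurable_split_power.
    exact: (measurableT_comp (@measurable_other_rows i t) measurable_fst).
  by apply: measurable_funM => //; exact: (measurableT_comp mzeta measurable_snd).
- apply: (@integrable_le_envelope _ 1 q) => //.
  + apply: (measurableT_comp (measurable_powR _)).
    by apply: measurable_funD => //; apply: measurable_sum => ij;
       apply: measurableT_comp => //; exact: measurable_row.
  + by rewrite lerDl.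
  + by move=> x; rewrite mul1r ger0_norm ?powR_ge0.
- by apply: integrable_realD; [exact: integrable_real_cst|exact: integrable_realZ].
- by move=> x; exact: powR_ge0.
- by move=> y; rewrite addr_ge0 ?mulr_ge0 ?powR_ge0.
- exact: split_le.
Qed.

Let second_moment z : \int[P]_x ((s * w x + z) ^+ 2) = s ^+ 2 * \int[P]_x (w x ^+ 2) + z ^+ 2.
Proof.
rewrite (_ : (fun x => _) = (fun x => s ^+ 2 * w x ^+ 2 + (2 * s * z * w x + z ^+ 2))); last first.
  by apply/funext => x; ring.
have i1 : integrable_real P (fun x => 2 * s * z * w x) by exact: integrable_realZ.
have i2 : integrable_real P (fun x => s ^+ 2 * w x ^+ 2) by exact: integrable_realZ.
rewrite rintegralD//; last by apply: integrable_realD => //; exact: integrable_real_cst.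
rewrite rintegralD//; last exact: integrable_real_cst.
have mw : \int[P]_x w x = 0 by exact: other_rows_mean.
by rewrite (rintegralZ (2 * s * z) iw1) (rintegralZ (s ^+ 2) iw2) mw rintegral_cst mulr0 add0r.
Qed.

Let mean_small u : r t < 1 -> 0 < u -> \int[Q]_y (zeta y ^+ 2) <= u ->
  \int[Q]_y \int[P]_x split_power (r t) s (c * zeta y) (w x) <= u `^ (r t / 2).
Proof.
move=> r1 u0 vu; pose rho := r t / 2.
have rho01 : 0 <= rho <= 1 by rewrite /rho; have := r0 t; lra.
have [rho0 _] : 0 <= rho /\ rho <= 1 by apply/andP.
have w2 : \int[P]_x (w x ^+ 2) <= u.
  apply: le_trans vu; rewrite zeta2.
  have h2 : 1 <= (2 : R) <= q + 4 by have := q0; lra.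
  have := @other_rows_moment_le i t 2 h2.
  have e (v : T -> R) : \int[P]_x `|v x| `^ 2 = \int[P]_x (v x ^+ 2).
    by apply: eq_Rintegral => x _; rewrite (powR_mulrn 2)// real_normK ?num_real.
  by rewrite !e.
pose m2 := \int[P]_x (w x ^+ 2).
pose bound y := u `^ rho * (1 - rho + rho / u * (s ^+ 2 * m2)) + u `^ rho * (rho / u) * c ^+ 2 * zeta y ^+ 2.
have ibound : integrable_real Q bound.
  by apply: integrable_realD; [exact: integrable_real_cst|exact: integrable_realZ].
have iz z : integrable_real P (fun x => (s * w x + z) ^+ 2).
  rewrite (_ : (fun x => _) = (fun x => s ^+ 2 * w x ^+ 2 + (2 * s * z * w x + z ^+ 2))); last first.
    by apply/funext => x; ring.
  apply: integrable_realD; first exact: integrable_realZ.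
  by apply: integrable_realD; [exact: integrable_realZ|exact: integrable_real_cst].
have inner y : \int[P]_x split_power (r t) s (c * zeta y) (w x) <= bound y.
  apply: (@le_trans _ _ (\int[P]_x (u `^ rho * (1 - rho) +
      u `^ rho * (rho / u) * (s * w x + c * zeta y) ^+ 2))).
    apply: rintegral_le => //.
      apply: integrable_realD; first exact: integrable_real_cst.
      exact: integrable_realZ.
    move=> x; rewrite /split_power r1 abs_powRE -/rho.
    set a := (_ + _) ^+ 2; have a0 : 0 <= a by exact: sqr_ge0.
    have au : 0 <= a / u by rewrite divr_ge0// ltW.
    have -> : a `^ rho = u `^ rho * (a / u) `^ rho.
      by rewrite -powRM//; [rewrite mulrC divfK ?gt_eqF|exact: ltW].
    apply: (le_trans (ler_wpM2l (powR_ge0 _ _) (powR_le_tangent rho01 au))).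
    by rewrite le_eqVlt; apply/orP; left; apply/eqP; ring.
  rewrite rintegralD; [|exact: integrable_real_cst|exact: integrable_realZ].
  rewrite rintegral_cst rintegralZ// second_moment -/m2 /bound.
  by rewrite le_eqVlt; apply/orP; left; apply/eqP; ring.
apply: (le_trans (rintegral_le integrable_mean_split_power ibound inner)).
rewrite /bound rintegralD; [|exact: integrable_real_cst|exact: integrable_realZ].
rewrite rintegral_cst rintegralZ// -/rho; set v := \int[Q]_y _ in vu *.
have -> : u `^ rho * (1 - rho + rho / u * (s ^+ 2 * m2)) + u `^ rho * (rho / u) * c ^+ 2 * v =
    u `^ rho * (1 - rho + rho * ((s ^+ 2 * m2 + c ^+ 2 * v) / u)) by ring.
rewrite -[leRHS]mulr1 ler_wpM2l ?powR_ge0//.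
have k : (s ^+ 2 * m2 + c ^+ 2 * v) / u <= 1.
  rewrite ler_pdivrMr// -sc mulrDl; apply: lerD; apply: ler_wpM2l => //; exact: sqr_ge0.
by have := ler_wpM2l rho0 k; lra.
Qed.

Lemma mean_split_power_le :
  \int[Q]_y \int[P]_x split_power (r t) s (c * zeta y) (w x) <=
  4 `^ r t * \int[P]_x `|row_sum x t 0| `^ r t + 2 `^ r t * \int[Q]_y `|zeta y| `^ r t.
Proof.
have W0 : 0 <= 4 `^ r t * \int[P]_x `|row_sum x t 0| `^ r t.
  by rewrite mulr_ge0 ?powR_ge0//; apply: Rintegral_ge0 => x _; exact: powR_ge0.
have [r1|r1] := ltP (r t) 1; last first.
  have inner y : \int[P]_x split_power (r t) s (c * zeta y) (w x) =
      4 `^ r t * \int[P]_x `|w x| `^ r t + 2 `^ r t * `|c * zeta y| `^ r t.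
    rewrite /split_power ltNge r1 /= rintegralD; [|exact: integrable_realZ|exact: integrable_real_cst].
    by rewrite rintegralZ// rintegral_cst.
  rewrite (_ : (fun y => _) = (fun y => 4 `^ r t * \int[P]_x `|w x| `^ r t +
      2 `^ r t * `|c * zeta y| `^ r t)); last exact/funext.
  have ic : integrable_real Q (fun y => `|c * zeta y| `^ r t).
    apply: (integrable_real_le _ izetar).
      by apply: measurable_abs_powR; exact: measurable_funM.
    by move=> y; rewrite ger0_norm ?powR_ge0.
  rewrite rintegralD; [|exact: integrable_real_cst|exact: integrable_realZ].
  rewrite rintegral_cst rintegralZ// lerD// ler_wpM2l ?powR_ge0//.
    by apply: other_rows_moment_le; rewrite r1.
  exact: rintegral_le.
apply: (@le_trans _ _ ((\int[Q]_y (zeta y ^+ 2)) `^ (r t / 2))); last first.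
  by apply: (le_trans (zetar (ltW r1))); rewrite lerDr.
set v := \int[Q]_y (zeta y ^+ 2).
have v0 : 0 <= v by apply: Rintegral_ge0 => y _; exact: sqr_ge0.
have [vE|vn0] := eqVneq v 0; last by apply: mean_small => //; rewrite lt_neqAle eq_sym vn0.
have [rE|rn0] := eqVneq (r t) 0.
  have := @mean_small 1 r1 ltr01; rewrite -/v vE ler01 rE mul0r !powRr0; exact.
have rp : 0 < r t / 2 by rewrite divr_gt0// lt_neqAle eq_sym rn0 r0.
rewrite vE powR0 ?gt_eqF//; apply/ler_addgt0Pr => e e0; rewrite add0r.
have -> : e = (e `^ (r t / 2)^-1) `^ (r t / 2).
  by rewrite -powRrM mulVf ?gt_eqF// powRr1// ltW.
by apply: mean_small; rewrite ?powR_gt0// -/v vE powR_ge0.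
Qed.

End gaussian_average.

Lemma row_weight_le i k (al be : 'I_d -> R) : (forall t, al t <= be t) ->
  row_weight i k al <= row_weight i k be.
Proof.
move=> ab; have N0 : 0 <= \int[P]_x (norm1 (Y i x) ^+ k).
  by apply: Rintegral_ge0 => x _; rewrite exprn_ge0 ?norm1_ge0.
rewrite ler_wpM2l// lerD2l ler_sum// => t _; rewrite ler_wpM2l// lerD2r.
exact: ler_wpM2l.
Qed.

Lemma mean_row_weight {d2 : measure_display} {T2 : measurableType d2} (Q : probability T2 R)
    i k (al : T2 -> 'I_d -> R) : (forall t, integrable_real Q (fun y => al y t)) ->
  integrable_real Q (fun y => row_weight i k (al y)) /\
  \int[Q]_y row_weight i k (al y) = row_weight i k (fun t => \int[Q]_y al y t).
Proof.
move=> ial; set N := \int[P]_x (norm1 (Y i x) ^+ k).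
pose m t := 4 `^ r t * \int[P]_x (norm1 (Y i x) ^+ k * `|Y i x t 0| `^ r t).
have i1 t : integrable_real Q (fun y => N * al y t) by exact: integrable_realZ.
have i2 t : integrable_real Q (fun y => N * al y t + m t).
  by apply: integrable_realD => //; exact: integrable_real_cst.
have i3 t : integrable_real Q (fun y => B t * (N * al y t + m t)) by exact: integrable_realZ.
have i4 : integrable_real Q (fun y => \sum_t B t * (N * al y t + m t)).
  exact: integrable_real_sum.
have i5 : integrable_real Q (fun y => A * N + \sum_t B t * (N * al y t + m t)).
  by apply: integrable_realD => //; exact: integrable_real_cst.
split; first exact: integrable_realZ.
transitivity (K * \int[Q]_y (A * N + \sum_t B t * (N * al y t + m t))).
  exact: (rintegralZ K i5).
rewrite /row_weight; congr (_ * _).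
rewrite (rintegralD (integrable_real_cst Q (A * N)) i4) rintegral_cst; congr (_ + _).
rewrite (rintegral_sum _ i3); apply: eq_bigr => t _.
rewrite (rintegralZ _ (i2 t)); congr (_ * _).
by rewrite (rintegralD (i1 t) (integrable_real_cst Q (m t))) rintegral_cst (rintegralZ _ (ial t)).
Qed.

Section comparison.
Context {d2 : measure_display} {T2 : measurableType d2} (Q : probability T2 R).
Variables (Z0 : 'I_d -> {RV Q >-> R}) (S : 'M[R]_d).
Hypothesis hZ0 : standard_normal_vector Z0.
Hypothesis symS : S^T = S.
Hypothesis covS : forall j k, (S *m S) j k = \sum_i row_covariance i j k.

Let Z y := S *m random_vector (fun j => Z0 j : T2 -> R) y.

Let mZ j : measurable_fun setT (fun y => Z y j 0).
Proof.
apply: (measurable_gaussian_image Z0 S (F := fun v => v j 0)).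
by apply: (norm1_continuous_coord (f := id)) => x; exact: cvg_id.
Qed.

Definition moment_bound t : R :=
  4 `^ r t * \int[P]_x `|row_sum x t 0| `^ r t + 2 `^ r t * \int[Q]_y `|Z y t 0| `^ r t.

Let average i t s c : 0 <= s -> 0 <= c -> s ^+ 2 + c ^+ 2 = 1 ->
  integrable_real Q
    (fun y => \int[P]_x split_power (r t) s (c * Z y t 0) (other_rows i x t 0)) /\
  \int[Q]_y \int[P]_x split_power (r t) s (c * Z y t 0) (other_rows i x t 0) <= moment_bound t.
Proof.
move=> s0 c0 sc.
have i2 : integrable_real Q (fun y => Z y t 0 ^+ 2).
  rewrite (_ : (fun y => _) = (fun y => `|Z y t 0| `^ 2)); first exact: (integrable_gaussian_abs hZ0).
  by apply/funext => y; rewrite (powR_mulrn 2)// real_normK ?num_real.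
have ir := integrable_gaussian_abs hZ0 S t (r0 t).
have v2 := gaussian_second_moment hZ0 symS t.
split; first exact: (integrable_mean_split_power i (mZ t) ir s0 c0 sc).
apply: (mean_split_power_le i (mZ t) i2 ir _ _ s0 c0 sc).
  by rewrite v2 covS -(row_sum_covariance t t).2; apply: eq_Rintegral => x _; rewrite expr2.
by move=> r1; rewrite v2; apply: gaussian_abs_moment_ge => //; rewrite r0.
Qed.

Lemma multivariate_bound :
  `|\int[P]_x f (row_sum x) - \int[Q]_y f (Z y)| <=
  (\sum_i (6^-1 * row_weight i 4 moment_bound +
     2^-1 * (\sum_j \sum_k `|row_covariance i j k|) * row_weight i 2 moment_bound)) / 4.
Proof.
have iW : integrable_real P (fun x => (1 + norm1 (row_sum x)) `^ (q + 1)).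
  apply: (@integrable_le_envelope _ 1 (q + 1)) => //.
  - apply: (measurableT_comp (measurable_powR _)); apply: measurable_funD => //.
    by apply: measurable_sum => j; apply: measurableT_comp => //; exact: measurable_row_sum.
  - by have := q0; lra.
  - move=> x; rewrite mul1r ger0_norm ?powR_ge0//.
    have := env_ge0 x; have := norm1_row_sum x; have := norm1_ge0 (row_sum x) => n0 nS eS.
    by apply: ge0_ler_powR; rewrite ?nnegrE//; have := q0; lra.
apply: (gaussian_interpolation_bound hZ0 symS C0 q0 fS measurable_row_sum iW) => u s0 c0.
set s := sin u in s0 *; set c := cos u in c0 *.
have sc : s ^+ 2 + c ^+ 2 = 1 by rewrite addrC cos2Dsin2.
have s01 : 0 <= s <= 1 by rewrite s0 sin_le1.
pose al i y t := \int[P]_x split_power (r t) s (c * Z y t 0) (other_rows i x t 0).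
have ial i t : integrable_real Q (fun y => al i y t) by exact: (average i t s0 c0 sc).1.
have w4 i := mean_row_weight i 4 (ial i).
have w2 i := mean_row_weight i 2 (ial i).
pose cov i := 2^-1 * \sum_j \sum_k `|row_covariance i j k|.
pose bd y := \sum_i (6^-1 * row_weight i 4 (al i y) + cov i * row_weight i 2 (al i y)).
have ibi i : integrable_real Q (fun y => 6^-1 * row_weight i 4 (al i y) + cov i * row_weight i 2 (al i y)).
  by apply: integrable_realD; apply: integrable_realZ; [exact: (w4 i).1|exact: (w2 i).1].
have ibd : integrable_real Q bd by exact: integrable_real_sum.
apply: (@le_trans _ _ (\int[Q]_y (s ^+ 3 * bd y))).
  apply: rintegral_norm_le.
  - exact: (integrable_stein_defect S hZ0 C0 q0 fS measurable_row_sum iW u).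
  - exact: integrable_realZ.
  - move=> y; have := sum_rows_bound (c *: Z y) s01.
    rewrite /stein_defect.
    have e j : \sum_k (S *m S) j k * \int[P]_x partial [:: k; j] f (s *: row_sum x + c *: Z y) =
       \sum_k (\sum_i row_covariance i j k) *
         \int[P]_x partial [:: k; j] f (s *: row_sum x + c *: Z y).
      by apply: eq_bigr => k _; rewrite covS.
    have ea i : (fun t => \int[P]_x split_power (r t) s ((c *: Z y) t 0) (other_rows i x t 0)) = al i y.
      by apply/funext => t; rewrite /al mxE.
    rewrite (eq_bigr _ (fun j _ => e j)) => /le_trans; apply.
    apply: ler_wpM2l; first exact: exprn_ge0.
    by apply: ler_sum => i _; rewrite ea.
rewrite rintegralZ// ler_wpM2l ?exprn_ge0// rintegral_sum// ler_sum// => i _.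
rewrite rintegralD; [|by apply: integrable_realZ; exact: (w4 i).1|by apply: integrable_realZ; exact: (w2 i).1].
rewrite (rintegralZ 6^-1 (w4 i).1) (rintegralZ (cov i) (w2 i).1) (w4 i).2 (w2 i).2.
have am t : \int[Q]_y al i y t <= moment_bound t by exact: (average i t s0 c0 sc).2.
rewrite lerD// ler_wpM2l ?row_weight_le// ?invr_ge0//.
by rewrite mulr_ge0 ?invr_ge0// sumr_ge0// => j _; rewrite sumr_ge0.
Qed.

End comparison.

End independent_rows.

Section sup_norms.
Context {R : realType}.
Implicit Types h : R -> R.

Lemma sup_norm_ge h y : (`|h y|%:E <= sup_norm h)%E.
Proof. by apply: ereal_sup_ubound; exists y. Qed.

Lemma sup_norm_ge0 h : (0 <= sup_norm h)%E.
Proof. by apply: le_trans (sup_norm_ge h 0); rewrite lee_fin. Qed.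

Lemma hconst_ge0 h : (0 <= hconst 4 h)%E.
Proof. by apply: sume_ge0 => j _; rewrite mule_ge0 ?lee_fin// sup_norm_ge0. Qed.

Lemma hconst_fin h : (hconst 4 h < +oo)%E ->
  exists c : nat -> R, (forall j, 0 <= c j) /\
  (forall j y, (0 < j <= 4)%N -> `|derive1n j h y| <= c j) /\
  hconst 4 h = (\sum_(1 <= j < 5) (stirling2 4 j)%:R * c j)%:E.
Proof.
move=> hK; have c_fin j : (0 < j <= 4)%N -> (sup_norm (derive1n j h) < +oo)%E.
  move=> j4; apply: le_lt_trans hK.
  have jin : j \in index_iota 1 5 by rewrite mem_index_iota ltnS.
  rewrite /hconst (bigD1_seq j)//=.
  have s1 : (1 <= (stirling2 4 j)%:R :> R).
    by rewrite ler1n; move: j4 {jin}; do 5 (case: j => [//|j]).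
  apply: (@le_trans _ _ ((stirling2 4 j)%:R%:E * sup_norm (derive1n j h))%E).
    by rewrite -[leLHS]mul1e lee_wpmul2r ?sup_norm_ge0// lee_fin.
  rewrite leeDl//; apply: sume_ge0 => k _.
  by rewrite mule_ge0 ?lee_fin// sup_norm_ge0.
have cE j : (0 < j <= 4)%N ->
    (fine (sup_norm (derive1n j h)))%:E = sup_norm (derive1n j h).
  by move=> j4; rewrite fineK// ge0_fin_numE ?c_fin// sup_norm_ge0.
exists (fun j => fine (sup_norm (derive1n j h))); split; [|split].
- by move=> j; rewrite fine_ge0// sup_norm_ge0.
- by move=> j y j4; rewrite -lee_fin cE// sup_norm_ge.
- rewrite -sumEFin /hconst big_nat [RHS]big_nat; apply: eq_bigr => j.
  by rewrite ltnS => j4; rewrite EFinM cE.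
Qed.

End sup_norms.

Section composition_smooth.
Context {R : realType} {d : nat}.
Variables (A q : R) (B r : 'I_d -> R).
Hypotheses (A0 : 0 <= A) (B0 : forall t, 0 <= B t) (r0 : forall t, 0 <= r t).
Hypotheses (q0 : 0 <= q) (rq : forall t, r t <= q).

Lemma growth_ge0 (w : 'cV[R]_d) : 0 <= growth A B r w.
Proof. by rewrite addr_ge0// sumr_ge0// => t _; rewrite mulr_ge0 ?powR_ge0. Qed.

Lemma growth_poly (w : 'cV[R]_d) :
  1 + growth A B r w <= (1 + A + \sum_t B t) * (1 + norm1 w) `^ q.
Proof.
have w0 := norm1_ge0 w; set e := (1 + norm1 w) `^ q.
have e1 : 1 <= e.
  by rewrite /e -[leLHS](powRr0 (1 + norm1 w)) ler_powR// lerDl.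
rewrite /growth addrA mulrDl lerD//; first by rewrite ler_peMr// addr_ge0.
rewrite mulr_suml ler_sum// => t _; rewrite ler_wpM2l//.
apply: (@le_trans _ _ ((1 + norm1 w) `^ r t)); last by rewrite ler_powR ?lerDl.
have wt := le_norm1 w t.
by apply: ge0_ler_powR; rewrite ?nnegrE//; lra.
Qed.

Lemma smooth4_comp (h : R -> R) (g : 'cV[R]_d -> R) (K : R) :
  Cb 4 h -> CP (growth A B r) 4 g -> hconst 4 h = K%:E ->
  exists2 C : R, 0 <= C & smooth4 (h \o g) C q /\
  forall (js : seq 'I_d) u, size js = 4 ->
    `|partial js (h \o g) u| <= K * growth A B r u.
Proof.
move=> [hD _] [gD gP] hK.
have [|c [c0 [hc hE]]] := @hconst_fin _ h; first by rewrite hK ltry.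
pose C0 : R := 15 * (c 0%N + c 1%N + c 2%N + c 3%N + c 4%N).
have C00 : 0 <= C0 by rewrite mulr_ge0// !addr_ge0.
have B0' : 0 <= \sum_t B t by rewrite sumr_ge0.
have pc (s : seq 'I_d) w : (0 < size s <= 4)%N -> _ :=
  @partial_comp_le R d h g (growth A B r) c 4 s w hD gD (growth_ge0 w) (gP^~ w) hc.
exists (C0 * (1 + A + \sum_t B t)).
  by rewrite mulr_ge0// !addr_ge0.
split; [split|].
- by move=> s i w s4; apply: (derivable_partial_comp hD gD).
- move=> s w s4; apply: (le_trans (pc s w s4)); rewrite -mulrA.
  have P0 := growth_ge0 w.
  rewrite ler_pM ?powR_ge0//.
  + by rewrite big_seq sumr_ge0.
  + by apply: sum_set_partitions_le => //; case/andP: s4.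
  apply: le_trans (growth_poly w).
  have s01 : 0 <= ((size s)%:R / 4%:R : R) <= 1.
    by rewrite divr_ge0//= ler_pdivrMr// mul1r ler_nat; case/andP: s4.
  apply: (le_trans (powR_le_tangent s01 P0)).
  by case/andP: s01 => s0 s1; nra.
- move=> s w s4; have := pc s w; rewrite sum_set_partitions4// s4 => /(_ isT).
  have -> : (4%:R / 4%:R : R) = 1 by rewrite divff.
  rewrite powRr1; last exact: growth_ge0.
  by move: hE; rewrite hK => -[->].
Qed.

(** Where the growth function vanishes at [w] it vanishes on the whole box
    between 0 and [w], so [g] has no derivative there. *)
Lemma growth_eq0_const (g : 'cV[R]_d -> R) w : CP (growth A B r) 4 g ->
  growth A B r w = 0 -> g w = g 0.
Proof.
move=> [gD gP] w0; apply/eqP; rewrite -subr_eq0 -normr_le0.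
have := @lipschitz_box R d g 0 w 0; rewrite add0r mul0r; apply.
  by move=> i x; exact: (gD [::] i x isT).
move=> i x bx; have : growth A B r x <= 0.
  rewrite -w0 lerD2l ler_sum// => t _; rewrite ler_wpM2l//.
  have [s /andP[s0 s1] ->] := bx t; rewrite mxE add0r.
  by apply: ge0_ler_powR; rewrite ?nnegrE// normrM ler_piMl// ger0_norm.
move=> /(le_trans (gP [:: i] x isT)); rewrite le_eqVlt ltNge powR_ge0 orbF.
by rewrite powR_eq0 normr_eq0 => /andP[/eqP dg _]; rewrite /pderiv /= in dg *; rewrite dg normr0.
Qed.

End composition_smooth.

Section expectations.
Context {R : realType} {disp : measure_display} {T : measurableType disp} (P : probability T R).

Lemma expectation_rintegral (f : T -> R) : integrable_real P f ->
  ('E_P[f] = (\int[P]_x f x)%:E)%E.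
Proof. by move=> fi; rewrite unlock EFin_rintegral. Qed.

Lemma rintegral_expectation (f : T -> R) (a : R) : ('E_P[f] = a%:E)%E -> \int[P]_x f x = a.
Proof. by rewrite unlock /Rintegral => ->. Qed.

Lemma integrable_abs_moment (f : T -> R) (p : R) : measurable_fun setT f ->
  ('E_P[fun x => (`|f x| `^ p)%R] < +oo)%E -> integrable_real P (fun x => `|f x| `^ p).
Proof.
move=> mf; rewrite unlock => h; apply/integrableP; split.
  by apply/measurable_EFinP; exact: measurable_abs_powR.
by under eq_integral => x _ do rewrite /= ger0_norm ?powR_ge0//.
Qed.

Lemma ae_zero_of_mean_zero (f : T -> R) : integrable_real P f -> (forall x, 0 <= f x) ->
  \int[P]_x f x = 0 -> {ae P, forall x, f x = 0}.
Proof.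
move=> fi f0 f1.
have mf : measurable_fun setT (EFin \o f) by exact: measurable_int fi.
have := (ae_eq_integral_abs P measurableT mf).1.
move=> /(_ _)/wrap[|].
  transitivity (\int[P]_x (f x)%:E)%E.
    by apply: eq_integral => x _; rewrite /= ger0_norm.
  by rewrite -EFin_rintegral// f1.
by apply: filterS => x /(_ I) [].
Qed.

Lemma expectation_ae_cst (f : T -> R) (c : R) : measurable_fun setT f ->
  {ae P, forall x, f x = c} -> ('E_P[f] = c%:E)%E.
Proof.
move=> mf fc; rewrite unlock.
transitivity (\int[P]_x (c%:E))%E.
  apply: ae_eq_integral => //; first exact/measurable_EFinP.
  by apply: filterS fc => x -> _.
by rewrite integral_cst//= probability_setT mule1.
Qed.

End expectations.

Section scaled_rows.
Context {R : realType} {n d : nat} {disp : measure_display} {T : measurableType disp}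
  (P : probability T R).
Variable X : 'I_n -> 'I_d -> {RV P >-> R}.

Definition row_algebra i : set (set T) := g_sigma_preimage (fun j => X i j : T -> R).

Lemma row_algebra_sigma i : sigma_algebra setT (row_algebra i).
Proof. exact: smallest_sigma_algebra. Qed.

Lemma row_algebra_measurable i : row_algebra i `<=` measurable.
Proof.
apply: smallest_sub; first exact: sigma_algebra_measurable.
apply: (big_ind (fun F : set (set T) => F `<=` measurable)) => //.
  by move=> F H sF sH C [/sF|/sH].
move=> j _ C [D mD <-]; exact: measurable_funPT.
Qed.

Lemma row_algebra_preimage i j (D : set R) : measurable D ->
  row_algebra i ((X i j : T -> R) @^-1` D).
Proof.
move=> mD; apply: sub_sigma_algebra; rewrite (bigD1 j)//=.
by left; exists D => //; rewrite setTI.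
Qed.

Definition scaled_row (a : R) i x : 'cV[R]_d := \col_j (a * X i j x).

Lemma scaled_row_preimage a i j (D : set R) : measurable D ->
  row_algebra i ((fun x => scaled_row a i x j 0) @^-1` D).
Proof.
move=> mD; rewrite (_ : _ @^-1` _ = (X i j : T -> R) @^-1` ((fun u => a * u) @^-1` D)).
  apply: row_algebra_preimage; rewrite -[X in measurable X]setTI.
  by apply: (measurable_funM (measurable_cst a) (@measurable_id _ _ setT)).
by apply/seteqP; split => x /=; rewrite mxE.
Qed.

End scaled_rows.

Lemma exists_max_exponent (R : realType) (d : nat) (r : 'I_d -> R) : (0 < d)%N ->
  exists k, forall t, r t <= r k.
Proof.
move=> d0; case: (@Order.TotalTheory.arg_maxP _ _ _ (Ordinal d0) xpredT r) => // k _ kP.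
by exists k => t; exact: kP.
Qed.

Section model.
Context {R : realType} {n d : nat} {disp disp' : measure_display}
  {T : measurableType disp} (P : probability T R)
  {T' : measurableType disp'} (Q : probability T' R).
Variable X : 'I_n -> 'I_d -> {RV P >-> R}.
Variables (Z0 : 'I_d -> {RV Q >-> R}) (A : R) (B r : 'I_d -> R) (S : 'M[R]_d).
Hypotheses (n0 : (0 < n)%N) (d0 : (0 < d)%N).
Hypotheses (A0 : 0 <= A) (B0 : forall t, 0 <= B t) (r0 : forall t, 0 <= r t).
Hypothesis meanX : forall i j, ('E_P[X i j] = 0)%E.
Hypothesis indepX : independent_vectors X.
Hypothesis momX : forall i j k, ('E_P[fun x => (`|X i j x| `^ (r k + 4))%R] < +oo)%E.
Hypothesis thirdX : forall i j k l,
  ('E_P[fun x => (X i j x * X i k x * X i l x)%R] = 0)%E.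
Let W := normalized_sum (fun i j => X i j : T -> R).
Hypothesis rootS : nonneg_definite_sqrt (covariance_matrix P W) S.
Hypothesis hZ0 : standard_normal_vector Z0.

Let Z y := S *m random_vector (fun j => Z0 j : T' -> R) y.
Let kmax := projT1 (cid (exists_max_exponent r d0)).
Let q := r kmax.
Let q0 : 0 <= q. Proof. exact: r0. Qed.
Let rq t : r t <= q. Proof. exact: (projT2 (cid (exists_max_exponent r d0))). Qed.

Let sn : R := (Num.sqrt n%:R)^-1.
Let sn0 : 0 <= sn. Proof. by rewrite invr_ge0 sqrtr_ge0. Qed.
Let sn2 : sn ^+ 2 = n%:R^-1.
Proof. by rewrite /sn exprVn sqr_sqrtr. Qed.

Let iX i j : integrable_real P (fun x => `|X i j x| `^ (q + 4)).
Proof. by apply: integrable_abs_moment => //; exact: momX. Qed.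

Let iscaled a i j : integrable_real P (fun x => `|scaled_row X a i x j 0| `^ (q + 4)).
Proof.
rewrite (_ : (fun x => _) = (fun x => `|a| `^ (q + 4) * `|X i j x| `^ (q + 4))).
  exact: integrable_realZ.
by apply/funext => x; rewrite mxE normrM powRM.
Qed.

Let env := envelope (scaled_row X 1).
Let mG := @row_algebra_measurable _ _ _ _ _ _ X.
Let hG a := @scaled_row_preimage _ _ _ _ _ _ X a.

Let le_env i j x : `|X i j x| <= env x.
Proof.
have := le_norm1 (scaled_row X 1 i x) j; rewrite mxE mul1r => /le_trans; apply.
exact: norm1_row.
Qed.

Let env1 x : 1 <= env x. Proof. exact: envelope_ge1. Qed.
Let env0 x : 0 <= env x. Proof. exact: le_trans (env1 x). Qed.

Lemma integrable_row_moment (U : T -> R) k t i : (k <= 4)%N -> measurable_fun setT U ->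
  (forall x, `|U x| <= env x ^+ k) ->
  integrable_real P (fun x => U x * `|X i t x| `^ r t).
Proof.
move=> k4 mU Uk.
apply: (integrable_le_envelopeM mG (hG 1) q0 (iscaled 1) (k := k) (c := 1) (a := q)) => //.
- by rewrite addrC lerD2l (ler_nat _ k 4).
- by apply: measurable_abs_powR; exact: measurable_funPT.
- move=> x; rewrite mul1r ger0_norm ?powR_ge0//.
  apply: le_trans (envelope_exp_le (scaled_row X 1) x (rq t)).
  by apply: ge0_ler_powR; rewrite ?nnegrE//.
Qed.

Lemma integrable_row_product (U : T -> R) (k : nat) : (k <= 4)%N -> measurable_fun setT U ->
  (forall x, `|U x| <= env x ^+ k) -> integrable_real P U.
Proof.
move=> k4 mU Uk.
apply: (integrable_le_envelope_exp mG (hG 1) q0 (iscaled 1) _ mU Uk).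
by apply: (@le_trans _ _ (4%:R)); [rewrite ler_nat|rewrite lerDr].
Qed.

Let W_row_sum x : row_sum (scaled_row X sn) x = W x.
Proof.
by apply/colP => j; rewrite summxE mxE mulr_sumr; apply: eq_bigr => i _; rewrite mxE.
Qed.

Let mean_scaled a i j : \int[P]_x scaled_row X a i x j 0 = 0.
Proof.
rewrite (_ : (fun x => _) = (fun x => a * X i j x)); last by apply/funext => x; rewrite mxE.
rewrite rintegralZ; last first.
  apply: (@integrable_row_product _ 1) => // x; rewrite expr1; exact: le_env.
by rewrite (rintegral_expectation (meanX i j)) mulr0.
Qed.

Let covX i j k := \int[P]_x (X i j x * X i k x).

Let iXX i j k : integrable_real P (fun x => X i j x * X i k x).
Proof.
apply: (@integrable_row_product _ 2) => //; first exact: measurable_funM.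
by move=> x; rewrite normrM expr2 ler_pM.
Qed.

Let iXXX i j k l : integrable_real P (fun x => X i j x * X i k x * X i l x).
Proof.
apply: (@integrable_row_product _ 3) => //; first by do 2 apply: measurable_funM => //.
by move=> x; rewrite !normrM exprSr expr2 !ler_pM ?mulr_ge0.
Qed.

Let cov_scaled i j k : row_covariance P (scaled_row X sn) i j k = n%:R^-1 * covX i j k.
Proof.
rewrite /row_covariance -sn2 -rintegralZ//; apply: eq_Rintegral => x _.
by rewrite !mxE; ring.
Qed.

Let third_scaled i j k l : \int[P]_x (scaled_row X sn i x j 0 * scaled_row X sn i x k 0 *
  scaled_row X sn i x l 0) = 0.
Proof.
transitivity (\int[P]_x (sn ^+ 3 * (X i j x * X i k x * X i l x))).
  by apply: eq_Rintegral => x _; rewrite !mxE; ring.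
by rewrite rintegralZ// (rintegral_expectation (thirdX i j k l)) mulr0.
Qed.

Let algX := @row_algebra_sigma _ _ _ _ _ _ X.

Let cov_root j k : (S *m S) j k = \sum_i row_covariance P (scaled_row X sn) i j k.
Proof.
rewrite rootS.2 mxE unlock.
have mW j' : ('E_P[fun x => W x j' 0%R] = 0)%E.
  rewrite expectation_rintegral.
    congr EFin; rewrite -(row_sum_mean mG (hG sn) q0 (iscaled sn) (mean_scaled sn) j').
    by apply: eq_Rintegral => x _; rewrite W_row_sum.
  rewrite (_ : (fun x => _) = (fun x => row_sum (scaled_row X sn) x j' 0)).
    exact: (integrable_row_sum mG (hG sn) q0 (iscaled sn)).
  by apply/funext => x; rewrite W_row_sum.
have [iWW EWW] := row_sum_covariance indepX algX mG (hG sn) q0 (iscaled sn) (mean_scaled sn) j k.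
rewrite -EWW !mW unlock /Rintegral; congr fine; apply: eq_integral => x _.
by rewrite !W_row_sum mulrfctE /= !subr0.
Qed.

Definition abs4 i j k l m x : R := `|X i j x * X i k x * X i l x * X i m x|.
Definition abs2 i l m x : R := `|X i l x * X i m x|.

Definition mean_W t := \int[P]_x `|W x t 0| `^ r t.
Definition mean_Z t := \int[Q]_y `|Z y t 0| `^ r t.

(** The summand of the bound, as a linear function of the moments of one row:
    [u] is a moment of the row and [ut t] that moment weighted by the [r t]-th
    power of the [t]-th entry. *)
Definition bracket (u : R) (ut : 'I_d -> R) : R :=
  A * u + \sum_t 2 `^ r t * B t *
    (2 `^ r t * u * mean_W t + 2 `^ r t / n%:R `^ (r t / 2) * ut t + mean_Z t * u).

Lemma bracket_sum (I : finType) (u : I -> R) (ut : I -> 'I_d -> R) :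
  \sum_i bracket (u i) (ut i) = bracket (\sum_i u i) (fun t => \sum_i ut i t).
Proof.
rewrite /bracket big_split -mulr_sumr exchange_big; congr (_ + _); apply: eq_bigr => t _.
rewrite -mulr_sumr; congr (_ * _); rewrite !big_split -!mulr_sumr -mulr_suml -mulr_sumr.
by [].
Qed.

Lemma bracketZ a u ut : a * bracket u ut = bracket (a * u) (fun t => a * ut t).
Proof.
rewrite /bracket mulrDr mulrCA mulr_sumr; congr (_ + _); apply: eq_bigr => t _; ring.
Qed.

Let mXX i j k : measurable_fun setT (fun x => X i j x * X i k x).
Proof. exact: measurable_funM. Qed.

Let mabs4 i j k l m : measurable_fun setT (abs4 i j k l m).
Proof.
by apply: measurableT_comp => //; do 2 apply: measurable_funM => //.
Qed.

Let mabs2 i l m : measurable_fun setT (abs2 i l m).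
Proof. exact: measurableT_comp. Qed.

Let abs4_le i j k l m x : `|abs4 i j k l m x| <= env x ^+ 4.
Proof.
rewrite normr_id !normrM [env x ^+ 4]exprSr exprSr expr2.
by rewrite !ler_pM ?mulr_ge0.
Qed.

Let abs2_le i l m x : `|abs2 i l m x| <= env x ^+ 2.
Proof. by rewrite normr_id normrM expr2 ler_pM. Qed.

Lemma integrable_abs4 i j k l m : integrable_real P (abs4 i j k l m).
Proof. exact: (integrable_row_product (k := 4) _ _ (abs4_le _ _ _ _ _)). Qed.

Lemma integrable_abs2 i l m : integrable_real P (abs2 i l m).
Proof. exact: (integrable_row_product (k := 2) _ _ (abs2_le _ _ _)). Qed.

Lemma integrable_abs4_pow i j k l m t :
  integrable_real P (fun x => abs4 i j k l m x * `|X i t x| `^ r t).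
Proof. exact: (integrable_row_moment (k := 4) _ _ _ _ (abs4_le _ _ _ _ _)). Qed.

Lemma integrable_abs2_pow i l m t :
  integrable_real P (fun x => abs2 i l m x * `|X i t x| `^ r t).
Proof. exact: (integrable_row_moment (k := 2) _ _ _ _ (abs2_le _ _ _)). Qed.

Lemma integrable_W_pow t : integrable_real P (fun x => `|W x t 0| `^ r t).
Proof.
rewrite (_ : (fun x => _) = (fun x => `|row_sum (scaled_row X sn) x t 0| `^ r t)); last first.
  by apply/funext => x; rewrite W_row_sum.
apply: (integrable_abs_powR mG (hG sn) q0 (iscaled sn)).
- exact: (measurable_row_sum mG (hG sn)).
- by rewrite r0/= (le_trans (rq t))// lerDl.
- move=> x; apply: (le_trans (le_norm1 _ _)); apply: (le_trans (norm1_row_sum _ _)).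
  by rewrite lerBlDr lerDl.
Qed.

Lemma integrable_Z_pow t : integrable_real Q (fun y => `|Z y t 0| `^ r t).
Proof. exact: (integrable_gaussian_abs hZ0). Qed.

Let sum4 i x : (\sum_j `|X i j x|) ^+ 4 = \sum_j \sum_k \sum_l \sum_m abs4 i j k l m x.
Proof.
rewrite exprS exprS expr2 mulr_suml; apply: eq_bigr => j _.
rewrite mulr_suml mulr_sumr; apply: eq_bigr => k _.
rewrite mulr_suml !mulr_sumr; apply: eq_bigr => l _.
by rewrite !mulr_sumr; apply: eq_bigr => m _; rewrite /abs4 !normrM !mulrA.
Qed.

Let sum2 i x : (\sum_j `|X i j x|) ^+ 2 = \sum_l \sum_m abs2 i l m x.
Proof.
rewrite expr2 mulr_suml; apply: eq_bigr => l _; rewrite mulr_sumr.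
by apply: eq_bigr => m _; rewrite /abs2 normrM.
Qed.

Let norm1_scaled i x : norm1 (scaled_row X sn i x) = sn * \sum_j `|X i j x|.
Proof. by rewrite mulr_sumr; apply: eq_bigr => j _; rewrite mxE normrM ger0_norm. Qed.

Let nr_neq0 t : (n%:R : R) `^ (r t / 2) != 0.
Proof. by rewrite gt_eqF// powR_gt0// ltr0n. Qed.

Let scaled_pow i t x : n%:R `^ (r t / 2) * `|scaled_row X sn i x t 0| `^ r t = `|X i t x| `^ r t.
Proof.
rewrite mxE normrM powRM// (ger0_norm sn0).
have -> : sn `^ r t = (n%:R `^ (r t / 2))^-1.
  rewrite -powR_inv1 ?powR_ge0// -powRrM -[sn](@ger0_norm R)// abs_powRE sn2.
  by rewrite -powR_inv1// -powRrM; congr (_ `^ _); ring.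
by rewrite mulrA mulfV// mul1r.
Qed.

Let row_weight_bracket K i k : row_weight P (scaled_row X sn) K A B r i k
    (fun t => 4 `^ r t * mean_W t + 2 `^ r t * mean_Z t) =
  K * bracket (\int[P]_x norm1 (scaled_row X sn i x) ^+ k)
    (fun t => n%:R `^ (r t / 2) *
      \int[P]_x (norm1 (scaled_row X sn i x) ^+ k * `|scaled_row X sn i x t 0| `^ r t)).
Proof.
rewrite /row_weight /bracket; congr (_ * (_ + _)); apply: eq_bigr => t _.
have -> : (4 : R) `^ r t = 2 `^ r t * 2 `^ r t.
  by rewrite -powRM//; congr (_ `^ _); lra.
by field; exact: nr_neq0.
Qed.

Let bracket4 i j k l m : R :=
  bracket (\int[P]_x abs4 i j k l m x) (fun t => \int[P]_x (abs4 i j k l m x * `|X i t x| `^ r t)).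
Let bracket2 i l m : R :=
  bracket (\int[P]_x abs2 i l m x) (fun t => \int[P]_x (abs2 i l m x * `|X i t x| `^ r t)).

Definition bound_summand i j k l m : R :=
  bracket (\int[P]_x abs4 i j k l m x) (fun t => \int[P]_x (abs4 i j k l m x * `|X i t x| `^ r t))
  + 9 * `|\int[P]_x (X i j x * X i k x)| *
    bracket (\int[P]_x abs2 i l m x) (fun t => \int[P]_x (abs2 i l m x * `|X i t x| `^ r t)).

Let rintegral_sum2 (F : 'I_d -> 'I_d -> T -> R) : (forall l m, integrable_real P (F l m)) ->
  \int[P]_x (\sum_l \sum_m F l m x) = \sum_l \sum_m \int[P]_x F l m x.
Proof.
move=> iF; rewrite rintegral_sum; last by move=> l; exact: integrable_real_sum.
by apply: eq_bigr => l _; rewrite rintegral_sum.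
Qed.

Let rintegral_sum4 (F : 'I_d -> 'I_d -> 'I_d -> 'I_d -> T -> R) :
  (forall j k l m, integrable_real P (F j k l m)) ->
  \int[P]_x (\sum_j \sum_k \sum_l \sum_m F j k l m x) =
  \sum_j \sum_k \sum_l \sum_m \int[P]_x F j k l m x.
Proof.
move=> iF; rewrite (@rintegral_sum2 (fun j k x => \sum_l \sum_m F j k l m x)).
  by apply: eq_bigr => j _; apply: eq_bigr => k _; exact: rintegral_sum2.
by move=> j k; apply: integrable_real_sum => l; exact: integrable_real_sum.
Qed.

Let rintegral_cancel (a b : R) (F H : T -> R) : a != 0 -> integrable_real P H ->
  (forall x, a * F x = b * H x) -> a * \int[P]_x F x = b * \int[P]_x H x.
Proof.
move=> a0 iH e; have iF : integrable_real P F.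
  rewrite (_ : F = (fun x => a^-1 * (b * H x))); first by do 2 apply: integrable_realZ.
  by apply/funext => x; rewrite -e mulKf.
by rewrite -!rintegralZ//; apply: eq_Rintegral => x _; exact: e.
Qed.

Let row_weight4 K i : row_weight P (scaled_row X sn) K A B r i 4
    (fun t => 4 `^ r t * mean_W t + 2 `^ r t * mean_Z t) =
  K * (n%:R ^- 2 * \sum_j \sum_k \sum_l \sum_m bracket4 i j k l m).
Proof.
have sn4 : sn ^+ 4 = n%:R ^- 2 by rewrite (exprM sn 2 2) sn2 exprVn.
have iS : integrable_real P (fun x => \sum_j \sum_k \sum_l \sum_m abs4 i j k l m x).
  by do 4 (apply: integrable_real_sum => ?); exact: integrable_abs4.
have iSt t : integrable_real P
    (fun x => \sum_j \sum_k \sum_l \sum_m abs4 i j k l m x * `|X i t x| `^ r t).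
  by do 4 (apply: integrable_real_sum => ?); exact: integrable_abs4_pow.
rewrite row_weight_bracket /bracket4; congr (_ * _).
under [in RHS]eq_bigr do under eq_bigr do under eq_bigr do rewrite bracket_sum.
under [in RHS]eq_bigr do under eq_bigr do rewrite bracket_sum.
under [in RHS]eq_bigr do rewrite bracket_sum.
rewrite bracket_sum bracketZ; congr bracket.
  rewrite -rintegral_sum4; last by move=> *; exact: integrable_abs4.
  rewrite -rintegralZ//; apply: eq_Rintegral => x _.
  by rewrite norm1_scaled exprMn sn4 sum4.
apply/funext => t; rewrite -rintegral_sum4; last by move=> *; exact: integrable_abs4_pow.
have e x : n%:R `^ (r t / 2) * (norm1 (scaled_row X sn i x) ^+ 4 * `|scaled_row X sn i x t 0| `^ r t) =
    n%:R ^- 2 * \sum_j \sum_k \sum_l \sum_m abs4 i j k l m x * `|X i t x| `^ r t.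
  rewrite mulrCA scaled_pow norm1_scaled exprMn sn4 sum4 -mulrA; congr (_ * _).
  rewrite mulr_suml; apply: eq_bigr => j _; rewrite mulr_suml; apply: eq_bigr => k _.
  by rewrite mulr_suml; apply: eq_bigr => l _; rewrite mulr_suml.
exact: rintegral_cancel (nr_neq0 t) (iSt t) e.
Qed.

Let row_weight2 K i : row_weight P (scaled_row X sn) K A B r i 2
    (fun t => 4 `^ r t * mean_W t + 2 `^ r t * mean_Z t) =
  K * (n%:R^-1 * \sum_l \sum_m bracket2 i l m).
Proof.
have iS : integrable_real P (fun x => \sum_l \sum_m abs2 i l m x).
  by do 2 (apply: integrable_real_sum => ?); exact: integrable_abs2.
have iSt t : integrable_real P (fun x => \sum_l \sum_m abs2 i l m x * `|X i t x| `^ r t).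
  by do 2 (apply: integrable_real_sum => ?); exact: integrable_abs2_pow.
rewrite row_weight_bracket /bracket2; congr (_ * _).
under [in RHS]eq_bigr do rewrite bracket_sum.
rewrite bracket_sum bracketZ; congr bracket.
  rewrite -rintegral_sum2; last by move=> *; exact: integrable_abs2.
  rewrite -rintegralZ//; apply: eq_Rintegral => x _.
  by rewrite norm1_scaled exprMn sn2 sum2.
apply/funext => t; rewrite -rintegral_sum2; last by move=> *; exact: integrable_abs2_pow.
have e x : n%:R `^ (r t / 2) * (norm1 (scaled_row X sn i x) ^+ 2 * `|scaled_row X sn i x t 0| `^ r t) =
    n%:R^-1 * \sum_l \sum_m abs2 i l m x * `|X i t x| `^ r t.
  rewrite mulrCA scaled_pow norm1_scaled exprMn sn2 sum2 -mulrA; congr (_ * _).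
  by rewrite mulr_suml; apply: eq_bigr => l _; rewrite mulr_suml.
exact: rintegral_cancel (nr_neq0 t) (iSt t) e.
Qed.

Let bracket_ge0 u ut : 0 <= u -> (forall t, 0 <= ut t) -> 0 <= bracket u ut.
Proof.
move=> u0 ut0; rewrite addr_ge0 ?mulr_ge0//; apply: sumr_ge0 => t _.
have W0 : 0 <= mean_W t by apply: Rintegral_ge0 => x _; exact: powR_ge0.
have Z00 : 0 <= mean_Z t by apply: Rintegral_ge0 => x _; exact: powR_ge0.
by rewrite mulr_ge0 ?addr_ge0 ?mulr_ge0 ?invr_ge0 ?powR_ge0.
Qed.

Let bracket4_ge0 i j k l m : 0 <= bracket4 i j k l m.
Proof.
apply: bracket_ge0 => [|t]; apply: Rintegral_ge0 => x _; first exact: normr_ge0.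
by apply: mulr_ge0; [exact: normr_ge0|exact: powR_ge0].
Qed.

Let bracket2_ge0 i l m : 0 <= bracket2 i l m.
Proof.
apply: bracket_ge0 => [|t]; apply: Rintegral_ge0 => x _; first exact: normr_ge0.
by apply: mulr_ge0; [exact: normr_ge0|exact: powR_ge0].
Qed.

Lemma bound_summand_ge0 i j k l m : 0 <= bound_summand i j k l m.
Proof. by rewrite addr_ge0 ?bracket4_ge0// !mulr_ge0 ?bracket2_ge0. Qed.

Lemma real_comparison (f : 'cV[R]_d -> R) (C K : R) : 0 <= C -> 0 <= K ->
  smooth4 f C q ->
  (forall (js : seq 'I_d) u, size js = 4 -> `|partial js f u| <= K * growth A B r u) ->
  `|\int[P]_x f (W x) - \int[Q]_y f (Z y)| <=
  K * (24 * n%:R ^+ 2)^-1 *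
    \sum_i \sum_j \sum_k \sum_l \sum_m bound_summand i j k l m.
Proof.
move=> C0 K0 fS fK.
have symS : S^T = S := rootS.1.1.
have := @multivariate_bound R n d disp T P (scaled_row X sn) (row_algebra X) q
  indepX algX mG (hG sn) q0 (iscaled sn) (mean_scaled sn) third_scaled f C K A B r
  C0 fS K0 B0 r0 rq fK disp' T' Q Z0 S hZ0 symS cov_root.
have -> : \int[P]_x f (row_sum (scaled_row X sn) x) = \int[P]_x f (W x).
  by apply: eq_Rintegral => x _; rewrite W_row_sum.
have mbE : moment_bound P (scaled_row X sn) r Z0 S =
    (fun t => 4 `^ r t * mean_W t + 2 `^ r t * mean_Z t).
  apply/funext => t; rewrite /moment_bound.
  have -> : \int[P]_x `|row_sum (scaled_row X sn) x t 0| `^ r t = mean_W t; last by [].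
  by apply: eq_Rintegral => x _; rewrite W_row_sum.
rewrite mbE => /le_trans; apply.
rewrite mulr_suml mulr_sumr; apply: ler_sum => i _.
rewrite row_weight4 row_weight2.
pose c := \sum_j \sum_k `|covX i j k|.
have -> : \sum_j \sum_k `|row_covariance P (scaled_row X sn) i j k| = n%:R^-1 * c.
  rewrite mulr_sumr; apply: eq_bigr => j _; rewrite mulr_sumr; apply: eq_bigr => k _.
  by rewrite cov_scaled normrM ger0_norm// invr_ge0.
set s4 := \sum_j \sum_k \sum_l \sum_m bracket4 i j k l m.
set s2 := \sum_l \sum_m bracket2 i l m.
have c0 : 0 <= c by do 2 (apply: sumr_ge0 => ? _).
have s20 : 0 <= s2 by do 2 (apply: sumr_ge0 => ? _); exact: bracket2_ge0.
have -> : \sum_j \sum_k \sum_l \sum_m bound_summand i j k l m = s4 + 9 * (c * s2).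
  rewrite /s4 /c mulr_suml mulr_sumr -big_split; apply: eq_bigr => j _.
  rewrite mulr_suml mulr_sumr -big_split; apply: eq_bigr => k _.
  rewrite /s2 !mulr_sumr -big_split; apply: eq_bigr => l _.
  rewrite !mulr_sumr -big_split; apply: eq_bigr => m _.
  by rewrite /bound_summand mulrA.
have nn : (n%:R : R) != 0 by rewrite pnatr_eq0 -lt0n.
have -> : (6^-1 * (K * (n%:R ^- 2 * s4)) + 2^-1 * (n%:R^-1 * c) * (K * (n%:R^-1 * s2))) / 4 =
    K * (24 * n%:R ^+ 2)^-1 * (s4 + 3 * (c * s2)).
  by field; rewrite nn.
apply: ler_wpM2l; first by rewrite mulr_ge0 ?invr_ge0 ?mulr_ge0 ?exprn_ge0.
by rewrite lerD2l; have := mulr_ge0 c0 s20; lra.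
Qed.

Lemma bound_summandE i j k l m :
  (A%:E * 'E_P[fun x => `|X i j x * X i k x * X i l x * X i m x|%R]
     + \sum_(t < d) (2 `^ r t * B t)%R%:E *
        ((2 `^ r t)%R%:E
           * 'E_P[fun x => `|X i j x * X i k x * X i l x * X i m x|%R]
           * 'E_P[fun x => (`|W x t 0| `^ r t)%R]
         + (2 `^ r t / n%:R `^ (r t / 2))%R%:E
           * 'E_P[fun x => (`|X i j x * X i k x * X i l x * X i m x|
                             * `|X i t x| `^ r t)%R]
         + 'E_Q[fun y => (`|Z y t 0| `^ r t)%R]
           * 'E_P[fun x => `|X i j x * X i k x * X i l x * X i m x|%R])
     + 9%:E * `|'E_P[fun x => (X i j x * X i k x)%R]| *
       (A%:E * 'E_P[fun x => `|X i l x * X i m x|%R]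
        + \sum_(t < d) (2 `^ r t * B t)%R%:E *
           ((2 `^ r t)%R%:E
              * 'E_P[fun x => `|X i l x * X i m x|%R]
              * 'E_P[fun x => (`|W x t 0| `^ r t)%R]
            + (2 `^ r t / n%:R `^ (r t / 2))%R%:E
              * 'E_P[fun x => (`|X i l x * X i m x| * `|X i t x| `^ r t)%R]
            + 'E_Q[fun y => (`|Z y t 0| `^ r t)%R]
              * 'E_P[fun x => `|X i l x * X i m x|%R])))%E = (bound_summand i j k l m)%:E.
Proof.
rewrite (expectation_rintegral (integrable_abs4 i j k l m)).
rewrite (expectation_rintegral (integrable_abs2 i l m)).
rewrite (expectation_rintegral (iXX i j k)).
rewrite (eq_bigr (fun t => (2 `^ r t * B t * (2 `^ r t * \int[P]_x abs4 i j k l m x * mean_W t +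
    2 `^ r t / n%:R `^ (r t / 2) * \int[P]_x (abs4 i j k l m x * `|X i t x| `^ r t) +
    mean_Z t * \int[P]_x abs4 i j k l m x))%:E)); last first.
  move=> t _.
  have -> : ('E_P[fun x => (`|W x t 0| `^ r t)%R] = (mean_W t)%:E)%E.
    exact: (expectation_rintegral (integrable_W_pow t)).
  have -> : ('E_Q[fun y => (`|Z y t 0| `^ r t)%R] = (mean_Z t)%:E)%E.
    exact: (expectation_rintegral (integrable_Z_pow t)).
  by rewrite (expectation_rintegral (integrable_abs4_pow i j k l m t)).
rewrite [X in (_ + _ * (_ + X))%E](eq_bigr (fun t => (2 `^ r t * B t * (2 `^ r t * \int[P]_x abs2 i l m x * mean_W t +
    2 `^ r t / n%:R `^ (r t / 2) * \int[P]_x (abs2 i l m x * `|X i t x| `^ r t) +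
    mean_Z t * \int[P]_x abs2 i l m x))%:E)); last first.
  move=> t _.
  have -> : ('E_P[fun x => (`|W x t 0| `^ r t)%R] = (mean_W t)%:E)%E.
    exact: (expectation_rintegral (integrable_W_pow t)).
  have -> : ('E_Q[fun y => (`|Z y t 0| `^ r t)%R] = (mean_Z t)%:E)%E.
    exact: (expectation_rintegral (integrable_Z_pow t)).
  by rewrite (expectation_rintegral (integrable_abs2_pow i l m t)).
by rewrite !sumEFin.
Qed.

Lemma integrable_smooth4_W (f : 'cV[R]_d -> R) C : 0 <= C -> smooth4 f C q ->
  integrable_real P (fun x => f (W x)).
Proof.
move=> C0 fS.
have mW j : measurable_fun setT (fun x => W x j 0).
  rewrite (_ : (fun x => _) = (fun x => row_sum (scaled_row X sn) x j 0)).
    exact: (measurable_row_sum mG (hG sn)).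
  by apply/funext => x; rewrite W_row_sum.
apply: (integrable_le_envelope mG (hG sn) q0 (iscaled sn) (c := `|f 0| + C) (a := q + 1)).
- apply: measurable_norm1_continuous => //.
  exact: (smooth4_continuous C0 q0 fS (s := [::])).
- by rewrite lerD2l ler1n.
- by rewrite addr_ge0.
move=> x; apply: (le_trans (smooth4_growth C0 q0 fS _)).
have e1 := envelope_ge1 (scaled_row X sn) x.
rewrite mulrDl lerD//.
  by rewrite ler_peMr// -[leLHS](powRr0 (envelope (scaled_row X sn) x)) envelope_exp_le// addr_ge0.
rewrite ler_wpM2l//.
have := norm1_row_sum (scaled_row X sn) x; rewrite W_row_sum => h.
have w0 := norm1_ge0 (W x).
by apply: ge0_ler_powR; rewrite ?nnegrE; have := q0; lra.
Qed.

Lemma integrable_smooth4_Z (f : 'cV[R]_d -> R) C : 0 <= C -> smooth4 f C q ->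
  integrable_real Q (fun y => f (Z y)).
Proof.
move=> C0 fS; apply: (integrable_gaussian_image hZ0).
  exact: (smooth4_continuous C0 q0 fS (s := [::])).
exists (`|f 0| + C), (Num.bound (q + 1)); split; first exact: addr_ge0.
move=> v; have v0 := norm1_ge0 v.
apply: (le_trans (smooth4_growth C0 q0 fS _)).
rewrite mulrDl lerD//.
  by rewrite ler_peMr// exprn_ege1// lerDl.
rewrite ler_wpM2l// -powR_mulrn ?addr_ge0// ler_powR ?lerDl//.
by apply: ltW; apply: archi_boundP; rewrite addr_ge0.
Qed.

Let total : R := \sum_i \sum_j \sum_k \sum_l \sum_m bound_summand i j k l m.

Lemma comparison_finite (h : R -> R) (g : 'cV[R]_d -> R) (K : R) :
  Cb 4 h -> CP (growth A B r) 4 g -> hconst 4 h = K%:E ->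
  (`| 'E_P[fun x => h (g (W x))] - 'E_Q[fun y => h (g (Z y))] | <=
   hconst 4 h * ((24 * n%:R ^+ 2)^-1)%R%:E * total%:E)%E.
Proof.
move=> hh hg hK; have [C C0 [fS fK]] := smooth4_comp A0 B0 r0 q0 rq hh hg hK.
have K0 : 0 <= K by rewrite -lee_fin -hK hconst_ge0.
rewrite (expectation_rintegral (integrable_smooth4_W C0 fS)).
rewrite (expectation_rintegral (integrable_smooth4_Z C0 fS)).
by rewrite hK -EFinB abse_EFin -!EFinM lee_fin; exact: (real_comparison C0 K0 fS fK).
Qed.



Let total_eq0 i j k l m : total = 0 -> bound_summand i j k l m = 0.
Proof.
have b0 := bound_summand_ge0.
have s1 i' j' k' l' : 0 <= \sum_m bound_summand i' j' k' l' m by rewrite sumr_ge0.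
have s2 i' j' k' : 0 <= \sum_l \sum_m bound_summand i' j' k' l m by rewrite sumr_ge0.
have s3 i' j' : 0 <= \sum_k \sum_l \sum_m bound_summand i' j' k l m by rewrite sumr_ge0.
have s4 i' : 0 <= \sum_j \sum_k \sum_l \sum_m bound_summand i' j k l m by rewrite sumr_ge0.
move=> /(psumr_eq0P (fun i' _ => s4 i'))/(_ i isT).
move=> /(psumr_eq0P (fun j' _ => s3 i j'))/(_ j isT).
move=> /(psumr_eq0P (fun k' _ => s2 i j k'))/(_ k isT).
move=> /(psumr_eq0P (fun l' _ => s1 i j k l'))/(_ l isT).
by move=> /(psumr_eq0P (fun m' _ => b0 i j k l m'))/(_ m isT).
Qed.

Let mW j : measurable_fun setT (fun x => W x j 0).
Proof.
rewrite (_ : (fun x => _) = (fun x => row_sum (scaled_row X sn) x j 0)).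
  exact: (measurable_row_sum mG (hG sn)).
by apply/funext => x; rewrite W_row_sum.
Qed.

Let mZ j : measurable_fun setT (fun y => Z y j 0).
Proof.
apply: (measurable_gaussian_image Z0 S (F := fun v => v j 0)).
by apply: (norm1_continuous_coord (f := id)) => x; exact: cvg_id.
Qed.

Let mean_W_ge0 t : 0 <= mean_W t.
Proof. by apply: Rintegral_ge0 => x _; exact: powR_ge0. Qed.

Let mean_Z_ge0 t : 0 <= mean_Z t.
Proof. by apply: Rintegral_ge0 => x _; exact: powR_ge0. Qed.

Let abs4_mean_ge0 i j : 0 <= \int[P]_x abs4 i j j j j x.
Proof. by apply: Rintegral_ge0 => x _; exact: normr_ge0. Qed.

Lemma degenerate_bracket i j : total = 0 -> \int[P]_x abs4 i j j j j x != 0 ->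
  A = 0 /\ forall t, B t * mean_W t = 0 /\ B t * mean_Z t = 0.
Proof.
move=> /(total_eq0 i j j j j) b0 un0.
set u := \int[P]_x abs4 i j j j j x in un0.
have u0 : 0 < u by rewrite lt_neqAle eq_sym un0 abs4_mean_ge0.
have {b0} : bracket4 i j j j j = 0.
  apply/eqP; rewrite eq_le bracket4_ge0 andbT -b0 lerDl.
  by apply: mulr_ge0; [exact: mulr_ge0|exact: bracket2_ge0].
rewrite /bracket4 /bracket -/u.
pose v t := \int[P]_x (abs4 i j j j j x * `|X i t x| `^ r t).
have v0 t : 0 <= v t.
  by apply: Rintegral_ge0 => x _; apply: mulr_ge0; [exact: normr_ge0|exact: powR_ge0].
have p2 t : 0 < (2 : R) `^ r t by rewrite powR_gt0.
pose w t := 2 `^ r t * u * mean_W t + 2 `^ r t / n%:R `^ (r t / 2) * v t + mean_Z t * u.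
have w3 t : 0 <= 2 `^ r t * u * mean_W t by rewrite !mulr_ge0 ?(ltW (p2 t)) ?(ltW u0).
have w4 t : 0 <= 2 `^ r t / n%:R `^ (r t / 2) * v t.
  by rewrite !mulr_ge0 ?invr_ge0 ?powR_ge0.
have w5 t : 0 <= mean_Z t * u by rewrite mulr_ge0// ltW.
have Bw t : 0 <= 2 `^ r t * B t * w t.
  by rewrite !mulr_ge0 ?(ltW (p2 t)) ?addr_ge0.
move=> /eqP; rewrite paddr_eq0; last 2 first.
- by rewrite mulr_ge0// ltW.
- by apply: sumr_ge0 => t _; exact: Bw.
rewrite mulf_eq0 (negbTE un0) orbF => /andP[/eqP -> /eqP sB]; split => // t.
have := psumr_eq0P (fun t _ => Bw t) sB; move=> /(_ t isT)/eqP.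
rewrite mulf_eq0 mulf_eq0 (gt_eqF (p2 t)) /= => /orP[/eqP ->|]; first by rewrite !mul0r.
rewrite /w !paddr_eq0 ?addr_ge0// => /andP[/andP[h1 _] h2].
move: h1 h2; rewrite !mulf_eq0 (gt_eqF (p2 t)) (negbTE un0) /= orbF.
by move=> /eqP -> /eqP ->; rewrite !mulr0.
Qed.

Lemma null_rows_zero : (forall i j, \int[P]_x abs4 i j j j j x = 0) ->
  {ae P, forall x, W x = 0} /\ {ae Q, forall y, Z y = 0}.
Proof.
move=> u0; pose F x := \sum_i \sum_j abs4 i j j j j x.
have F1 i x : 0 <= \sum_j abs4 i j j j j x.
  by apply: sumr_ge0 => j _; exact: normr_ge0.
have aeW : {ae P, forall x, W x = 0}.
  have : {ae P, forall x, F x = 0}.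
    apply: ae_zero_of_mean_zero.
    - apply: integrable_real_sum => i; apply: integrable_real_sum => j.
      exact: integrable_abs4.
    - by move=> x; apply: sumr_ge0.
    - rewrite /F rintegral_sum; last first.
        by move=> i; apply: integrable_real_sum => j; exact: integrable_abs4.
      rewrite big1// => i _; rewrite rintegral_sum; last by move=> j; exact: integrable_abs4.
      by rewrite big1.
  apply: filterS => x Fx; apply/colP => t; rewrite !mxE big1 ?mulr0// => i _.
  have := psumr_eq0P (fun i _ => F1 i x) Fx; move=> /(_ i isT) Fi.
  have := psumr_eq0P (fun j _ => normr_ge0 _) Fi; move=> /(_ t isT)/eqP.
  by rewrite /abs4 normr_eq0 !mulf_eq0 !orbb => /eqP.
split=> //.
pose H y := \sum_t Z y t 0 ^+ 2.
have iZ t : integrable_real Q (fun y => Z y t 0 ^+ 2).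
  rewrite (_ : (fun y => _) = (fun y => `|Z y t 0| `^ 2)); first exact: (integrable_gaussian_abs hZ0).
  by apply/funext => y; rewrite (powR_mulrn 2)// real_normK ?num_real.
have Z2 t : \int[Q]_y Z y t 0 ^+ 2 = 0.
  rewrite (gaussian_second_moment hZ0 rootS.1.1) cov_root.
  rewrite -(row_sum_covariance indepX algX mG (hG sn) q0 (iscaled sn) (mean_scaled sn) t t).2.
  transitivity (\int[P]_x (W x t 0 * W x t 0)).
    by apply: eq_Rintegral => x _; rewrite W_row_sum.
  apply: rintegral_expectation; apply: expectation_ae_cst; first exact: measurable_funM.
  by apply: filterS aeW => x ->; rewrite mxE mulr0.
have : {ae Q, forall y, H y = 0}.
  apply: ae_zero_of_mean_zero.
  - exact: integrable_real_sum.
  - by move=> y; apply: sumr_ge0 => t _; exact: sqr_ge0.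
  - by rewrite /H rintegral_sum// big1.
apply: filterS => y Hy; apply/colP => t.
have := psumr_eq0P (fun t _ => sqr_ge0 (Z y t 0)) Hy; move=> /(_ t isT)/eqP.
by rewrite sqrf_eq0 [RHS]mxE => /eqP.
Qed.

Lemma degenerate_comparison (h : R -> R) (g : 'cV[R]_d -> R) :
  Cb 4 h -> CP (growth A B r) 4 g -> total = 0 ->
  ('E_P[fun x => h (g (W x))] = (h (g 0))%:E)%E /\
  ('E_Q[fun y => h (g (Z y))] = (h (g 0))%:E)%E.
Proof.
move=> [hD _] hg t0.
have [aeW aeZ] : {ae P, forall x, g (W x) = g 0} /\ {ae Q, forall y, g (Z y) = g 0}.
  have [u0|] := pselect (forall i j, \int[P]_x abs4 i j j j j x = 0).
    have [aW aZ] := null_rows_zero u0.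
    by split; [apply: filterS aW => x ->|apply: filterS aZ => y ->].
  move=> /existsNP[i /existsNP[j /eqP /(degenerate_bracket t0) [A00 BWZ]]].
  have gr0 (w : 'cV[R]_d) : 0 <= growth A B r w by exact: growth_ge0.
  split.
    have : {ae P, forall x, growth A B r (W x) = 0}.
      apply: ae_zero_of_mean_zero => //.
        apply: integrable_realD; first exact: integrable_real_cst.
        by apply: integrable_real_sum => t; apply: integrable_realZ; exact: integrable_W_pow.
      rewrite rintegralD; last 2 first.
      - exact: integrable_real_cst.
      - by apply: integrable_real_sum => t; apply: integrable_realZ; exact: integrable_W_pow.
      rewrite rintegral_cst A00 add0r rintegral_sum; last first.
        by move=> t; apply: integrable_realZ; exact: integrable_W_pow.
      rewrite big1// => t _; rewrite rintegralZ; last exact: integrable_W_pow.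
      exact: (BWZ t).1.
    by apply: filterS => x; exact: (growth_eq0_const B0 r0 hg).
  have : {ae Q, forall y, growth A B r (Z y) = 0}.
    apply: ae_zero_of_mean_zero => //.
      apply: integrable_realD; first exact: integrable_real_cst.
      by apply: integrable_real_sum => t; apply: integrable_realZ; exact: integrable_Z_pow.
    rewrite rintegralD; last 2 first.
    - exact: integrable_real_cst.
    - by apply: integrable_real_sum => t; apply: integrable_realZ; exact: integrable_Z_pow.
    rewrite rintegral_cst A00 add0r rintegral_sum; last first.
      by move=> t; apply: integrable_realZ; exact: integrable_Z_pow.
    rewrite big1// => t _; rewrite rintegralZ; last exact: integrable_Z_pow.
    exact: (BWZ t).2.
  by apply: filterS => y; exact: (growth_eq0_const B0 r0 hg).
have cg : norm1_continuous g.
  apply: norm1_continuous_lipschitz; first by move=> i w; exact: (hg.1 [::] i w isT).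
  move=> i a; exists ((1 + A + \sum_t B t) * (1 + `|a|) `^ q) => w wa.
  apply: (@le_trans _ _ (1 + growth A B r w)).
    have := hg.2 [:: i] w isT; rewrite divr1 (powR_mulrn 4)// -[partial _ _ _]/(pderiv i g w).
    set p := `|_|; have p0 : 0 <= p by exact: normr_ge0.
    have [p1|p1] := leP p 1.
      by move=> _; rewrite (le_trans p1)// lerDl growth_ge0.
    have : p <= p ^+ 4 by rewrite -[leLHS]expr1 ler_weXn2l// ltW.
    lra.
  have w0 := norm1_ge0 w.
  apply: (le_trans (growth_poly A0 B0 r0 q0 rq w)); apply: ler_wpM2l.
    by rewrite !addr_ge0// sumr_ge0.
  have aa := ler_norm a.
  by apply: ge0_ler_powR; rewrite ?nnegrE//; lra.
have mh : measurable_fun setT h.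
  apply: continuous_measurable_fun => x.
  by apply: differentiable_continuous; apply/derivable1_diffP; exact: (hD 0%N).
split; apply: expectation_ae_cst.
- by apply: (measurableT_comp mh); exact: measurable_norm1_continuous.
- by apply: filterS aeW => x ->.
- by apply: (measurableT_comp mh); exact: measurable_norm1_continuous.
- by apply: filterS aeZ => y ->.
Qed.

Lemma comparison (h : R -> R) (g : 'cV[R]_d -> R) :
  Cb 4 h -> CP (growth A B r) 4 g ->
  (`| 'E_P[fun x => h (g (W x))] - 'E_Q[fun y => h (g (Z y))] | <=
   hconst 4 h * ((24 * n%:R ^+ 2)^-1)%R%:E * total%:E)%E.
Proof.
move=> hh hg; have hK0 := hconst_ge0 h.
have N0 : 0 < (24 * n%:R ^+ 2)^-1 :> R by rewrite invr_gt0 mulr_gt0// exprn_gt0// ltr0n.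
have tot0 : 0 <= total by do 5 (apply: sumr_ge0 => ? _); exact: bound_summand_ge0.
have [hKoo|] := eqVneq (hconst 4 h) +oo%E; last first.
  rewrite -ltey => hKfin.
  have hKE : hconst 4 h = (fine (hconst 4 h))%:E by rewrite fineK// ge0_fin_numE.
  exact: comparison_finite hh hg hKE.
rewrite hKoo gt0_mulye ?lte_fin//.
have [t0|tn0] := eqVneq total 0; last first.
  by rewrite gt0_mulye ?leey// lte_fin lt_neqAle eq_sym tn0.
have [-> ->] := degenerate_comparison hh hg t0.
by rewrite t0 mule0 -EFinB subrr abse0.
Qed.

End model.

Theorem theorem2p5 (R : realType) (n d : nat) (hn : (0 < n)%N) (hd : (0 < d)%N)
  (disp : measure_display) (T : measurableType disp) (P : probability T R)
  (X : 'I_n -> 'I_d -> {RV P >-> R})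
  (disp' : measure_display) (T' : measurableType disp') (Q : probability T' R)
  (Z0 : 'I_d -> {RV Q >-> R})
  (A : R) (B r : 'I_d -> R) (Sroot : 'M[R]_d)
  (W : T -> 'cV[R]_d) (Sigma : 'M[R]_d) (Z : T' -> 'cV[R]_d)
  (hW : W = normalized_sum (fun i j => X i j : T -> R))
  (hSigma : Sigma = covariance_matrix P W)
  (hZ : Z = fun y => Sroot *m random_vector (fun j => Z0 j : T' -> R) y)
  (hA : 0 <= A) (hB : forall t, 0 <= B t) (hr : forall t, 0 <= r t)
  (hmean : forall i j, ('E_P[X i j] = 0)%E)
  (hindep : independent_vectors X)
  (hmom : forall i j k, ('E_P[fun x => (`|X i j x| `^ (r k + 4))%R] < +oo)%E)
  (hpsd : nonneg_definite Sigma)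
  (hroot : nonneg_definite_sqrt Sigma Sroot)
  (hZ0 : standard_normal_vector Z0)
  (hthird : forall i j k l,
    ('E_P[fun x => (X i j x * X i k x * X i l x)%R] = 0)%E)
  (g : 'cV[R]_d -> R) (hg : CP (growth A B r) 4 g)
  (h : R -> R) (hh : Cb 4 h) :
  (`| 'E_P[fun x => h (g (W x))] - 'E_Q[fun y => h (g (Z y))] | <=
   hconst 4 h * ((24 * n%:R ^+ 2)^-1)%R%:E *
   \sum_(i < n) \sum_(j < d) \sum_(k < d) \sum_(l < d) \sum_(m < d)
    (A%:E * 'E_P[fun x => `|X i j x * X i k x * X i l x * X i m x|%R]
     + \sum_(t < d) (2 `^ r t * B t)%R%:E *
        ((2 `^ r t)%R%:E
           * 'E_P[fun x => `|X i j x * X i k x * X i l x * X i m x|%R]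
           * 'E_P[fun x => (`|W x t 0| `^ r t)%R]
         + (2 `^ r t / n%:R `^ (r t / 2))%R%:E
           * 'E_P[fun x => (`|X i j x * X i k x * X i l x * X i m x|
                             * `|X i t x| `^ r t)%R]
         + 'E_Q[fun y => (`|Z y t 0| `^ r t)%R]
           * 'E_P[fun x => `|X i j x * X i k x * X i l x * X i m x|%R])
     + 9%:E * `|'E_P[fun x => (X i j x * X i k x)%R]| *
       (A%:E * 'E_P[fun x => `|X i l x * X i m x|%R]
        + \sum_(t < d) (2 `^ r t * B t)%R%:E *
           ((2 `^ r t)%R%:E
              * 'E_P[fun x => `|X i l x * X i m x|%R]
              * 'E_P[fun x => (`|W x t 0| `^ r t)%R]
            + (2 `^ r t / n%:R `^ (r t / 2))%R%:E
              * 'E_P[fun x => (`|X i l x * X i m x| * `|X i t x| `^ r t)%R]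
            + 'E_Q[fun y => (`|Z y t 0| `^ r t)%R]
              * 'E_P[fun x => `|X i l x * X i m x|%R]))))%E.
Proof.
rewrite hSigma hW in hroot; rewrite hW hZ.
apply: (le_trans (comparison hn hd hA hB hr hmean hindep hmom hthird hroot hZ0 hh hg)).
rewrite le_eqVlt; apply/orP; left; apply/eqP; congr (_ * _)%E.
rewrite -sumEFin; apply: eq_bigr => i _; rewrite -sumEFin; apply: eq_bigr => j _.
rewrite -sumEFin; apply: eq_bigr => k _; rewrite -sumEFin; apply: eq_bigr => l _.
rewrite -sumEFin; apply: eq_bigr => m _; apply/esym.
exact: (bound_summandE A B Sroot hd hr hmom hZ0).
Qed.
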